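(* Assume that $u \in X$, $\operatorname{div} u = 0$ and $\omega = \partial_1 u_2 - \partial_2 u_1 \in L^\infty(\mathbb{R}^2)$. Let $\chi \in C_c^\infty(\mathbb{R}^2)$ be a cut-off function which is equal to $1$ on a neighborhood of the origin, let $\chi^c = 1 - \chi$, and for $z\neq0$ and $k,\ell\in\{1,2\}$ let $$M_{k\ell}(z) = \frac{2z_k \partial_\ell\chi(z) - \delta_{k\ell}\bigl(z_1\partial_1\chi(z) + z_2\partial_2\chi(z)\bigr)}{|z|^2}, \qquad K_{k\ell}(z) = \frac{2z_kz_\ell - |z|^2\delta_{k\ell}}{|z|^4}.$$ If $q \in \mathrm{BMO}(\mathbb{R}^2)$ is a solution to $-\Delta q = \operatorname{div}(u^\perp\omega)$ in $\mathbb{R}^2$, then for any $x_0 \in \mathbb{R}^2$ there exists $q_0\in\mathbb{R}$ such that $$q(x) = q_0 + q_1(x) + q_2(x) + q_3(x,x_0), \qquad x \in \mathbb{R}^2,$$ where $$q_1(x) = \frac{1}{2\pi}\int_{\mathbb{R}^2} \chi(x-y) \frac{(x-y)^\perp}{|x-y|^2}\cdot u(y)\,\omega(y)\,dy,$$ $$q_2(x) = \frac{1}{4\pi}\sum_{k,\ell=1}^2\int_{\mathbb{R}^2} M_{k\ell}(x-y)u_k(y)u_\ell(y)\,dy,$$ $$q_3(x,x_0) = \frac{1}{2\pi}\sum_{k,\ell=1}^2\int_{\mathbb{R}^2} \Bigl\{\chi^c(x-y)K_{k\ell}(x-y) - \chi^c(x_0-y)K_{k\ell}(x_0-y)\Bi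gr\}u_k(y)u_\ell(y)\,dy.$$
   Context: $X$ is the space of bounded, uniformly continuous vector fields $u:\mathbb{R}^2\to\mathbb{R}^2$. $\operatorname{div} u=\partial_1u_1+\partial_2u_2$; derivatives and the equation for $q$ are understood in the sense of distributions. For $z=(z_1,z_2)\in\mathbb{R}^2$, $z^\perp=(-z_2,z_1)$; in particular $u^\perp=(-u_2,u_1)$. $\mathrm{BMO}(\mathbb{R}^2)$ is the space of functions of bounded mean oscillation (elements are identified with functions up to equality almost everywhere). $\delta_{k\ell}$ is the Kronecker symbol. *)

(* Defs.v *)
From HB Require Import structures.
From mathcomp Require Import all_boot all_order all_algebra.
From mathcomp Require Import all_classical all_reals all_analysis.

Set Implicit Arguments.
Unset Strict Implicit.
Unset Printing Implicit Defensive.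

Import Order.TTheory GRing.Theory Num.Theory.
Import numFieldNormedType.Exports.

Local Open Scope classical_set_scope.
Local Open Scope ring_scope.

Section Plane.
Context {R : realType}.
Implicit Types (x y z w c : R * R) (f g phi chi omega : R * R -> R).
Implicit Types (u v : R * R -> R * R) (k l : 'I_2).

Definition coord k z : R := if k == ord0 then z.1 else z.2.

Definition basis k : R * R := if k == ord0 then (1, 0) else (0, 1).

Definition dot z w : R := z.1 * w.1 + z.2 * w.2.

(* The library norm on [R * R] is the max norm, so the squared Euclidean norm
   is spelled out. *)
Definition sqnorm z : R := dot z z.

Definition perp z : R * R := (- z.2, z.1).

(* [measurableTypeR R] is [R] with its Borel sigma-algebra. *)
Definition leb2 :
    {measure set (measurableTypeR R * measurableTypeR R) -> \bar R} :=
  (@lebesgue_measure R \x @lebesgue_measure R)%E.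

Definition partial k f : R * R -> R := fun z => 'D_(basis k) f z.

(* [foldr partial f s] is the iterated partial derivative of [f] along the
   multi-index listed by [s]. *)
Definition smooth f : Prop := forall s : seq 'I_2,
  continuous (foldr partial f s) /\
  forall k z, derivable (foldr partial f s) z (basis k).

Definition test_function f : Prop :=
  smooth f /\ compact (closure [set z | f z != 0]).

Definition buc u : Prop := bounded_fun u /\ unif_continuous u.

(* Distributions are represented by functionals, of which only the values on
   test functions matter: see [distr_eq]. *)
Definition functional : Type := (R * R -> R) -> R.

Definition distr_eq (S T : functional) : Prop :=
  forall phi, test_function phi -> S phi = T phi.

Definition distr_of f : functional := fun phi => \int[leb2]_y (f y * phi y).

Definition dpartial k (T : functional) : functional :=
  fun phi => - T (partial k phi).

Definition ddiv v : functional :=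
  fun phi => \sum_(k < 2) dpartial k (distr_of (coord k \o v)) phi.

Definition dcurl v : functional :=
  fun phi => dpartial ord0 (distr_of (coord ord_max \o v)) phi
           - dpartial ord_max (distr_of (coord ord0 \o v)) phi.

Definition dlaplacian f : functional :=
  fun phi => \sum_(k < 2) dpartial k (dpartial k (distr_of f)) phi.

Definition disk c (r : R) : set (R * R) := [set z | sqnorm (z - c) < r ^+ 2].

Definition average f (B : set (R * R)) : R :=
  (\int[leb2]_(y in B) f y) / fine (leb2 B).

(* Integrability on a set includes measurability there; together the disks
   cover the plane, so [f] is measurable and locally integrable. *)
Definition BMO f : Prop :=
  (forall c (r : R), 0 < r -> leb2.-integrable (disk c r) (EFin \o f)) /\
  exists C : R, forall c (r : R), 0 < r ->
    average (fun y => `|f y - average f (disk c r)|) (disk c r) <= C.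

(* In the kernels below division by zero gives zero; for [chi] equal to 1 near
   the origin this only matters for [q1_integrand], on the null set [y = x]. *)
Definition M_kernel chi k l z : R :=
  (2 * coord k z * partial l chi z
   - (k == l)%:R * (z.1 * partial ord0 chi z + z.2 * partial ord_max chi z))
  / sqnorm z.

Definition K_kernel k l z : R :=
  (2 * coord k z * coord l z - sqnorm z * (k == l)%:R) / sqnorm z ^+ 2.

Definition q1_integrand chi u omega x y : R :=
  chi (x - y) * (dot (perp (x - y)) (u y) / sqnorm (x - y)) * omega y.

Definition q2_integrand chi u k l x y : R :=
  M_kernel chi k l (x - y) * coord k (u y) * coord l (u y).

Definition q3_integrand chi u x0 k l x y : R :=
  ((1 - chi (x - y)) * K_kernel k l (x - y)
   - (1 - chi (x0 - y)) * K_kernel k l (x0 - y))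
  * coord k (u y) * coord l (u y).

Definition q1 chi u omega x : R :=
  (2 * pi)^-1 * \int[leb2]_y q1_integrand chi u omega x y.

Definition q2 chi u x : R :=
  (4 * pi)^-1 *
  \sum_(k < 2) \sum_(l < 2) \int[leb2]_y q2_integrand chi u k l x y.

Definition q3 chi u x x0 : R :=
  (2 * pi)^-1 *
  \sum_(k < 2) \sum_(l < 2) \int[leb2]_y q3_integrand chi u x0 k l x y.

(* The integrals defining [q1], [q2] and [q3] converge absolutely; otherwise
   the library integral would only return a conventional value. *)
Definition integrals_converge chi u omega x x0 : Prop :=
  [/\ leb2.-integrable setT (EFin \o q1_integrand chi u omega x),
      forall k l, leb2.-integrable setT (EFin \o q2_integrand chi u k l x) &
      forall k l, leb2.-integrable setT (EFin \o q3_integrand chi u x0 k l x)].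

End Plane.

(* Main.v *)
Require Import Defs.
From HB Require Import structures.
From mathcomp Require Import all_boot all_order all_algebra.
From mathcomp Require Import all_classical all_reals all_analysis.
From mathcomp Require Import measurable_realfun ess_sup_inf ring lra.

(** Let [w] be the field [omega *: perp u] and [pker] the gradient of the
    logarithm of the Euclidean norm. Formally [2 * pi * q] is minus the sum of
    the convolutions of the components of [w] with those of [pker]. These
    convolutions need not converge, so the logarithm is replaced by a smooth
    function [Et] that agrees with it away from the origin
    ([potential_exists]); its Laplacian is a test function of integral
    [2 * pi] ([Int_LapEt]).

    Testing the equation for [q] against the difference of [Et] at two scales,
    and letting the finer one shrink, identifies [2 * pi * q] almost everywhere
    with a function [pressure] defined at every point: the convolution of [q]
    with the Laplacian of [Et], plus convolutions of the bounded field [w] with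
    integrable kernels ([pressure_ae]).

    Testing against the truncation of [Et] at a large scale [s] splits the
    gradient of the potential into [chi * pker], which yields [q1], and a field
    of test functions. On the latter, [w] is the divergence of the matrix with
    entries [u_k * u_l] up to a gradient, because [u] is solenoidal; this is
    proved by mollification ([vorticity_identity]). After the integration by
    parts, the derivative falls either on the gradient of [Et], where it gives
    [K_kernel], or on the cut-off, where it gives [M_kernel] ([pressure_split]).

    Two terms remain: [q] against a test function dilated by [s], and the
    products [u_k * u_l] against a dilated kernel that is homogeneous of degree
    [-2] far out. Only their increments between two points are small, of order
    [s^-1]. For [q], the increment of the dilated test function has zero mean,
    is of size [s ^- 3] and lives on a disk of radius of order [s], where the
    mean oscillation of [q] is bounded ([osc_increment]). For the homogeneous
    kernel, increments are of order [-3] at infinity, hence integrable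
    ([homog_increment]). Letting [s] tend to infinity gives the formula up to
    an additive constant ([pressure_increment]). *)

Import Defs Order.TTheory GRing.Theory Num.Theory.
Import numFieldNormedType.Exports.
Local Open Scope classical_set_scope.
Local Open Scope ring_scope.
Set Implicit Arguments.
Unset Strict Implicit.
Unset Printing Implicit Defensive.

(** * Lebesgue measure of the plane *)

Section PlaneMeasure.
Context {R : realType}.
Notation P := (measurableTypeR R * measurableTypeR R)%type.
Implicit Types (f g : R * R -> R) (x y z c : R * R) (a r : R).

Definition integ f : Prop := (@leb2 R).-integrable setT (EFin \o f).

Lemma ball_prodE c r : ball c r = ball c.1 r `*` ball c.2 r.
Proof. by rewrite predeqE => -[u v]; split. Qed.

(** The Borel sets of the product topology are those of the product
    sigma-algebra because the topology has a countable basis of squares. *)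
Lemma open_measurable_plane (U : set (R * R)) :
  open U -> measurable (U : set P).
Proof.
move=> oU.
pose F (k : rat * rat * nat) : set (R * R) :=
  let B := ball (ratr k.1.1 : R, ratr k.1.2 : R) k.2.+1%:R^-1 in
  if `[< B `<=` U >] then B else set0.
have -> : U = \bigcup_k F k.
  rewrite predeqE => z; split; last first.
    by move=> [k _]; rewrite /F; case: asboolP => // BU Bz; exact: BU.
  move=> Uz.
  have /nbhs_ballP[e /= e0 eU] : nbhs z U by exact: open_nbhs_nbhs.
  have [n] : exists n : nat, n.+1%:R^-1 < e / 2.
    near \oo%classic => n; exists n; near: n.
    exact: (near_infty_natSinv_lt (PosNum (divr_gt0 e0 (ltr0n _ 2)))).
  move=> ne.
  have n0 : 0 < n.+1%:R^-1 :> R by rewrite invr_gt0.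
  have H t : exists k : rat, `|t - ratr k| < n.+1%:R^-1 :> R.
    have ne0 : ball t n.+1%:R^-1 !=set0 by exists t; exact: ballxx.
    have [w [/= tk [k _ kw]]] := dense_rat ne0 (@ball_open _ _ t _).
    by exists k; move: tk; rewrite -kw -ball_normE.
  have [k1 Hk1] := H z.1; have [k2 Hk2] := H z.2.
  exists (k1, k2, n) => //; rewrite /F /=; case: asboolP => [_|[]].
    by split; rewrite -ball_normE /= distrC.
  move=> w [w1 w2]; move: w1 w2; rewrite -!ball_normE /= => w1 w2; apply: eU.
  rewrite ball_prodE; split; rewrite -ball_normE /=.
    apply: (le_lt_trans (ler_distD (ratr k1) _ _)).
    by rewrite (splitr e); apply: ltrD; [exact: lt_trans Hk1 ne|exact: lt_trans w1 ne].
  apply: (le_lt_trans (ler_distD (ratr k2) _ _)).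
  by rewrite (splitr e); apply: ltrD; [exact: lt_trans Hk2 ne|exact: lt_trans w2 ne].
apply: countable_bigcupT_measurable => [|k]; first exact: countableP.
rewrite /F; case: asboolP => // _.
rewrite ball_prodE /=; apply: measurableX; exact: measurable_ball.
Unshelve. all: by end_near. Qed.

Lemma continuous_measurable_plane f :
  continuous f -> measurable_fun setT (f : P -> R).
Proof.
move=> /continuousP cf.
apply: (measurability _ (RGenOpens.measurableE R)) => _ [_ [a [b ->]] <-].
rewrite setTI; apply: open_measurable_plane; apply: cf; exact: interval_open.
Qed.

Lemma measurable_affine1 a (c : R) :
  measurable_fun setT (fun t : measurableTypeR R => a * t + c : measurableTypeR R).
Proof.
apply: (@measurable_funD _ _ _ setT (fun t => a * t) (cst c)) => //.
exact: measurable_funM.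
Qed.

Definition affine a c z : R * R := (a * z.1 + c.1, a * z.2 + c.2).

Lemma affine0E a z : affine a 0 z = a *: z.
Proof. by rewrite /affine !addr0; apply/pair_equal_spec. Qed.

Lemma measurable_affine a c :
  measurable_fun setT (affine a c : P -> P).
Proof.
apply: measurable_fun_pair => /=.
  by apply: (@measurableT_comp _ _ _ _ _ _ (fun t => a * t + c.1)) => //;
    exact: measurable_affine1.
by apply: (@measurableT_comp _ _ _ _ _ _ (fun t => a * t + c.2)) => //;
  exact: measurable_affine1.
Qed.

(** Both sides are measures of [A] that agree on half-open intervals. *)
Lemma lebesgue_affine a (c : R) (A : set (measurableTypeR R)) :
  a != 0 -> measurable A ->
  (@lebesgue_measure R ((fun t : R => (a * t + c)%R) @^-1` A) =
   `|a|^-1%:E * @lebesgue_measure R A)%E.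
Proof.
move=> a0 mA.
have na0 : 0 < `|a| by rewrite normr_gt0.
have N0 : 0 <= `|a| by [].
pose phi : measurableTypeR R -> measurableTypeR R := fun t => a * t + c.
have mphi : measurable_fun setT phi by exact: measurable_affine1.
pose m : {measure set (measurableTypeR R) -> \bar R} :=
  mscale (NngNum N0) (pushforward (@lebesgue_measure R) phi).
suff H : (@lebesgue_measure R A = m mphi A)%E.
  rewrite H /= /mscale /= /pushforward muleA -EFinM mulVf ?gt_eqF//.
  by rewrite mul1e.
apply: lebesgue_measure_unique => // _ [[u v] /= uv <-].
rewrite /mscale /= /pushforward /=.
rewrite lebesgue_measure_itv /= lte_fin.
have [a_gt0|a_le0] := ltP 0 a.
  have -> : phi @^-1` `]u, v] = `](u - c) / a, (v - c) / a]%classic.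
    rewrite predeqE => t /=; rewrite !in_itv /= ltr_pdivrMr// ler_pdivlMr// /phi.
    by rewrite ltrBlDr lerBrDr [t * a]mulrC.
  rewrite lebesgue_measure_itv /= lte_fin ltr_pM2r ?invr_gt0// ltrD2r.
  case: ifPn => _; last by rewrite mule0.
  by rewrite gtr0_norm// -!EFinB -EFinM; congr EFin; field.
have a_lt0 : a < 0 by rewrite lt_neqAle a0.
have -> : phi @^-1` `]u, v] = `[(v - c) / a, (u - c) / a[%classic.
  rewrite predeqE => t /=; rewrite !in_itv /= ltr_ndivlMr// ler_ndivrMr// /phi.
  by rewrite ltrBlDr lerBrDr [t * a]mulrC andbC.
rewrite lebesgue_measure_itv /= lte_fin ltr_nM2r ?invr_lt0// ltrD2r.
case: ifPn => _; last by rewrite mule0.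
by rewrite ltr0_norm// -!EFinB -EFinM; congr EFin; field.
Qed.

(** A measure on the plane is determined by its values on rectangles. *)
Lemma leb2_affine a c (A : set P) : a != 0 -> measurable A ->
  (@leb2 R A = (`|a| ^+ 2)%:E * @leb2 R (affine a c @^-1` A))%E.
Proof.
move=> a0 mA.
have na0 : `|a| != 0 by rewrite normr_eq0.
have N0 : 0 <= `|a| ^+ 2 by rewrite exprn_ge0.
pose phi : P -> P := affine a c.
have mphi : measurable_fun setT phi by exact: measurable_affine.
pose m : {measure set P -> \bar R} :=
  mscale (NngNum N0) (pushforward (@leb2 R) phi).
have -> : ((`|a| ^+ 2)%:E * @leb2 R (affine a c @^-1` A) = m mphi A)%E by [].
apply: product_measure_unique => //= B C mB mC.
rewrite /mscale /= /pushforward /= /leb2.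
have -> : affine a c @^-1` (B `*` C) =
    ((fun t : R => a * t + c.1) @^-1` B) `*` ((fun t : R => a * t + c.2) @^-1` C).
  by rewrite predeqE => -[].
rewrite [X in (_ * X)%E]product_measure1E; last 2 first.
- by rewrite -[X in measurable X]setTI; exact: measurable_affine1.
- by rewrite -[X in measurable X]setTI; exact: measurable_affine1.
transitivity ((`|a| ^+ 2)%:E * (((`|a|^-1)%:E * @lebesgue_measure R B) *
    ((`|a|^-1)%:E * @lebesgue_measure R C)))%E.
  by congr (_ * (_ * _))%E; exact: lebesgue_affine.
move: (lebesgue_measure B) (lebesgue_measure C) => p q.
have K : `|a| ^+ 2 * (`|a|^-1 * `|a|^-1) = 1 by field.
by rewrite (muleACA _%:E p) -EFinM (muleA _%:E _%:E) -EFinM K mul1e.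
Qed.

Lemma integral_affine a c (F : P -> \bar R) : a != 0 ->
  measurable_fun setT F -> (forall z, 0 <= F z)%E ->
  (\int[@leb2 R]_z F z = (`|a| ^+ 2)%:E * \int[@leb2 R]_z F (affine a c z))%E.
Proof.
move=> a0 mF F0.
have N0 : 0 <= `|a| ^+ 2 by rewrite exprn_ge0.
pose phi : P -> P := affine a c.
have mphi : measurable_fun setT phi by exact: measurable_affine.
pose pm : {measure set P -> \bar R} := pushforward (@leb2 R) phi.
pose m : {measure set P -> \bar R} := mscale (NngNum N0) (pm mphi).
transitivity (\int[m]_z F z)%E.
  by apply: eq_measure_integral => A mA _; exact: (leb2_affine c a0 mA).
transitivity ((`|a| ^+ 2)%:E * \int[pm mphi]_z F z)%E.
  exact: (@ge0_integral_mscale _ _ _ (pm mphi) setT measurableT (NngNum N0) F mF (fun z _ => F0 z)).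
have := ge0_integral_pushforward mphi (@leb2 R) measurableT mF (fun z _ => F0 z).
by rewrite preimage_setT => <-.
Qed.

Lemma measurable_comp_affine a c f : measurable_fun setT (f : P -> R) ->
  measurable_fun setT ((f \o affine a c) : P -> R).
Proof. by move=> mf; apply: measurableT_comp => //; exact: measurable_affine. Qed.

Lemma integ_affine a c f : a != 0 -> integ f -> integ (f \o affine a c).
Proof.
move=> a0 /integrableP[/measurable_EFinP mf foo]; apply/integrableP; split.
  by apply/measurable_EFinP; exact: measurable_comp_affine.
move: foo; rewrite (integral_affine c a0) //; last first.
  by apply: measurableT_comp => //; exact/measurable_EFinP.
have : (0 < (`|a| ^+ 2)%:E)%E by rewrite lte_fin exprn_gt0// normr_gt0.
move=> H /= foo; rewrite ltey; apply/eqP => E; move: foo.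
by rewrite E gt0_muley.
Qed.

Lemma Rintegral_affine a c f : a != 0 -> integ f ->
  \int[@leb2 R]_z f (affine a c z) = (`|a| ^+ 2)^-1 * \int[@leb2 R]_z f z.
Proof.
move=> a0 intf.
have na0 : `|a| ^+ 2 != 0 by rewrite expf_neq0// normr_eq0.
have mf : measurable_fun setT (f : P -> R).
  by case/integrableP : intf => /measurable_EFinP.
have intfa := integ_affine c a0 intf.
have Hp : (\int[@leb2 R]_z (EFin \o f)^\+ z = (`|a| ^+ 2)%:E *
    \int[@leb2 R]_z (EFin \o (f \o affine a c))^\+ z)%E.
  rewrite (_ : (EFin \o (f \o affine a c))^\+%E = (EFin \o f)^\+%E \o affine a c).
    rewrite (integral_affine c a0)//.
    exact/measurable_funepos/measurable_EFinP.
  by rewrite -funepos_comp.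
have Hn : (\int[@leb2 R]_z (EFin \o f)^\- z = (`|a| ^+ 2)%:E *
    \int[@leb2 R]_z (EFin \o (f \o affine a c))^\- z)%E.
  rewrite (_ : (EFin \o (f \o affine a c))^\-%E = (EFin \o f)^\-%E \o affine a c).
    rewrite (integral_affine c a0)//.
    exact/measurable_funeneg/measurable_EFinP.
  by rewrite -funeneg_comp.
have fp : (\int[@leb2 R]_z (EFin \o (f \o affine a c))^\+ z)%E \is a fin_num.
  exact: (integrable_pos_fin_num measurableT intfa).
have fn : (\int[@leb2 R]_z (EFin \o (f \o affine a c))^\- z)%E \is a fin_num.
  exact: (integrable_neg_fin_num measurableT intfa).
have -> : \int[@leb2 R]_z f (affine a c z) =
    fine (\int[@leb2 R]_z (EFin \o (f \o affine a c))^\+ z) -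
    fine (\int[@leb2 R]_z (EFin \o (f \o affine a c))^\- z).
  by rewrite -fineB// -integralE.
have -> : \int[@leb2 R]_z f z =
    fine (\int[@leb2 R]_z (EFin \o f)^\+ z) -
    fine (\int[@leb2 R]_z (EFin \o f)^\- z).
  rewrite -fineB//; first by rewrite -integralE.
    exact: (integrable_pos_fin_num measurableT intf).
  exact: (integrable_neg_fin_num measurableT intf).
by rewrite Hp Hn !fineM// -mulrBr mulrA mulVf// mul1r.
Qed.

End PlaneMeasure.

(** * Smooth functions on the plane *)

Section Smooth.
Context {R : realType}.
Implicit Types (f g : R * R -> R) (x y z c : R * R) (a r : R) (k l : 'I_2).

Lemma ord2P (Q : 'I_2 -> Prop) : Q ord0 -> Q ord_max -> forall k, Q k.
Proof.
move=> Q0 Q1 [[|[|//]] i]; first by rewrite (_ : Ordinal i = ord0)//; exact: val_inj.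
by rewrite (_ : Ordinal i = ord_max)//; exact: val_inj.
Qed.

Lemma sum_ord2 (F : 'I_2 -> R) : \sum_(k < 2) F k = F ord0 + F ord_max.
Proof.
by rewrite !big_ord_recl big_ord0 addr0; congr (_ + F _); exact: val_inj.
Qed.

Lemma normE z : `|z| = Num.max `|z.1| `|z.2|.
Proof. by []. Qed.

Lemma norm_le z r : (`|z| <= r) = (`|z.1| <= r) && (`|z.2| <= r).
Proof. by rewrite normE ge_max. Qed.

Lemma coord_le k z : `|coord k z| <= `|z|.
Proof. by move: k; apply: ord2P; rewrite normE le_max lexx ?orbT. Qed.

(** The line through [z] parallel to the [k]-th axis, parametrized by its
    [k]-th coordinate: partial derivatives become derivatives on the line. *)
Definition slice k z (t : R) : R * R := if k == ord0 then (t, z.2) else (z.1, t).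

Lemma slice_coord k z : slice k z (coord k z) = z.
Proof. by case: z => z1 z2; move: k; apply: ord2P. Qed.

Lemma coord_slice k l z (t : R) : coord l (slice k z t) = if l == k then t else coord l z.
Proof. by move: k l; apply: ord2P; apply: ord2P. Qed.

Lemma slice_shift k z (t : R) : slice k z (t + coord k z) = t *: basis k + z.
Proof.
case: z => z1 z2; move: k; apply: ord2P; apply/pair_equal_spec; split => /=.
- by rewrite [t *: 1]mulr1.
- by rewrite [t *: 0]mulr0 add0r.
- by rewrite [t *: 0]mulr0 add0r.
- by rewrite [t *: 1]mulr1.
Qed.

Lemma slice_quotient f k z :
  (fun h : R => h^-1 *: (f (h *: basis k + z) - f z)) =
  (fun h : R => h^-1 *: ((f \o slice k z) (h *: 1 + coord k z) -
                         (f \o slice k z) (coord k z))).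
Proof.
by rewrite funeqE => h /=; rewrite slice_coord -slice_shift [h *: 1]mulr1.
Qed.

Lemma is_derive_slice f k z df :
  is_derive (coord k z) 1 (f \o slice k z) df <-> is_derive z (basis k) f df.
Proof.
split=> -[d e]; apply: DeriveDef.
- by move: d; rewrite /derivable slice_quotient.
- by move: e; rewrite /derive slice_quotient.
- by move: d; rewrite /derivable slice_quotient.
- by move: e; rewrite /derive slice_quotient.
Qed.

Definition pderivable f : Prop := forall k z, derivable f z (basis k).

Lemma partialP f k z : pderivable f -> is_derive z (basis k) f (partial k f z).
Proof. by move=> df; apply: derivableP; exact: df. Qed.
Arguments partialP [f] k z _.

Lemma partial_slice f k z (t : R) : pderivable f ->
  is_derive t 1 (f \o slice k z) (partial k f (slice k z t)).
Proof.
move=> df; have /is_derive_slice := partialP k (slice k z t) df.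
rewrite coord_slice eqxx (_ : slice k (slice k z t) = slice k z)//.
by rewrite funeqE => s; move: k; apply: ord2P.
Qed.

Lemma pderivable_of f (df : 'I_2 -> R * R -> R) :
  (forall k z, is_derive z (basis k) f (df k z)) ->
  pderivable f /\ forall k, partial k f = df k.
Proof.
move=> H; split=> [k z|k]; first by have [] := H k z.
by rewrite funeqE => z; have [_ ] := H k z.
Qed.

(** Continuity of the partial derivatives up to order [n]: the closure properties
    of [smooth] are proved by induction on the order. *)
Fixpoint Cn n f : Prop :=
  continuous f /\
  if n is n'.+1 then pderivable f /\ forall k, Cn n' (partial k f) else True.

Lemma Cn_continuous n f : Cn n f -> continuous f.
Proof. by case: n => [|n] []. Qed.

Lemma CnS n f : Cn n.+1 f -> Cn n f.
Proof.
elim: n f => [|n IH] f; first by move=> [].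
by move=> [cf [df pf]]; split => //; split => // k; exact/IH/pf.
Qed.

Lemma smooth_partial k f : smooth f -> smooth (partial k f).
Proof. by move=> sf s; rewrite -foldr_rcons; exact: sf. Qed.

Lemma smooth_continuous f : smooth f -> continuous f.
Proof. by move=> /(_ [::]) []. Qed.

Lemma smooth_pderivable f : smooth f -> pderivable f.
Proof. by move=> /(_ [::]) []. Qed.

Lemma smoothP f : smooth f <-> forall n, Cn n f.
Proof.
split=> [sf n|].
  elim: n f sf => [|n IH] f sf; split => //; do ?exact: smooth_continuous.
  split; first exact: smooth_pderivable.
  by move=> k; apply: IH; exact: smooth_partial.
move=> H s; elim/last_ind: s f H => [|s k IH] f H /=.
  by split; [exact: (Cn_continuous (H 0%N))|have [_ []] := H 1%N].
by rewrite foldr_rcons; apply: IH => n; have [_ [_ ]] := H n.+1; apply.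
Qed.

Lemma partial_cst (c : R) k : partial k (fun _ => c : R) = fun _ => 0.
Proof. by rewrite /partial funeqE => z; rewrite derive_cst. Qed.

Lemma Cn_cst n (c : R) : Cn n (fun _ => c).
Proof.
elim: n c => [|n IH] c; split => //; try by move=> z; exact: cvg_cst.
split=> [k z|k]; first exact: derivable_cst.
by rewrite partial_cst; exact: IH.
Qed.

Lemma partialD f g k : pderivable f -> pderivable g ->
  partial k (fun z => f z + g z) = fun z => partial k f z + partial k g z.
Proof. by move=> df dg; rewrite /partial funeqE => z; exact: deriveD. Qed.

Lemma partialN f k : pderivable f ->
  partial k (fun z => - f z) = fun z => - partial k f z.
Proof. by move=> df; rewrite /partial funeqE => z; exact: deriveN. Qed.

Lemma partialM f g k : pderivable f -> pderivable g ->
  partial k (fun z => f z * g z) =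
  fun z => partial k f z * g z + f z * partial k g z.
Proof.
move=> df dg; rewrite /partial funeqE => z.
by rewrite [LHS](deriveM (df _ _) (dg _ _)) addrC [X in X + _]mulrC.
Qed.

Lemma Cn_add n f g : Cn n f -> Cn n g -> Cn n (fun z => f z + g z).
Proof.
elim: n f g => [|n IH] f g [cf Hf] [cg Hg]; split => //.
- by move=> z; apply: cvgD; [exact: cf|exact: cg].
- by move=> z; apply: cvgD; [exact: cf|exact: cg].
move: Hf Hg => [df pf] [dg pg]; split=> [k z|k]; first exact: derivableD.
by rewrite partialD//; apply: IH; [exact: pf|exact: pg].
Qed.

Lemma Cn_mul n f g : Cn n f -> Cn n g -> Cn n (fun z => f z * g z).
Proof.
elim: n f g => [|n IH] f g Hf Hg.
  by split => // z; apply: cvgM; [exact: Hf.1|exact: Hg.1].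
have [cf [df pf]] := Hf; have [cg [dg pg]] := Hg; split.
  by move=> z; apply: cvgM; [exact: cf|exact: cg].
split=> [k z|k]; first exact: derivableM.
rewrite partialM//; apply: Cn_add.
  by apply: IH; [exact: pf|exact: CnS].
by apply: IH; [exact: CnS|exact: pg].
Qed.

Lemma is_derive_inv f k z df : f z != 0 -> is_derive z (basis k) f df ->
  is_derive z (basis k) (fun w => (f w)^-1) (- df * ((f z)^-1 * (f z)^-1)).
Proof.
move=> fz [d e]; apply: DeriveDef; first exact: derivableV.
by rewrite deriveV// e /GRing.scale /= expr2 invfM mulNr mulNr mulrC.
Qed.

Lemma Cn_inv n f : (forall z, f z != 0) -> Cn n f -> Cn n (fun z => (f z)^-1).
Proof.
move=> f0; elim: n => [|n IH] Hf.
  by split => // z; apply: cvgV => //; exact: Hf.1.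
have [cf [df pf]] := Hf; split; first by move=> z; apply: cvgV => //; exact: cf.
have [D E] := pderivable_of (fun k z => is_derive_inv (f0 z) (partialP k z df)).
split => // k; rewrite E; apply: Cn_mul.
  rewrite (_ : (fun _ => _) = fun z => (-1) * partial k f z).
    by apply: Cn_mul; [exact: Cn_cst|exact: pf].
  by rewrite funeqE => z; rewrite mulN1r.
by apply: Cn_mul; apply: IH; exact: CnS.
Qed.

Lemma is_derive_ln f k z df : 0 < f z -> is_derive z (basis k) f df ->
  is_derive z (basis k) (fun w => ln (f w)) (df * (f z)^-1).
Proof.
move=> fz /is_derive_slice H; apply/is_derive_slice; rewrite mulrC.
apply: (@is_derive1_comp _ (@ln R) (f \o slice k z)) => //=.
by rewrite slice_coord; exact: is_derive1_ln.
Qed.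

Lemma Cn_ln n f : (forall z, 0 < f z) -> Cn n f -> Cn n (fun z => ln (f z)).
Proof.
move=> f0; have f0' z : f z != 0 by rewrite gt_eqF.
have cl : continuous f -> continuous (fun z => ln (f z)).
  move=> cf z; apply: (@continuous_comp _ _ _ f (@ln R)); first exact: cf.
  exact: continuous_ln.
case: n => [|n] Hf; first by split => //; apply: cl; exact: Hf.1.
have [cf [df pf]] := Hf; split; first exact: cl.
have [D E] := pderivable_of (fun k z => is_derive_ln (f0 z) (partialP k z df)).
split => // k; rewrite E; apply: Cn_mul; first exact: pf.
by apply: Cn_inv => //; exact: CnS.
Qed.

Lemma is_derive_coord k l z : is_derive z (basis k) (@coord R l) (k == l)%:R.
Proof.
apply/is_derive_slice.
rewrite (_ : _ \o _ = if l == k then id else cst (coord l z)).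
  have -> : (k == l) = (l == k) by rewrite eq_sym.
  case: (l == k) => /=; rewrite ?mulr1n ?mulr0n.
    exact: is_derive_id.
  exact: is_derive_cst.
by rewrite funeqE => t /=; rewrite coord_slice; case: ifP.
Qed.

Lemma Cn_coord n l : Cn n (@coord R l).
Proof.
have cc : continuous (@coord R l).
  by move: l; apply: ord2P => z; [exact: cvg_fst|exact: cvg_snd].
have [D E] := pderivable_of (fun k z => is_derive_coord k l z).
case: n => [|n]; split => //; split => // k; rewrite E; exact: Cn_cst.
Qed.

Lemma is_derive_affine f k a c z df :
  is_derive (affine a c z) (basis k) f df ->
  is_derive z (basis k) (f \o affine a c) (a * df).
Proof.
move=> /is_derive_slice H; apply/is_derive_slice; rewrite mulrC.
rewrite (_ : _ \o slice k z =
    (f \o slice k (affine a c z)) \o (fun t => a * t + coord k c)); last first.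
  by rewrite funeqE => t; clear H; move: k; apply: ord2P.
have E : coord k (affine a c z) = a * coord k z + coord k c.
  by clear H; move: k; apply: ord2P.
apply: is_derive1_comp; first by rewrite -E.
have D1 : is_derive (coord k z) (1 : R) (a *: id) (a *: (1 : R)).
  by apply: is_deriveZ.
have := is_deriveD D1 (is_derive_cst (coord k c) (coord k z) (1 : R)).
by rewrite addr0 [a *: 1]mulr1.
Qed.

Lemma partial_affine f a c k : pderivable f ->
  partial k (f \o affine a c) = fun z => a * partial k f (affine a c z).
Proof.
move=> df.
have [_ E] := pderivable_of
  (fun l z => is_derive_affine (a := a) (c := c) (partialP l (affine a c z) df)).
exact: E.
Qed.

Lemma continuous_affine a c : continuous (affine a c : R * R -> R * R).
Proof.
move=> z; have H (b : R) (h : R * R -> R) : h w @[w --> z] --> h z ->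
    a * h w + b @[w --> z] --> a * h z + b.
  by move=> ch; apply: cvgD; [apply: cvgM => //; exact: cvg_cst|exact: cvg_cst].
apply: (@cvg_pair _ _ _ (nbhs z) (nbhs (a * z.1 + c.1)) (nbhs (a * z.2 + c.2)) _ _ _
  (fun w => a * w.1 + c.1) (fun w => a * w.2 + c.2)).
  by apply: (H c.1 fst); exact: cvg_fst.
by apply: (H c.2 snd); exact: cvg_snd.
Qed.

Lemma Cn_affine n f a c : Cn n f -> Cn n (f \o affine a c).
Proof.
have cc g : continuous g -> continuous (g \o affine a c).
  move=> cg z; apply: continuous_comp; [exact: continuous_affine|exact: cg].
elim: n f => [|n IH] f [cf Hf]; split => //; do ?exact: cc.
have [df pf] := Hf; have [D E] := pderivable_of
  (fun l z => is_derive_affine (a := a) (c := c) (partialP l (affine a c z) df)).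
split => // k; rewrite E; apply: (@Cn_mul _ (fun=> a)); first exact: Cn_cst.
by apply: IH; exact: pf.
Qed.

Lemma smooth_cst (c : R) : smooth (fun _ => c).
Proof. by apply/smoothP => n; exact: Cn_cst. Qed.

Lemma smoothD f g : smooth f -> smooth g -> smooth (fun z => f z + g z).
Proof. by move=> /smoothP sf /smoothP sg; apply/smoothP => n; exact: Cn_add. Qed.

Lemma smoothM f g : smooth f -> smooth g -> smooth (fun z => f z * g z).
Proof. by move=> /smoothP sf /smoothP sg; apply/smoothP => n; exact: Cn_mul. Qed.

Lemma smoothZ (c : R) f : smooth f -> smooth (fun z => c * f z).
Proof. by move=> sf; apply: smoothM => //; exact: smooth_cst. Qed.

Lemma smoothN f : smooth f -> smooth (fun z => - f z).
Proof.
move=> sf; rewrite (_ : (fun _ => _) = fun z => (-1) * f z); first exact: smoothZ.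
by rewrite funeqE => z; rewrite mulN1r.
Qed.

Lemma smoothB f g : smooth f -> smooth g -> smooth (fun z => f z - g z).
Proof. by move=> sf sg; apply: smoothD => //; exact: smoothN. Qed.

Lemma smooth_coord l : smooth (@coord R l).
Proof. by apply/smoothP => n; exact: Cn_coord. Qed.

Lemma smooth_ln f : (forall z, 0 < f z) -> smooth f -> smooth (fun z => ln (f z)).
Proof. by move=> f0 /smoothP sf; apply/smoothP => n; exact: Cn_ln. Qed.

Lemma smooth_affine f a c : smooth f -> smooth (f \o affine a c).
Proof. by move=> /smoothP sf; apply/smoothP => n; exact: Cn_affine. Qed.

(** Supports are measured with the library norm, for which balls are squares. *)
Definition supported r f : Prop := forall z, r < `|z| -> f z = 0.

Lemma test_functionP f :
  test_function f <-> smooth f /\ exists2 r, 0 < r & supported r f.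
Proof.
split=> [[sf cf]|[sf [r r0 fr]]]; split => //.
  have [M [_ HM]] := compact_bounded cf.
  have [N0 N1] : 0 < `|M| + 1 /\ M < `|M| + 1.
    by split; [rewrite ltr_wpDl|rewrite (le_lt_trans (ler_norm _))// ltrDl].
  exists (`|M| + 1) => // z zM; apply/eqP/negPn/negP => fz.
  have := HM _ N1 z (@subset_closure _ [set z | f z != 0] z fz); rewrite /= leNgt.
  by rewrite zM.
apply: (@subclosed_compact _ _ (`[-r, r]%classic `*` `[-r, r]%classic)).
- exact: closed_closure.
- apply: compact_setX; exact: segment_compact.
have cB : closed ([set z : R * R | `|z| <= r]).
  have : closed ((@Num.norm R (R * R)%type) @^-1` [set t : R | t <= r]).
    by apply: preimage_closed => [z _|]; [exact: norm_continuous|exact: closed_le].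
  by [].
have -> : (`[-r, r]%classic `*` `[-r, r]%classic) = [set z : R * R | `|z| <= r].
  by rewrite predeqE => z /=; rewrite !in_itv /= norm_le !ler_norml; split => [[-> ->]|/andP].
rewrite (proj1 (closure_id _) cB); apply: closure_subset => z /= fz.
by rewrite leNgt; apply/negP => /fr fz0; rewrite fz0 eqxx in fz.
Qed.

Lemma is_derive_far f g r k z df : (forall w, r < `|w| -> f w = g w) ->
  r < `|z| -> is_derive z (basis k) g df -> is_derive z (basis k) f df.
Proof.
move=> fg rz H; apply: near_eq_is_derive H.
have oB : open ((@Num.norm R (R * R)%type) @^-1` [set t : R | r < t]).
  by apply: open_comp => [w _|]; [exact: norm_continuous|exact: open_gt].
have : nbhs z ((@Num.norm R (R * R)%type) @^-1` [set t : R | r < t]).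
  exact: open_nbhs_nbhs.
by apply: filterS => w /= rw; rewrite fg.
Qed.

Lemma supported_partial k r f : supported r f -> supported r (partial k f).
Proof.
move=> fr z rz.
by have [_] := is_derive_far (g := cst 0) fr rz (is_derive_cst (0 : R) z (basis k)).
Qed.

Lemma test_smooth f : test_function f -> smooth f.
Proof. by case. Qed.

Lemma test_partial k f : test_function f -> test_function (partial k f).
Proof.
move=> /test_functionP[sf [r r0 fr]]; apply/test_functionP; split.
  exact: smooth_partial.
by exists r => //; exact: supported_partial.
Qed.

End Smooth.

(** * Integrals over the plane *)

Section Integrals.
Context {R : realType}.
Notation P := (measurableTypeR R * measurableTypeR R)%type.
Implicit Types (f g h k : R * R -> R) (x y z : R * R) (a r C L : R).

Definition meas f : Prop := measurable_fun setT (f : P -> R).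

Lemma integ_meas f : integ f -> meas f.
Proof. by case/integrableP => /measurable_EFinP. Qed.

Lemma integ_le f g : meas f -> integ g -> (forall z, `|f z| <= g z) -> integ f.
Proof.
move=> mf ig fg; apply: (le_integrable measurableT _ _ ig).
  exact/measurable_EFinP.
by move=> z _ /=; rewrite lee_fin (le_trans (fg z))// ler_norm.
Qed.

Lemma integD f g : integ f -> integ g -> integ (fun z => f z + g z).
Proof. by move=> hf hg; exact: (integrableD measurableT hf hg). Qed.

Lemma integB f g : integ f -> integ g -> integ (fun z => f z - g z).
Proof. by move=> hf hg; exact: (integrableB measurableT hf hg). Qed.

Lemma integZ a f : integ f -> integ (fun z => a * f z).
Proof. by move=> hf; exact: (integrableZl measurableT a hf). Qed.

Lemma integ_norm f : integ f -> integ (fun z => `|f z|).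
Proof. exact: integrable_norm. Qed.

Lemma IntD f g : integ f -> integ g ->
  \int[@leb2 R]_z (f z + g z) = \int[@leb2 R]_z f z + \int[@leb2 R]_z g z.
Proof. by move=> hf hg; rewrite RintegralD. Qed.

Lemma IntB f g : integ f -> integ g ->
  \int[@leb2 R]_z (f z - g z) = \int[@leb2 R]_z f z - \int[@leb2 R]_z g z.
Proof. by move=> hf hg; rewrite RintegralB. Qed.

Lemma IntZ a f : integ f -> \int[@leb2 R]_z (a * f z) = a * \int[@leb2 R]_z f z.
Proof. by move=> hf; rewrite RintegralZl. Qed.

Lemma IntN f : integ f -> \int[@leb2 R]_z (- f z) = - \int[@leb2 R]_z f z.
Proof.
move=> hf; rewrite -mulN1r -IntZ//; congr Rintegral.
by rewrite funeqE => z; rewrite mulN1r.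
Qed.

Lemma Int_eq f g : f =1 g -> \int[@leb2 R]_z f z = \int[@leb2 R]_z g z.
Proof. by move=> fg; apply: eq_Rintegral => z _; exact: fg. Qed.

Lemma integ_eq f g : f =1 g -> integ f -> integ g.
Proof. by move=> fg; rewrite (_ : f = g)//; exact/funext. Qed.

Lemma Int0 : \int[@leb2 R]_z (0 : R) = 0.
Proof. by rewrite /Rintegral integral0_eq. Qed.

Lemma Int_le f g : integ f -> integ g -> (forall z, f z <= g z) ->
  \int[@leb2 R]_z f z <= \int[@leb2 R]_z g z.
Proof. by move=> hf hg fg; exact: le_Rintegral. Qed.

Lemma Int_norm_le f g : integ f -> integ g -> (forall z, `|f z| <= g z) ->
  `|\int[@leb2 R]_z f z| <= \int[@leb2 R]_z g z.
Proof.
move=> hf hg fg; apply: (le_trans (le_normr_Rintegral _ hf)) => //.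
by apply: Int_le => //; exact: integ_norm.
Qed.

Lemma measD f g : meas f -> meas g -> meas (fun z => f z + g z).
Proof. exact: measurable_funD. Qed.

Lemma measB f g : meas f -> meas g -> meas (fun z => f z - g z).
Proof. exact: measurable_funB. Qed.

Lemma measM f g : meas f -> meas g -> meas (fun z => f z * g z).
Proof. exact: measurable_funM. Qed.

Lemma meas_cont f : continuous f -> meas f.
Proof. exact: continuous_measurable_plane. Qed.

Definition box r : set (R * R) := [set z | `|z| <= r].

Lemma boxE r : box r = (`[-r, r]%classic `*` `[-r, r]%classic).
Proof.
rewrite predeqE => z; rewrite /box /= !in_itv /= norm_le !ler_norml.
by split => [/andP|[-> ->]].
Qed.

Lemma measurable_box r : measurable (box r : set P).
Proof. by rewrite boxE; apply: measurableX; exact: measurable_itv. Qed.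

Lemma leb2_box r : 0 <= r -> @leb2 R (box r) = ((2 * r) ^+ 2)%:E.
Proof.
move=> r0; rewrite boxE; pose I : set (measurableTypeR R) := `[-r, r]%classic.
have H : @lebesgue_measure R I = (2 * r)%:E.
  rewrite lebesgue_measure_itv /= lte_fin; case: ltP => h.
    by rewrite -EFinB; congr EFin; lra.
  by congr EFin; lra.
transitivity (@lebesgue_measure R I * @lebesgue_measure R I)%E.
  by apply: product_measure1E; exact: measurable_itv.
by rewrite H -EFinM expr2.
Qed.

Lemma compact_box r : compact (box r).
Proof. rewrite boxE; apply: compact_setX; exact: segment_compact. Qed.

Lemma continuous_bounded_box f r : continuous f ->
  exists2 C, 0 <= C & forall z, `|z| <= r -> `|f z| <= C.
Proof.
move=> cf; have : compact (f @` box r).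
  by apply: continuous_compact (@compact_box r); exact: continuous_subspaceT.
move=> /compact_bounded[M [_ HM]].
exists (`|M| + 1) => [|z zr]; first by rewrite addr_ge0.
by apply: HM => /=; [rewrite (le_lt_trans (ler_norm _))// ltrDl|exists z].
Qed.

Lemma supported_bounded f r : continuous f -> supported r f ->
  exists2 C, 0 <= C & forall z, `|f z| <= C.
Proof.
move=> cf fr; have [C C0 HC] := continuous_bounded_box r cf.
by exists C => // z; have [/HC//|/fr ->] := leP `|z| r; rewrite normr0.
Qed.

Definition ind r z : R := \1_(box r) z.

Lemma indE r z : ind r z = if `|z| <= r then 1 else 0.
Proof.
rewrite /ind indicE; have -> : (z \in box r) = (`|z| <= r).
  by apply/idP/idP; rewrite inE.
by case: ifP.
Qed.

Lemma ind_ge0 r z : 0 <= ind r z.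
Proof. by rewrite indE; case: ifP. Qed.

Lemma ind_le1 r z : `|ind r z| <= 1.
Proof. by rewrite indE; case: ifP => _; rewrite ?normr1 ?normr0 ?ler01. Qed.

Lemma meas_ind r : meas (ind r).
Proof. exact: (measurable_indic (measurable_box r)). Qed.

Lemma integ_ind r : integ (ind r).
Proof.
have [r0|r0] := leP 0 r; last first.
  rewrite (_ : ind r = fun=> 0); first exact: integrable0.
  by rewrite funeqE => z; rewrite indE leNgt (lt_le_trans r0).
apply/integrableP; split; first by apply/measurable_EFinP; exact: meas_ind.
apply: (@le_lt_trans _ _ (\int[@leb2 R]_z (\1_(box r : set P) z)%:E)%E).
  rewrite le_eqVlt; apply/orP; left; apply/eqP; apply: eq_integral => z _ /=.
  by rewrite ger0_norm ?ind_ge0.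
have := @integral_indic _ _ _ (@leb2 R) setT measurableT (box r) (measurable_box r).
by move=> ->; rewrite setIT (_ : leb2 _ = ((2 * r) ^+ 2)%:E) ?ltey//; exact: leb2_box.
Qed.

Lemma Int_ind r : 0 <= r -> \int[@leb2 R]_z ind r z = (2 * r) ^+ 2.
Proof.
move=> r0; rewrite /Rintegral /ind.
have := @integral_indic _ _ _ (@leb2 R) setT measurableT (box r) (measurable_box r).
by move=> ->; rewrite setIT (_ : leb2 _ = ((2 * r) ^+ 2)%:E)//; exact: leb2_box.
Qed.

Lemma supported_ind r f z : supported r f -> f z * ind r z = f z.
Proof.
move=> fr; rewrite indE; have [zr|rz] := leP `|z| r; first by rewrite mulr1.
by rewrite (fr _ rz) mul0r.
Qed.

Lemma supported_norm_le r C f : (forall z, `|f z| <= C) -> supported r f ->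
  forall z, `|f z| <= C * ind r z.
Proof.
move=> fC fr z; rewrite indE; have [zr|rz] := leP `|z| r; first by rewrite mulr1.
by rewrite (fr _ rz) normr0 mulr0.
Qed.

Lemma integ_bounded C r f : meas f -> (forall z, `|f z| <= C) -> supported r f ->
  integ f.
Proof.
move=> mf fC fr; apply: (@integ_le _ (fun z => C * ind r z)) => //.
  by apply: integZ; exact: integ_ind.
exact: supported_norm_le.
Qed.

(** The squares [box r] exhaust the plane, hence cover every compact set. *)
Definition locint f : Prop := meas f /\ forall r, integ (fun z => f z * ind r z).

Lemma locint_bounded C f : meas f -> (forall z, `|f z| <= C) -> locint f.
Proof.
move=> mf fC; split => // r.
apply: (@integ_bounded C r); first by apply: measM => //; exact: meas_ind.
  by move=> z; rewrite normrM -[leRHS]mulr1 ler_pM//; exact: ind_le1.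
by move=> z rz; rewrite indE leNgt rz mulr0.
Qed.

Lemma locint_cont f : continuous f -> locint f.
Proof.
move=> cf; split=> [|r]; first exact: meas_cont.
have [C C0 HC] := continuous_bounded_box r cf.
apply: (@integ_bounded C r); first by apply: measM; [exact: meas_cont|exact: meas_ind].
  move=> z; rewrite indE; have [zr|_] := leP `|z| r; first by rewrite mulr1 HC.
  by rewrite mulr0 normr0.
by move=> z rz; rewrite indE leNgt rz mulr0.
Qed.

Lemma locint_mul f k C r : locint f -> meas k -> (forall z, `|k z| <= C) ->
  supported r k -> integ (fun z => f z * k z).
Proof.
move=> [mf lf] mk kC kr.
apply: (@integ_le _ (fun z => C * `|f z * ind r z|)).
- exact: measM.
- by apply: integZ; apply: integ_norm; exact: lf.
move=> z; rewrite -(supported_ind z kr) mulrCA normrM.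
by apply: ler_pM.
Qed.

Lemma locintD f g : locint f -> locint g -> locint (fun z => f z + g z).
Proof.
move=> [mf lf] [mg lg]; split=> [|r]; first exact: measD.
by apply: (integ_eq _ (integD (lf r) (lg r))) => z; rewrite mulrDl.
Qed.

Lemma locintZ a f : locint f -> locint (fun z => a * f z).
Proof.
move=> [mf lf]; split=> [|r]; first by apply: measM => //; exact: measurable_cst.
by apply: (integ_eq _ (integZ a (lf r))) => z; rewrite mulrA.
Qed.

Lemma Int_dominated (F : nat -> R * R -> R) f g :
  (forall n, meas (F n)) -> meas f -> {ae @leb2 R, forall z, F n z @[n --> \oo] --> f z} ->
  integ g -> (forall n z, `|F n z| <= g z) ->
  integ f /\ \int[@leb2 R]_z F n z @[n --> \oo] --> \int[@leb2 R]_z f z.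
Proof.
move=> mF mf Ff ig Fg.
have [] := @dominated_convergence _ _ _ (@leb2 R) setT measurableT
  (fun n => EFin \o F n) (EFin \o f) (EFin \o g).
- by move=> n; apply/measurable_EFinP; exact: mF.
- exact/measurable_EFinP.
- apply: (@filterS _ (almost_everywhere (@leb2 R)) _ _ _ _ Ff) => z Fz _.
  by apply: cvg_comp Fz _; exact: cvg_id.
- exact: ig.
- by apply: aeW => z n _ /=; rewrite lee_fin.
move=> i_f _ cvgi; split => //.
apply: fine_cvg; rewrite fineK; first exact: cvgi.
exact: integrable_fin_num.
Qed.

End Integrals.

(** * Mean value inequality and Lipschitz bounds *)

Section Lipschitz.
Context {R : realType}.
Implicit Types (f g h : R * R -> R) (x y z a b : R * R) (r C L : R).

Lemma norm_slice (k : 'I_2) z (s : R) : `|slice k z s| <= Num.max `|z| `|s|.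
Proof.
move: k; apply: ord2P; rewrite norm_le; apply/andP; split; rewrite le_max /=.
- by rewrite lexx orbT.
- by rewrite (coord_le ord_max z).
- by rewrite (coord_le ord0 z).
- by rewrite lexx orbT.
Qed.

Lemma mvt_slice f r C : pderivable f ->
  (forall (k : 'I_2) z, `|z| <= r -> `|partial k f z| <= C) ->
  forall (k : 'I_2) z (s t : R), `|z| <= r -> `|s| <= r -> `|t| <= r ->
  `|f (slice k z s) - f (slice k z t)| <= C * `|s - t|.
Proof.
move=> df fC k z s t zr; wlog st : s t / s <= t => [H sr tr|sr tr].
  by have [/H|/ltW/H] := leP s t; [exact|rewrite distrC [`|s - t|]distrC; exact].
have D (u : R) : is_derive u 1 (f \o slice k z) (partial k f (slice k z u)).
  exact: partial_slice.
have cw : {within `[s, t], continuous (f \o slice k z)}.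
  by apply: derivable_within_continuous => u _; have [] := D u.
have [c] := @MVT_segment R _ _ s t st (fun u _ => D u) cw.
rewrite in_itv /= => /andP[sc ct] E.
rewrite distrC [`|s - t|]distrC E normrM ler_wpM2r//; apply: fC.
apply: (le_trans (norm_slice _ _ _)); rewrite ge_max zr /=.
by rewrite ler_norml; move: sr tr; rewrite !ler_norml; lra.
Qed.

(** Two points of a square are joined by two segments parallel to the axes that
    stay in the square. *)
Lemma mvt_box f r C : 0 <= C -> pderivable f ->
  (forall (k : 'I_2) z, `|z| <= r -> `|partial k f z| <= C) ->
  forall a b, `|a| <= r -> `|b| <= r -> `|f a - f b| <= 2 * C * `|a - b|.
Proof.
move=> C0 df fC a b ar br.
have [a1 a2] := (coord_le ord0 a, coord_le ord_max a).
have [b1 b2] := (coord_le ord0 b, coord_le ord_max b).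
have [d1 d2] := (coord_le ord0 (a - b), coord_le ord_max (a - b)).
have cr : `|slice ord0 a b.1| <= r.
  by apply: (le_trans (norm_slice _ _ _)); rewrite ge_max ar (le_trans b1).
have H1 := mvt_slice df fC ord0 ar (le_trans a1 ar) (le_trans b1 br).
have H2 := mvt_slice df fC ord_max cr (le_trans a2 ar) (le_trans b2 br).
rewrite slice_coord in H1.
have E1 : slice ord_max (slice ord0 a b.1) (coord ord_max a) = slice ord0 a (coord ord0 b) by [].
have E2 : slice ord_max (slice ord0 a b.1) (coord ord_max b) = b by case: (b).
rewrite E1 E2 in H2.
apply: (le_trans (ler_distD (f (slice ord0 a (coord ord0 b))) _ _)).
rewrite -mulrA mulr_natl mulr2n; apply: lerD.
  exact: (le_trans H1 (ler_wpM2l C0 d1)).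
exact: (le_trans H2 (ler_wpM2l C0 d2)).
Qed.

Lemma smooth_lip_box f r : smooth f ->
  exists2 L, 0 <= L & forall a b, `|a| <= r -> `|b| <= r -> `|f a - f b| <= L * `|a - b|.
Proof.
move=> sf.
have [C0 C0_ge0 H0] := continuous_bounded_box r (smooth_continuous (smooth_partial ord0 sf)).
have [C1 C1_ge0 H1] := continuous_bounded_box r (smooth_continuous (smooth_partial ord_max sf)).
exists (2 * (C0 + C1)); first by rewrite mulr_ge0// addr_ge0.
apply: mvt_box; first by rewrite addr_ge0.
  exact: smooth_pderivable.
apply: ord2P => z zr.
  by rewrite (le_trans (H0 _ zr))// lerDl.
by rewrite (le_trans (H1 _ zr))// lerDr.
Qed.

Lemma test_bounded f : test_function f -> exists2 C, 0 <= C & forall z, `|f z| <= C.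
Proof.
by move=> /test_functionP[sf [r r0 fr]]; exact: (supported_bounded (smooth_continuous sf) fr).
Qed.

Lemma test_lip f : test_function f ->
  exists2 L, 0 <= L & forall a b, `|f a - f b| <= L * `|a - b|.
Proof.
move=> tf.
have [C0 C0_ge0 H0] := test_bounded (test_partial ord0 tf).
have [C1 C1_ge0 H1] := test_bounded (test_partial ord_max tf).
exists (2 * (C0 + C1)); first by rewrite mulr_ge0// addr_ge0.
move=> a b; apply: (@mvt_box _ (Num.max `|a| `|b|)).
- by rewrite addr_ge0.
- by apply: smooth_pderivable; exact: test_smooth.
- apply: ord2P => z _; first by rewrite (le_trans (H0 _))// lerDl.
  by rewrite (le_trans (H1 _))// lerDr.
- by rewrite le_max lexx.
- by rewrite le_max lexx orbT.
Qed.

Lemma meas_test f : test_function f -> meas f.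
Proof. by move=> /test_smooth/smooth_continuous; exact: meas_cont. Qed.

Lemma integ_test f : test_function f -> integ f.
Proof.
move=> tf; have [C C0 HC] := test_bounded tf.
have /test_functionP[_ [r _ fr]] := tf.
exact: (integ_bounded (meas_test tf) HC fr).
Qed.

End Lipschitz.

(** * Convolution with test functions *)

Section Convolution.
Context {R : realType}.
Implicit Types (f g h k : R * R -> R) (x y z a b : R * R) (r C L s : R) (j : 'I_2).

Definition conv f k x : R := \int[@leb2 R]_y (f y * k (x - y)).

Lemma affine_refl x y : affine (-1) x y = x - y.
Proof. by rewrite /affine !mulN1r ![- _ + _]addrC. Qed.

Lemma reflE k x : (fun y => k (x - y)) = k \o affine (-1) x.
Proof. by rewrite funeqE => y /=; rewrite affine_refl. Qed.

Lemma meas_refl k x : meas k -> meas (fun y => k (x - y)).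
Proof. by rewrite reflE; exact: measurable_comp_affine. Qed.

Lemma supported_refl r k x : supported r k -> supported (r + `|x|) (fun y => k (x - y)).
Proof.
move=> kr y ry; apply: kr; rewrite -(ltrD2r `|x|); apply: (lt_le_trans ry).
by rewrite addrC -{1}[y](subKr x) ler_normB.
Qed.

Lemma smooth_refl k x : smooth k -> smooth (fun y => k (x - y)).
Proof. by rewrite reflE; exact: smooth_affine. Qed.

Lemma test_refl k x : test_function k -> test_function (fun y => k (x - y)).
Proof.
move=> /test_functionP[sk [r r0 kr]]; apply/test_functionP; split.
  exact: smooth_refl.
by exists (r + `|x|); [rewrite ltr_wpDr|exact: supported_refl].
Qed.

Lemma partial_refl j k x : pderivable k ->
  partial j (fun y => k (x - y)) = fun y => - partial j k (x - y).
Proof.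
move=> dk; rewrite reflE partial_affine// funeqE => y.
by rewrite affine_refl mulN1r.
Qed.

Lemma integ_conv f k x : locint f -> test_function k -> integ (fun y => f y * k (x - y)).
Proof.
move=> lf tk; have tk' := test_refl x tk.
have [C _ HC] := test_bounded tk'; have /test_functionP[_ [r _ kr]] := tk'.
exact: (locint_mul lf (meas_test tk') HC kr).
Qed.

Lemma convB f k h : locint f -> test_function k -> test_function h ->
  conv f (fun z => k z - h z) = fun x => conv f k x - conv f h x.
Proof.
move=> lf tk th; rewrite funeqE => x; rewrite /conv -IntB; last 2 first.
- exact: integ_conv.
- exact: integ_conv.
by apply: Int_eq => y; rewrite mulrBr.
Qed.

Lemma supported_shift r k x x' y : supported r k -> `|x - x'| <= 1 ->
  r + `|x| + 1 < `|y| -> k (x' - y) = 0.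
Proof.
move=> kr xx' ry; apply: kr.
have := ler_distD x x' y; have := lerB_dist y x; have := distrC x' x.
by rewrite [`|y - x|]distrC; have := ler_normB y x; rewrite [`|y - x|]distrC;
  have := lerB_dist x' y; have := lerB_normD y (- x);
  have := ler_distD x' x y; lra.
Qed.

(** All translates of the kernel by at most one are supported in one square, so
    a single integral of [f] controls them. *)
Lemma conv_diff_le f k L r x x' : locint f -> test_function k ->
  (forall a b, `|k a - k b| <= L * `|a - b|) -> supported r k -> `|x - x'| <= 1 ->
  `|conv f k x - conv f k x'| <=
  L * `|x - x'| * \int[@leb2 R]_y `|f y * ind (r + `|x| + 1) y|.
Proof.
move=> lf tk kL kr xx'; rewrite /conv -IntB; [|exact: integ_conv|exact: integ_conv].
have i_f : integ (fun y => `|f y * ind (r + `|x| + 1) y|).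
  by apply: integ_norm; exact: lf.2.
rewrite -IntZ//; apply: Int_norm_le.
- by apply: integB; exact: integ_conv.
- exact: integZ.
move=> y; rewrite -mulrBr indE.
have [ry|ry] := leP `|y| (r + `|x| + 1).
  rewrite mulr1 normrM mulrC ler_wpM2r// (le_trans (kL _ _))//.
  by rewrite (_ : x - y - (x' - y) = x - x')//; rewrite opprB addrA subrK.
rewrite !mulr0 normr0 mulr0 (supported_shift kr xx' ry).
rewrite (@supported_shift r k x x y)// ?subrr ?mulr0 ?normr0//.
Qed.

Lemma near_dist_continuous (F : R * R -> R) C x : 0 <= C ->
  (forall x', `|x - x'| <= 1 -> `|F x - F x'| <= C * `|x - x'|) ->
  F x' @[x' --> x] --> F x.
Proof.
move=> C0 HF; apply/cvgrPdist_le => e e0.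
have d0 : 0 < Num.min 1 (e / (C + 1)).
  by rewrite lt_min ltr01 divr_gt0// ltr_wpDl.
have : nbhs x (ball x (Num.min 1 (e / (C + 1)))) by exact: nbhsx_ballx.
apply: filterS => x'; rewrite -ball_normE /= => /ltW; rewrite le_min => /andP[h1 h2].
apply: (le_trans (HF _ h1)).
have C1 : 0 < C + 1 by rewrite ltr_wpDl.
apply: (@le_trans _ _ ((C + 1) * `|x - x'|)).
  by rewrite ler_wpM2r// lerDl.
by move: h2; rewrite ler_pdivlMr// mulrC.
Qed.

Lemma conv_continuous f k : locint f -> test_function k -> continuous (conv f k).
Proof.
move=> lf tk x; have [L L0 kL] := test_lip tk.
have /test_functionP[_ [r r0 kr]] := tk.
apply: (@near_dist_continuous _ (L * \int[@leb2 R]_y `|f y * ind (r + `|x| + 1) y|)).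
  by rewrite mulr_ge0//; apply: Rintegral_ge0.
by move=> x' xx'; rewrite mulrAC; exact: conv_diff_le.
Qed.

Lemma mvt1 (F dF : R -> R) C (s t : R) :
  (forall u : R, is_derive u 1 F (dF u)) ->
  (forall u, `|u - t| <= `|s - t| -> `|dF u| <= C) -> `|F s - F t| <= C * `|s - t|.
Proof.
move=> D HC.
have cw (a b : R) : {within `[a, b], continuous F}.
  by apply: derivable_within_continuous => u _; have [] := D u.
have [st|/ltW ts] := leP s t.
  have [c] := @MVT_segment R _ _ s t st (fun u _ => D u) (cw _ _).
  rewrite in_itv /= => /andP[sc ct] E.
  rewrite -(normrN (F s - F t)) -(normrN (s - t)) !opprB E normrM ler_wpM2r//.
  by apply: HC; rewrite !ler0_norm; lra.
have [c] := @MVT_segment R _ _ t s ts (fun u _ => D u) (cw _ _).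
rewrite in_itv /= => /andP[sc ct] E.
rewrite E normrM ler_wpM2r//; apply: HC.
by rewrite !ger0_norm; lra.
Qed.

(** The derivative of the remainder is an increment of a Lipschitz function. The
    constant does not depend on the base point, so that the estimate survives
    integration against a locally integrable function. *)
Lemma test_taylor1 j k : test_function k ->
  exists2 L, 0 <= L & forall z (t : R),
    `|k (t *: basis j + z) - k z - t * partial j k z| <= L * t ^+ 2.
Proof.
move=> tk; have [L L0 HL] := test_lip (test_partial j tk).
have dk := smooth_pderivable (test_smooth tk).
exists L => // z t; pose c := coord j z; pose d := partial j k z.
pose F (u : R) := k (slice j z u) - u * d.
have DF (u : R) : is_derive u 1 F (partial j k (slice j z u) - d).
  have H1 := partial_slice j z u dk.
  have H2 : is_derive u (1 : R) (d *: id) (d *: (1 : R)) by apply: is_deriveZ.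
  have := is_deriveB H1 H2; rewrite [d *: 1]mulr1.
  rewrite (_ : _ - _ = F)// funeqE => v; rewrite /F /=.
  by congr (_ - _); rewrite mulrC.
have := @mvt1 F _ (L * `|t|) (t + c) c DF.
rewrite addrK -mulrA -expr2 real_normK ?num_real// => H.
have -> : k (t *: basis j + z) - k z - t * d = F (t + c) - F c.
  by rewrite /F slice_shift slice_coord; ring.
apply: H => u uc; apply: (le_trans (HL _ _)); rewrite ler_wpM2l//.
apply: le_trans uc; rewrite -{2}(slice_coord j z) -/c.
move: (j) c; apply: ord2P => c; rewrite norm_le /= ?subrr ?normr0 ?normr_ge0 ?andbT lexx //.
Qed.

Lemma is_derive_quadratic (F : R * R -> R) j x (df C : R) : 0 <= C ->
  (forall t : R, `|t| <= 1 -> `|F (t *: basis j + x) - F x - t * df| <= C * t ^+ 2) ->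
  is_derive x (basis j) F df.
Proof.
move=> C0 H.
have cv : h^-1 *: (F (h *: basis j + x) - F x) @[h --> (0 : R)^'] --> df.
  apply/cvgrPdist_le => e e0.
  have d0 : 0 < Num.min 1 (e / (C + 1)).
    by rewrite lt_min ltr01 divr_gt0// ltr_wpDl.
  have C1 : 0 < C + 1 by rewrite ltr_wpDl.
  rewrite !near_withinE.
  have : nbhs (0 : R) (ball (0 : R) (Num.min 1 (e / (C + 1)))) by exact: nbhsx_ballx.
  apply: filterS => t; rewrite -ball_normE /= sub0r normrN => /ltW.
  rewrite le_min => /andP[h1 h2] t0.
  have nt0 : 0 < `|t| by rewrite normr_gt0.
  rewrite distrC -(ler_pM2l nt0) -normrM mulrBr [_ *: _]/(_ * _) mulVKf//.
  apply: (le_trans (H _ h1)); rewrite -real_normK ?num_real// expr2.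
  rewrite mulrCA ler_wpM2l//.
  apply: (@le_trans _ _ ((C + 1) * `|t|)); first by rewrite ler_wpM2r// lerDl.
  by move: h2; rewrite ler_pdivlMr// mulrC.
apply: DeriveDef; first by apply: cvgP cv.
exact: cvg_lim cv.
Qed.

Lemma is_derive_conv f k j x : locint f -> test_function k ->
  is_derive x (basis j) (conv f k) (conv f (partial j k) x).
Proof.
move=> lf tk; have [L L0 HL] := test_taylor1 j tk.
have /test_functionP[_ [r r0 kr]] := tk.
have tpk := test_partial j tk.
have kr' : supported r (partial j k).
  exact: supported_partial.
set I := \int[@leb2 R]_y `|f y * ind (r + `|x| + 1) y|.
have i_f : integ (fun y => `|f y * ind (r + `|x| + 1) y|).
  by apply: integ_norm; exact: lf.2.
have I0 : 0 <= I by apply: Rintegral_ge0.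
apply: (@is_derive_quadratic _ _ _ _ (L * I)); first by rewrite mulr_ge0.
move=> t t1; rewrite /conv -IntB; [|exact: integ_conv|exact: integ_conv].
rewrite -IntZ; last exact: integ_conv.
rewrite -IntB; last 2 first.
- by apply: integB; exact: integ_conv.
- by apply: integZ; exact: integ_conv.
rewrite mulrAC -IntZ//; apply: Int_norm_le.
- by apply: integB; [apply: integB; exact: integ_conv|apply: integZ; exact: integ_conv].
- exact: integZ.
have nb : `|x - (t *: basis j + x)| <= 1.
  rewrite opprD addrCA subrr addr0 normrN normrZ.
  suff -> : `|basis j : R * R| = 1 by rewrite mulr1.
  by move: (j); apply: ord2P; rewrite normE /= normr0 normr1;
    [rewrite max_l|rewrite max_r]; rewrite ?ler01.
move=> y.
have -> : f y * k (t *: basis j + x - y) - f y * k (x - y) - t * (f y * partial j k (x - y)) =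
    f y * (k (t *: basis j + (x - y)) - k (x - y) - t * partial j k (x - y)).
  by rewrite addrA; ring.
rewrite indE; have [ry|ry] := leP `|y| (r + `|x| + 1).
  by rewrite mulr1 normrM mulrC ler_wpM2r// HL.
rewrite !mulr0 normr0 mulr0 addrA (supported_shift kr nb ry).
have x1 : `|x - x| <= 1 by rewrite subrr normr0.
by rewrite (supported_shift kr x1 ry) (supported_shift kr' x1 ry) mulr0 !subr0 mulr0 normr0.
Qed.

Lemma conv_pderivable f k : locint f -> test_function k -> pderivable (conv f k).
Proof. by move=> lf tk j z; have [] := is_derive_conv j z lf tk. Qed.

Lemma partial_conv f k j : locint f -> test_function k ->
  partial j (conv f k) = conv f (partial j k).
Proof. by move=> lf tk; rewrite funeqE => z; have [] := is_derive_conv j z lf tk. Qed.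

(** The power of [s] makes this dilation preserve integrals. *)
Definition rescale s k z : R := (s ^+ 2)^-1 * k (affine s^-1 0 z).

Lemma supported_rescale r s k : 0 < s -> supported r k -> supported (s * r) (rescale s k).
Proof.
move=> s0 kr z rz; rewrite /rescale kr ?mulr0//.
by rewrite affine0E normrZ gtr0_norm ?invr_gt0// mulrC ltr_pdivlMr// mulrC.
Qed.

Lemma test_affine0 s k : 0 < s -> test_function k -> test_function (k \o affine s^-1 0).
Proof.
move=> s0 /test_functionP[sk [r r0 kr]]; apply/test_functionP; split.
  exact: smooth_affine.
exists (s * r) => [|z rz]; first exact: mulr_gt0.
have := supported_rescale s0 kr rz; rewrite /rescale => /eqP.
by rewrite mulf_eq0 invr_eq0 expf_eq0 /= (gt_eqF s0) /= => /eqP.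
Qed.

Lemma test_scale (c : R) k : test_function k -> test_function (fun z => c * k z).
Proof.
move=> /test_functionP[sk [r r0 kr]]; apply/test_functionP; split.
  exact: smoothZ.
by exists r => // z /kr ->; rewrite mulr0.
Qed.

Lemma test_rescale s k : 0 < s -> test_function k -> test_function (rescale s k).
Proof. by move=> s0 tk; apply: test_scale; exact: test_affine0. Qed.

Lemma conv_rescale f k s x : 0 < s -> integ (fun y => f y * rescale s k (x - y)) ->
  conv f (rescale s k) x = \int[@leb2 R]_w (f (affine (- s) x w) * k w).
Proof.
move=> s0 ig; have s1 : - s != 0 by rewrite oppr_eq0 gt_eqF.
have := Rintegral_affine x s1 ig.
rewrite normrN gtr0_norm// => E.
have s2 : s ^+ 2 != 0 by rewrite gt_eqF ?exprn_gt0.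
rewrite -[LHS](mulVKf s2) /conv -E -IntZ; last exact: (integ_affine x s1 ig).
apply: Int_eq => w; rewrite mulrCA; congr (_ * _).
rewrite /rescale mulrA mulfV// mul1r; congr k; rewrite /affine /= !addr0.
case: w => w1 w2; apply/pair_equal_spec; split => /=; field; by rewrite gt_eqF.
Qed.

End Convolution.

(** * Fubini and approximate identities *)

Section Fubini.
Context {R : realType}.
Notation P := (measurableTypeR R * measurableTypeR R)%type.
Implicit Types (f g h k : R * R -> R) (x y z a b : R * R) (r C L s : R).

Lemma leb2_sigma_finite : sigma_finite setT (@leb2 R).
Proof.
exists (fun n => box n%:R).
  rewrite predeqE => z; split => // _; exists (Num.truncn `|z|).+1 => //.
  by rewrite /box /= ltW// truncnS_gt.
move=> n; split; first exact: measurable_box.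
by rewrite (_ : leb2 _ = ((2 * n%:R) ^+ 2)%:E) ?ltry//; exact: leb2_box.
Qed.

(** [leb2] packed with its sigma-finiteness, so that Fubini's theorem applies to
    the product of [leb2] with itself. *)
Definition sleb2 : {sigma_finite_measure set P -> \bar R} :=
  let m := (@lebesgue_measure R \x @lebesgue_measure R)%E in
  HB.pack m (Measure_isSigmaFinite.Build _ _ _ m leb2_sigma_finite).

Lemma meas_sub : measurable_fun setT (fun p : P * P => ((p.1 : R * R) - p.2) : P).
Proof.
apply: measurable_fun_pair; apply: measurable_funB => /=.
- by apply: measurableT_comp => //; exact: measurable_fst.
- by apply: measurableT_comp => //; exact: measurable_snd.
- by apply: measurableT_comp => //; exact: measurable_fst.
- by apply: measurableT_comp => //; exact: measurable_snd.
Qed.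

Lemma integ_fineK f : integ f ->
  (\int[@leb2 R]_z (f z)%:E = (\int[@leb2 R]_z f z)%:E)%E.
Proof. by move=> hf; rewrite fineK//; exact: (integrable_fin_num _ hf). Qed.

(** Fubini: only the [y] in a square contribute, because both [g] and the kernel
    are compactly supported, and there [f] is integrable. *)
Lemma conv_pairing f g k C r : locint f -> test_function k ->
  meas g -> (forall z, `|g z| <= C) -> 0 <= r -> supported r g ->
  \int[@leb2 R]_x (g x * conv f k x) =
  \int[@leb2 R]_y (f y * \int[@leb2 R]_x (g x * k (x - y))).
Proof.
move=> lf tk mg gC r0 gr; have [Ck Ck0 kC] := test_bounded tk.
have /test_functionP[_ [rk rk0 kr]] := tk.
have C0 : 0 <= C by rewrite (le_trans _ (gC 0)).
pose h (p : P * P) : R := g p.1 * (f p.2 * k ((p.1 : R * R) - p.2)).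
have mh : measurable_fun setT h.
  apply: measurable_funM; first by apply: measurableT_comp => //; exact: measurable_fst.
  apply: measurable_funM.
    by apply: measurableT_comp; [exact: lf.1|exact: measurable_snd].
  by apply: (@measurableT_comp _ _ _ _ _ _ k); [exact: meas_test|exact: meas_sub].
pose Phi y := `|f y * ind (rk + r) y|.
have iPhi : integ Phi by apply: integ_norm; exact: lf.2.
pose I := \int[@leb2 R]_y Phi y.
have hb x y : `|h (x, y)| <= C * Ck * ind r x * Phi y.
  rewrite /h /Phi /= !normrM.
  have [xr|rx] := leP `|x| r; last first.
    by rewrite (gr _ rx) normr0 mul0r !mulr_ge0// ind_ge0.
  have [yr|ry] := leP `|y| (rk + r).
    rewrite !indE xr yr mulr1 normr1 mulr1 mulrCA [leRHS]mulrC.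
    by rewrite ler_wpM2l// ler_pM.
  rewrite [k _](supported_refl (x := x) kr)//; last by rewrite (le_lt_trans _ ry)// lerD2l.
  by rewrite normr0 !mulr0 !mulr_ge0// ind_ge0.
have ih1 x : integ (fun y => h (x, y)).
  by have : integ (fun y => g x * (f y * k (x - y))) by apply: integZ; exact: integ_conv.
have ih : (sleb2 \x sleb2)%E.-integrable setT (EFin \o h).
  apply/integrable12ltyP; first exact/measurable_EFinP.
  apply: (@le_lt_trans _ _ (\int[@leb2 R]_x ((C * Ck * I) * ind r x)%:E)%E); last first.
    have ic : integ (fun x => C * Ck * I * ind r x) by apply: integZ; exact: integ_ind.
    by rewrite (integ_fineK ic) ltry.
  apply: ge0_le_integral => //.
  - by move=> x _; apply: integral_ge0.
  - have ma : measurable_fun setT (abse \o (EFin \o h)).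
      by apply: measurableT_comp => //; exact/measurable_EFinP.
    exact: (@measurable_fun_fubini_tonelli_F _ _ _ _ R sleb2 (abse \o (EFin \o h)) ma
      (fun=> abse_ge0 _)).
  - by apply/measurable_EFinP; apply: measM; [exact: measurable_cst|exact: meas_ind].
  - move=> x _.
    have -> : (C * Ck * I * ind r x)%:E = (\int[@leb2 R]_y (C * Ck * ind r x * Phi y)%:E)%E.
      by rewrite (integ_fineK (integZ _ iPhi)) IntZ// -/I mulrAC.
    apply: ge0_le_integral => //.
    + by apply/measurable_EFinP; apply: integ_meas; exact: integ_norm (ih1 x).
    + by apply/measurable_EFinP; apply: integ_meas; exact: integZ.
    + by move=> y _; rewrite lee_fin hb.
have := @Fubini _ _ _ _ R sleb2 sleb2 (EFin \o h) ih.
have -> : (\int[sleb2]_x \int[sleb2]_y (EFin \o h) (x, y) =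
    \int[@leb2 R]_x (g x * conv f k x)%:E)%E.
  by apply: eq_integral => x _; rewrite /= [LHS](integ_fineK (ih1 x));
    exact: (congr1 EFin (IntZ (g x) (@integ_conv _ f k x lf tk))).
have igk y : integ (fun x => g x * k (x - y)).
  apply: (@integ_bounded _ (C * Ck) r).
  - apply: measM => //; have := measurable_comp_affine 1 (- y) (meas_test tk).
    rewrite (_ : _ \o _ = fun x => k (x - y))// funeqE => x /=.
    by rewrite /affine !mul1r.
  - by move=> x; rewrite normrM; apply: ler_pM.
  - by move=> x rx; rewrite (gr _ rx) mul0r.
have -> : (\int[sleb2]_y \int[sleb2]_x (EFin \o h) (x, y) =
    \int[@leb2 R]_y (f y * \int[@leb2 R]_x (g x * k (x - y)))%:E)%E.
  apply: eq_integral => y _ /=.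
  have ih2 : integ (fun x => h (x, y)).
    by apply: (integ_eq _ (integZ (f y) (igk y))) => x; rewrite /h /= mulrCA.
  rewrite [LHS](integ_fineK ih2) -IntZ//; congr EFin.
  by apply: Int_eq => x; rewrite /h /= mulrCA.
by move=> E; rewrite /Rintegral E.
Qed.

(** Dominated convergence, after moving the dilation from the kernel to [g]. *)
Lemma conv_rescale_cvg g k C x : meas g -> (forall z, `|g z| <= C) ->
  test_function k -> g z @[z --> x] --> g x ->
  conv g (rescale n.+1%:R^-1 k) x @[n --> \oo] --> g x * \int[@leb2 R]_z k z.
Proof.
move=> mg gC tk cg; have lg := locint_bounded mg gC.
have s0 (n : nat) : 0 < n.+1%:R^-1 :> R by rewrite invr_gt0.
rewrite (_ : (fun n => _) = (fun n : nat =>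
    \int[@leb2 R]_w (g (affine (- n.+1%:R^-1) x w) * k w))); last first.
  rewrite funeqE => n; rewrite conv_rescale//.
  by apply: integ_conv => //; exact: test_rescale.
rewrite -IntZ; last exact: integ_test.
apply: (proj2 (@Int_dominated _ _ (fun w => g x * k w) (fun w => C * `|k w|) _ _ _ _ _)).
- by move=> n; apply: measM; [exact: measurable_comp_affine|exact: meas_test].
- by apply: measM; [exact: measurable_cst|exact: meas_test].
- apply: aeW => w; apply: cvgMl.
  apply: (cvg_comp _ _ _ cg).
  have H (c d : R) : - n.+1%:R^-1 * c + d @[n --> \oo] --> d.
    rewrite -{2}[d]add0r -(mul0r c); apply: cvgD; last exact: cvg_cst.
    apply: cvgMl; rewrite -oppr0; apply: cvgN; exact: cvg_harmonic.
  case: (x) => x1 x2.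
  apply: (@cvg_pair _ _ _ _ (nbhs x1) (nbhs x2) _ _ _
    (fun n : nat => - n.+1%:R^-1 * w.1 + x1) (fun n : nat => - n.+1%:R^-1 * w.2 + x2)); exact: H.
- by apply: integZ; apply: integ_norm; exact: integ_test.
- by move=> n w; rewrite normrM ler_wpM2r.
Qed.

Definition reflect k z : R := k (- z).

Lemma test_reflect k : test_function k -> test_function (reflect k).
Proof.
move=> tk; rewrite (_ : reflect k = fun z => k (0 - z)); first exact: test_refl.
by rewrite funeqE => z; rewrite sub0r.
Qed.

Lemma Int_refl k x : integ k -> \int[@leb2 R]_y k (x - y) = \int[@leb2 R]_y k y.
Proof.
move=> ik; have n1 : (-1 : R) != 0 by rewrite oppr_eq0 oner_eq0.
have := Rintegral_affine x n1 ik; rewrite normrN normr1 expr1n invr1 mul1r => <-.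
by apply: Int_eq => z; rewrite affine_refl.
Qed.

Lemma Int_reflect k : integ k -> \int[@leb2 R]_z reflect k z = \int[@leb2 R]_z k z.
Proof.
by move=> ik; rewrite -(Int_refl 0 ik); apply: Int_eq => z; rewrite /reflect sub0r.
Qed.

Lemma conv_rescale_reflect g k s y :
  \int[@leb2 R]_x (g x * rescale s k (x - y)) = conv g (rescale s (reflect k)) y.
Proof.
apply: Int_eq => x; rewrite /rescale /reflect; congr (_ * (_ * k _)).
by rewrite /affine /= !addr0; apply/pair_equal_spec; split => /=; ring.
Qed.

End Fubini.

(** * Divergence theorem on squares *)

Section BoxDivergence.
Context {R : realType}.
Implicit Types (f g h : R * R -> R) (x y z a b : R * R) (r C L s : R) (k j : 'I_2).

Lemma FTC_is_derive (F dF : R -> R) (a b : R) : a < b ->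
  (forall t : R, is_derive t 1 F (dF t)) -> continuous dF ->
  (\int[@lebesgue_measure R]_(t in `[a, b]) (dF t)%:E = (F b - F a)%:E)%E.
Proof.
move=> ab DF cdF; have cF : continuous F.
  move=> t; apply: differentiable_continuous; apply/derivable1_diffP.
  by have [] := DF t.
rewrite (@continuous_FTC2 _ dF F a b) ?EFinB//.
- exact: continuous_subspaceT.
- split; first by move=> t _; have [] := DF t.
  + by apply: cvg_at_right_filter; exact: cF.
  + by apply: cvg_at_left_filter; exact: cF.
- by move=> t _; rewrite derive1E; have [] := DF t.
Qed.

Lemma ind_pair r (s t : R) :
  ind r (s, t) = (\1_(`[-r, r]%classic : set R) s : R) * \1_(`[-r, r]%classic : set R) t.
Proof.
rewrite indE norm_le /= !indicE !ler_norml.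
have m u : (u \in (`[-r, r]%classic : set R)) = (-r <= u <= r).
  by apply/idP/idP; rewrite inE /= in_itv.
rewrite !m; case: (-r <= s <= r) => /=; rewrite ?mul0r ?mul1r//.
by case: (-r <= t <= r).
Qed.

Lemma Int_swap h : integ h ->
  (\int[@leb2 R]_z (h z)%:E =
   \int[@lebesgue_measure R]_t \int[@lebesgue_measure R]_s (h (s, t))%:E)%E.
Proof.
move=> ih; exact: (esym (@integral21_prod_meas1 _ _ _ _ R (@lebesgue_measure R)
  (@lebesgue_measure R) (EFin \o h) ih)).
Qed.

Lemma Int_noswap h : integ h ->
  (\int[@leb2 R]_z (h z)%:E =
   \int[@lebesgue_measure R]_s \int[@lebesgue_measure R]_t (h (s, t))%:E)%E.
Proof.
move=> ih; exact: (esym (@integral12_prod_meas1 _ _ _ _ R (@lebesgue_measure R)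
  (@lebesgue_measure R) (EFin \o h) ih)).
Qed.

Lemma integral_indicM (F : R -> R) (c : R) (I : set R) :
  (\int[@lebesgue_measure R]_t (F t * (\1_I t * c))%:E =
   \int[@lebesgue_measure R]_(t in I) (F t * c)%:E)%E.
Proof.
rewrite [RHS]integral_mkcond; apply: eq_integral => t _ /=.
rewrite patchE indicE; case: ifP => /= _; first by rewrite mul1r.
by rewrite mul0r mulr0.
Qed.

(** Fubini and the fundamental theorem of calculus in the [k]-th variable; the
    point [slice k (t, t) s] has [k]-th coordinate [s] and other coordinate [t]. *)
Lemma box_divergence h k L : 0 < L -> pderivable h -> continuous (partial k h) ->
  (\int[@leb2 R]_z (partial k h z * ind L z)%:E =
   \int[@lebesgue_measure R]_(t in `[(- L)%R, L%R])
     (h (slice k (t, t) L) - h (slice k (t, t) (- L)))%:E)%E.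
Proof.
move=> L0 dh cph; have L1 : - L < L by lra.
have ih : integ (fun z => partial k h z * ind L z) := (locint_cont cph).2 L.
have cs (t : R) : continuous (fun s => partial k h (slice k (t, t) s)).
  move=> s; apply: (@continuous_comp _ _ _ (slice k (t, t)) (partial k h)); last exact: cph.
  move: (k); apply: ord2P.
    apply: (@cvg_pair _ _ _ (nbhs s) (nbhs s) (nbhs t) _ _ _ id (cst t)); [exact: cvg_id|exact: cvg_cst].
  apply: (@cvg_pair _ _ _ (nbhs s) (nbhs t) (nbhs s) _ _ _ (cst t) id); [exact: cvg_cst|exact: cvg_id].
have inner (t : R) : (\int[@lebesgue_measure R]_(s in `[(- L)%R, L%R])
    (partial k h (slice k (t, t) s) * 1)%:E =
    (h (slice k (t, t) L) - h (slice k (t, t) (- L)))%:E)%E.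
  under eq_integral do rewrite mulr1.
  exact: (FTC_is_derive L1 (fun s => partial_slice k (t, t) s dh) (cs t)).
transitivity (\int[@lebesgue_measure R]_t \int[@lebesgue_measure R]_s
    (partial k h (slice k (t, t) s) *
      (\1_(`[(- L)%R, L%R]%classic : set R) s * \1_(`[(- L)%R, L%R]%classic : set R) t))%:E)%E.
  move: (k) ih; apply: ord2P => ih.
    rewrite (Int_swap ih); apply: eq_integral => t _; apply: eq_integral => s _ /=.
    by rewrite ind_pair.
  rewrite (Int_noswap ih); apply: eq_integral => t _; apply: eq_integral => s _ /=.
  by rewrite ind_pair [X in _ * X]mulrC.
rewrite [RHS]integral_mkcond; apply: eq_integral => t _ /=.
rewrite integral_indicM patchE indicE; case: ifP => _; first exact: inner.
by under eq_integral do rewrite mulr0; rewrite integral0.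
Qed.

(** The faces of a large square lie outside the support. *)
Lemma Int_partial0 h k r : pderivable h -> continuous (partial k h) ->
  supported r h -> \int[@leb2 R]_z partial k h z = 0.
Proof.
move=> dh cph hr; pose L := `|r| + 1.
have L0 : 0 < L by rewrite ltr_wpDl.
have rL : r < L by rewrite (le_lt_trans (ler_norm _))// ltrDl.
rewrite (_ : \int[@leb2 R]_z partial k h z = fine (0 : \bar R)%E)//.
rewrite -(integral0 (@lebesgue_measure R) `[(- L)%R, L%R]%classic) /Rintegral.
congr fine; transitivity (\int[@leb2 R]_z (partial k h z * ind L z)%:E)%E.
  apply: eq_integral => z _; rewrite (@supported_ind _ L (partial k h))//.
  by move=> w Lw; apply: (supported_partial k hr); exact: lt_trans Lw.
rewrite box_divergence//; apply: eq_integral => t _.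
have H (s : R) : `|s| = L -> h (slice k (t, t) s) = 0.
  move=> sL; apply: hr; apply: (lt_le_trans rL); rewrite -sL.
  by apply: le_trans (coord_le k _); rewrite coord_slice eqxx.
by rewrite !H ?subrr ?normrN ?gtr0_norm.
Qed.

End BoxDivergence.

(** * A smooth logarithmic potential and the kernels built from it *)

Section Kernels.
Context {R : realType}.
Implicit Types (f g h : R * R -> R) (x y z a b : R * R) (s t L C : R) (k l j : 'I_2).

Lemma sqnormE z : sqnorm z = z.1 * z.1 + z.2 * z.2.
Proof. by []. Qed.

Lemma sqnorm_ge0 z : 0 <= sqnorm z.
Proof. by rewrite sqnormE -!expr2 addr_ge0// sqr_ge0. Qed.

Lemma sqnorm_ge z : `|z| ^+ 2 <= sqnorm z.
Proof.
rewrite sqnormE normE -!expr2; have [h|h] := leP `|z.1| `|z.2|.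
  by rewrite real_normK ?num_real// lerDr sqr_ge0.
by rewrite real_normK ?num_real// lerDl sqr_ge0.
Qed.

Lemma sqnorm_gt0 z : z != 0 -> 0 < sqnorm z.
Proof. by move=> z0; rewrite (lt_le_trans _ (sqnorm_ge z))// exprn_gt0// normr_gt0. Qed.

Lemma sqnorm_affine0 s z : sqnorm (affine s 0 z) = s ^+ 2 * sqnorm z.
Proof. by rewrite !sqnormE /affine /= !addr0; ring. Qed.

Lemma coord_affine0 k s z : coord k (affine s 0 z) = s * coord k z.
Proof. by move: k; apply: ord2P; rewrite /affine /coord /= addr0. Qed.

Lemma norm_affine0 s z : 0 < s -> `|affine s 0 z| = s * `|z|.
Proof. by move=> s0; rewrite affine0E normrZ gtr0_norm. Qed.

(** The gradient of the logarithm of the Euclidean norm; turned by a right angle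
    and divided by [2 * pi], it is the Biot-Savart kernel. *)
Definition pker k z : R := coord k z / sqnorm z.

Lemma is_derive_val (V : normedModType R) (F : V -> R) (u v : V) (c e : R) :
  is_derive u v F c -> c = e -> is_derive u v F e.
Proof. by move=> H <-. Qed.

Lemma is_derive_sqnorm k z : is_derive z (basis k) (@sqnorm R) (2 * coord k z).
Proof.
have H l := is_derive_coord k l z.
have := is_deriveD (is_deriveM (H ord0) (H ord0)) (is_deriveM (H ord_max) (H ord_max)).
rewrite (_ : _ + _ = @sqnorm R); last by rewrite funeqE => w.
move=> /is_derive_val; apply; rewrite /GRing.scale /=.
by move: k {H}; apply: ord2P; rewrite /= ?mulr1 ?mulr0; ring.
Qed.

Lemma is_derive_halfln k z : z != 0 ->
  is_derive z (basis k) (fun w => 2^-1 * ln (sqnorm w)) (pker k z).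
Proof.
move=> z0; have H := is_derive_ln (sqnorm_gt0 z0) (is_derive_sqnorm k z).
have /is_derive_val := is_deriveZ (2^-1) H; apply.
rewrite /GRing.scale /= /pker; field.
by rewrite gt_eqF ?sqnorm_gt0.
Qed.

(** [K_kernel] is minus the Hessian of the logarithm of the Euclidean norm. *)
Lemma is_derive_pker k l z : z != 0 ->
  is_derive z (basis l) (pker k) (- K_kernel k l z).
Proof.
move=> z0; have n0 : sqnorm z != 0 by rewrite gt_eqF ?sqnorm_gt0.
have H := is_derive_inv n0 (is_derive_sqnorm l z).
have := is_deriveM (is_derive_coord l k z) H.
rewrite (_ : _ * _ = pker k); last by rewrite funeqE => w.
move=> /is_derive_val; apply; rewrite /GRing.scale /= /K_kernel eq_sym.
by field.
Qed.

(** Harmonicity of the logarithm. *)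
Lemma K_trace z : K_kernel ord0 ord0 z + K_kernel ord_max ord_max z = 0 :> R.
Proof.
rewrite /K_kernel !eqxx -mulrDl (_ : _ + _ = 0) ?mul0r//.
by rewrite /coord /= sqnormE; ring.
Qed.

Definition Lap f z : R := partial ord0 (partial ord0 f) z + partial ord_max (partial ord_max f) z.

Lemma smooth_Lap f : smooth f -> smooth (Lap f).
Proof. by move=> sf; apply: smoothD; do 2 apply: smooth_partial. Qed.

Lemma test_add f g : test_function f -> test_function g -> test_function (fun z => f z + g z).
Proof.
move=> /test_functionP[sf [r r0 fr]] /test_functionP[sg [r' r0' gr]].
apply/test_functionP; split; first exact: smoothD.
exists (Num.max r r') => [|z]; first by rewrite lt_max r0.
by rewrite gt_max => /andP[/fr -> /gr ->]; rewrite addr0.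
Qed.

Lemma test_sub f g : test_function f -> test_function g -> test_function (fun z => f z - g z).
Proof.
move=> tf tg; rewrite (_ : (fun _ => _) = fun z => f z + (-1) * g z).
  by apply: test_add => //; exact: test_scale.
by rewrite funeqE => z; rewrite mulN1r.
Qed.

Lemma test_mull f g : test_function f -> smooth g -> test_function (fun z => f z * g z).
Proof.
move=> /test_functionP[sf [r r0 fr]] sg; apply/test_functionP; split.
  exact: smoothM.
by exists r => // z /fr ->; rewrite mul0r.
Qed.

Lemma pderivable_affine f (a : R) c : pderivable f -> pderivable (f \o affine a c).
Proof.
move=> df l z; have H := partialP l (affine a c z) df.
by have [] := is_derive_affine H.
Qed.

End Kernels.

Section Potential.
Context {R : realType}.
Implicit Types (z : R * R) (k l : 'I_2).

(** Adding the square of a bump supported near the origin removes the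
    singularity of the logarithm without changing it elsewhere. *)
Lemma potential_exists (chi : R * R -> R) (d : R) : test_function chi -> chi 0 = 1 ->
  0 < d -> exists2 Et, smooth Et & forall z, d < `|z| -> Et z = 2^-1 * ln (sqnorm z).
Proof.
move=> /test_functionP[schi [r r0 chir]] chi0 d0; pose c := r / d.
have c0 : 0 < c by rewrite divr_gt0.
pose b z := chi (affine c 0 z).
have sb : smooth b by exact: smooth_affine.
pose N z := sqnorm z + b z * b z.
have N0 z : 0 < N z.
  have [->|z0] := eqVneq z 0.
    rewrite /N /b (_ : affine c 0 0 = 0); last by rewrite /affine /= !mulr0 !addr0.
    by rewrite chi0 mulr1 ltr_wpDl// sqnorm_ge0.
  by rewrite /N ltr_pwDl ?sqnorm_gt0// -expr2 sqr_ge0.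
have sN : smooth N.
  apply: smoothD; last exact: smoothM.
  by apply: smoothD; apply: smoothM; try exact: (smooth_coord ord0); exact: (smooth_coord ord_max).
exists (fun z => 2^-1 * ln (N z)); first by apply: smoothZ; exact: smooth_ln.
move=> z dz; rewrite /N /b chir ?mulr0 ?addr0//.
by rewrite norm_affine0// /c -mulrA ltr_pMr// ltr_pdivlMl// mulr1.
Qed.

Variables (Et : R * R -> R) (d : R).
Hypothesis d_gt0 : 0 < d.
Hypotheses (Et_smooth : smooth Et) (Et_far : forall z, d < `|z| -> Et z = 2^-1 * ln (sqnorm z)).

Lemma far_neq0 z : d < `|z| -> z != 0.
Proof. by move=> dz; rewrite -normr_gt0 (lt_trans d_gt0). Qed.

Lemma partial_Et_far k z : d < `|z| -> partial k Et z = pker k z.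
Proof.
by move=> dz; have [_] := is_derive_far Et_far dz (is_derive_halfln k (far_neq0 dz)).
Qed.

Lemma partial2_Et_far k l z : d < `|z| -> partial l (partial k Et) z = - K_kernel k l z.
Proof.
move=> dz; have [_] // := is_derive_far (@partial_Et_far k) dz (is_derive_pker k l (far_neq0 dz)).
Qed.

Lemma Lap_Et_far z : d < `|z| -> Lap Et z = 0.
Proof. by move=> dz; rewrite /Lap !partial2_Et_far// -opprD K_trace oppr0. Qed.

Lemma test_LapEt : test_function (Lap Et).
Proof.
apply/test_functionP; split; first exact: smooth_Lap.
by exists d => //; exact: Lap_Et_far.
Qed.

(** The flux of the gradient of the logarithm through the boundary of a square
    is eight times the integral of [L / (L ^ 2 + t ^ 2)] over half a side, that
    is [8 * atan 1]. *)
Lemma Int_LapEt : \int[@leb2 R]_z Lap Et z = 2 * pi.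
Proof.
pose L := d + 1; have L0 : 0 < L by rewrite addr_gt0.
have dL : d < L by rewrite ltrDl.
have LL : - L < L by lra.
pose h k := partial k Et.
have sh k : smooth (h k) by exact: smooth_partial.
have side k : (\int[@leb2 R]_z (partial k (h k) z * ind L z)%:E = pi%:E)%E.
  rewrite box_divergence//; last 2 first.
  - exact: (smooth_pderivable (sh k)).
  - exact: (smooth_continuous (smooth_partial k (sh k))).
  transitivity (\int[@lebesgue_measure R]_(t in `[(- L)%R, L%R])
      (2 * L / (L ^+ 2 + t ^+ 2))%:E)%E.
    apply: eq_integral => t _; congr EFin.
    have far s : `|s| = L -> d < `|slice k (t, t) s|.
      move=> sL; apply: (lt_le_trans dL); rewrite -sL.
      by apply: le_trans (coord_le k _); rewrite coord_slice eqxx.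
    rewrite /h !partial_Et_far; try by apply: far; rewrite ?normrN gtr0_norm.
    have D : L ^+ 2 + t ^+ 2 != 0.
      by rewrite gt_eqF// ltr_pwDl ?exprn_gt0// sqr_ge0.
    rewrite /pker !coord_slice eqxx.
    have N s : s ^+ 2 = L ^+ 2 -> sqnorm (slice k (t, t) s) = L ^+ 2 + t ^+ 2.
      by move=> <-; move: (k); apply: ord2P; rewrite sqnormE /= -!expr2// addrC.
    by rewrite !N ?sqrrN//; field.
  (* the primitive of the integrand *)
  have D (t : R) : is_derive t 1 (fun t => 2 * atan (L^-1 * t)) (2 * L / (L ^+ 2 + t ^+ 2)).
    have H1 : is_derive t (1 : R) (L^-1 *: id) (L^-1 *: (1 : R)) by apply: is_deriveZ.
    have H2 := is_deriveZ 2 (is_derive1_comp (is_derive1_atan _) H1).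
    apply: (is_derive_val H2); rewrite [L^-1 *: 1]mulr1 /GRing.scale /=.
    have D0 : L ^+ 2 + t ^+ 2 != 0.
      by rewrite gt_eqF// ltr_pwDl ?exprn_gt0// sqr_ge0.
    rewrite (_ : L^-1 *: t = L^-1 * t)//; field.
    by rewrite D0 gt_eqF.
  rewrite (FTC_is_derive LL D).
    have Ln : L != 0 by rewrite gt_eqF.
    by congr EFin; rewrite mulrN atanN mulVf// atan1; field.
  move=> t; apply: cvgM; first exact: cvg_cst.
  apply: cvgV; first by rewrite gt_eqF// ltr_pwDl ?exprn_gt0// sqr_ge0.
  by apply: cvgD; [exact: cvg_cst|exact: exprn_continuous].
have i_h k : integ (fun z => partial k (h k) z * ind L z).
  exact: (locint_cont (smooth_continuous (smooth_partial k (sh k)))).2.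
transitivity (\int[@leb2 R]_z (partial ord0 (h ord0) z * ind L z +
    partial ord_max (h ord_max) z * ind L z)).
  apply: Int_eq => z; rewrite -mulrDl indE; have [zL|Lz] := leP `|z| L; rewrite ?mulr1 ?mulr0//.
  by rewrite Lap_Et_far// (lt_trans dL).
have S k : \int[@leb2 R]_z (partial k (h k) z * ind L z) = pi.
  by rewrite /Rintegral side.
have -> : 2 * pi = pi + pi :> R by ring.
exact: (etrans (IntD (i_h ord0) (i_h ord_max)) (congr2 +%R (S ord0) (S ord_max))).
Qed.

End Potential.

(** * The vorticity form of the Euler nonlinearity *)

Section Vorticity.
Context {R : realType}.
Implicit Types (f g h a psi : R * R -> R) (x y z : R * R) (r s t L C : R) (k l j : 'I_2).

Lemma conv_rescale_bound f C (k : R * R -> R) s x : meas f -> (forall z, `|f z| <= C) ->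
  test_function k -> 0 < s -> `|conv f (rescale s k) x| <= C * \int[@leb2 R]_z `|k z|.
Proof.
move=> mf fC tk s0; have lf := locint_bounded mf fC.
have ik : integ (fun z => `|k z|) by apply: integ_norm; exact: integ_test.
rewrite conv_rescale//; last by apply: integ_conv => //; exact: test_rescale.
rewrite -IntZ//; apply: Int_norm_le; last 2 first.
- exact: integZ.
- by move=> z; rewrite normrM ler_wpM2r.
apply: (@integ_le _ _ (fun z => C * `|k z|)).
- by apply: measM; [exact: measurable_comp_affine|exact: meas_test].
- exact: integZ.
- by move=> z; rewrite normrM ler_wpM2r.
Qed.

Lemma conv_rescale_supported g (k : R * R -> R) s (rg rk : R) : 0 < s -> s <= 1 -> 0 < rk ->
  supported rg g -> supported rk k -> supported (rg + rk) (conv g (rescale s k)).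
Proof.
move=> s0 s1 rk0 gr kr x rx; rewrite -[RHS](@Int0 R); apply: Int_eq => y.
have [yr|ry] := leP `|y| rg; last by rewrite (gr _ ry) mul0r.
rewrite (supported_rescale s0 kr) ?mulr0//.
have : `|x| <= `|x - y| + `|y| by rewrite -{1}(subrK y x) ler_normD.
have : s * rk <= rk by rewrite ler_piMl// ltW.
lra.
Qed.

Section Classical.
Variables (a0 a1 p0 p1 : R * R -> R).
Hypotheses (a0C : Cn 1 a0) (a1C : Cn 1 a1) (tp0 : test_function p0) (tp1 : test_function p1).

(** The pairing of the trace-free part of the matrix with entries [a_k * a_l] with
    the gradient of the field [(p0, p1)]. *)
Definition quad z : R :=
  (a0 z * a0 z - a1 z * a1 z) * (2^-1 * (partial ord0 p0 z - partial ord_max p1 z)) +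
  a0 z * a1 z * (partial ord_max p0 z + partial ord0 p1 z).

(** For a smooth solenoidal field [a] the vector field
    [(a . p) a - |a| ^ 2 / 2 p] has the integrand as its divergence. *)
Lemma classical_vorticity_identity :
  (forall z, partial ord0 a0 z + partial ord_max a1 z = 0) ->
  \int[@leb2 R]_z ((partial ord0 a1 z - partial ord_max a0 z) * (a0 z * p1 z - a1 z * p0 z)
    + quad z) = 0.
Proof.
move=> div0.
have C_p (p : R * R -> R) : test_function p -> Cn 1 p by move=> /test_smooth/smoothP.
have [p0C p1C] := (C_p _ tp0, C_p _ tp1).
pose S z := a0 z * p0 z + a1 z * p1 z.
pose A z := a0 z * a0 z + a1 z * a1 z.
have SC : Cn 1 S by apply: Cn_add; exact: Cn_mul.
have AC : Cn 1 A by apply: Cn_add; exact: Cn_mul.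
pose V a p z := a z * S z + (- 2^-1) * (A z * p z).
have VC a p : Cn 1 a -> Cn 1 p -> Cn 1 (V a p).
  move=> aC pC; apply: Cn_add; first exact: Cn_mul.
  by apply: (@Cn_mul _ _ (fun=> - 2^-1)); [exact: Cn_cst|exact: Cn_mul].
have [_ [r0 r0_gt0 pr0]] := (test_functionP p0).1 tp0.
have [_ [r1 r1_gt0 pr1]] := (test_functionP p1).1 tp1.
have sV a p : (forall z, r0 + r1 < `|z| -> p z = 0) -> supported (r0 + r1) (V a p).
  move=> pr z rz; have h0 : p0 z = 0 by apply: pr0; lra.
  have h1 : p1 z = 0 by apply: pr1; lra.
  by rewrite /V /S (pr _ rz) h0 h1 !mulr0 !addr0 !mulr0.
have D k z f : Cn 1 f -> is_derive z (basis k) f (partial k f z).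
  by move=> [_ [df _]]; exact: partialP.
have DV k z a p : Cn 1 a -> Cn 1 p -> partial k (V a p) z =
    partial k a z * S z + a z * (partial k a0 z * p0 z + a0 z * partial k p0 z +
      (partial k a1 z * p1 z + a1 z * partial k p1 z)) -
    2^-1 * ((2 * (a0 z * partial k a0 z) + 2 * (a1 z * partial k a1 z)) * p z + A z * partial k p z).
  move=> aC pC.
  have HM f h (df dh : R) : is_derive z (basis k) f df -> is_derive z (basis k) h dh ->
      is_derive z (basis k) (fun w => f w * h w) (f z * dh + h z * df).
    by move=> Hf Hh; exact: is_deriveM Hf Hh.
  have HD f h (df dh : R) : is_derive z (basis k) f df -> is_derive z (basis k) h dh ->
      is_derive z (basis k) (fun w => f w + h w) (df + dh).
    by move=> Hf Hh; exact: is_deriveD Hf Hh.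
  have HZ f (df c : R) : is_derive z (basis k) f df -> is_derive z (basis k) (fun w => c * f w) (c * df).
    by move=> Hf; exact: (is_deriveZ c Hf).
  have HS : is_derive z (basis k) S _ :=
    HD _ _ _ _ (HM _ _ _ _ (D k z _ a0C) (D k z _ p0C)) (HM _ _ _ _ (D k z _ a1C) (D k z _ p1C)).
  have HA : is_derive z (basis k) A _ :=
    HD _ _ _ _ (HM _ _ _ _ (D k z _ a0C) (D k z _ a0C)) (HM _ _ _ _ (D k z _ a1C) (D k z _ a1C)).
  have [_ E] : is_derive z (basis k) (V a p) _ :=
    HD _ _ _ _ (HM _ _ _ _ (D k z _ aC) HS) (HZ _ _ (- 2^-1) (HM _ _ _ _ HA (D k z _ pC))).
  by rewrite [LHS]E; ring.
have iV k a p : Cn 1 a -> Cn 1 p -> (forall z, r0 + r1 < `|z| -> p z = 0) ->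
    integ (partial k (V a p)) /\ \int[@leb2 R]_z partial k (V a p) z = 0.
  move=> aC pC pr; have [_ [dV cV]] := VC a p aC pC.
  have cpV : continuous (partial k (V a p)) by have [] := cV k.
  have spV : supported (r0 + r1) (partial k (V a p)).
    by apply: supported_partial; exact: sV.
  have [C C0 HC] := supported_bounded cpV spV.
  split; first exact: (integ_bounded (meas_cont cpV) HC spV).
  by apply: (Int_partial0 dV cpV); exact: sV.
have [|i0 I0] := iV ord0 a0 p0 a0C p0C; first by move=> z rz; rewrite pr0//; lra.
have [|i1 I1] := iV ord_max a1 p1 a1C p1C; first by move=> z rz; rewrite pr1//; lra.
transitivity (\int[@leb2 R]_z (partial ord0 (V a0 p0) z + partial ord_max (V a1 p1) z)).
  apply: Int_eq => z; rewrite (DV _ _ a0 p0 a0C p0C) (DV _ _ a1 p1 a1C p1C).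
  have -> : partial ord_max a1 z = - partial ord0 a0 z.
    by apply/eqP; rewrite -addr_eq0 addrC div0.
  rewrite /quad /S /A; move: (partial ord0 a0 z) (partial ord_max a0 z) (partial ord0 a1 z).
  move: (partial ord0 p0 z) (partial ord_max p0 z) (partial ord0 p1 z) (partial ord_max p1 z).
  by move: (a0 z) (a1 z) (p0 z) (p1 z) => *; field.
by rewrite IntD// I0 I1 addr0.
Qed.

End Classical.

(** The classical identity is applied to the mollified field. The mollified
    vorticity does not converge pointwise, but in its pairing with the fixed
    field [g] the mollifier can be moved onto [g]; the other terms converge
    pointwise and dominatedly because the field is continuous and bounded. *)
Lemma vorticity_identity (U0 U1 om p0 p1 rho : R * R -> R) C :
  continuous U0 -> continuous U1 -> meas om ->
  (forall z, `|U0 z| <= C) -> (forall z, `|U1 z| <= C) -> (forall z, `|om z| <= C) ->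
  (forall phi, test_function phi ->
    \int[@leb2 R]_z (U0 z * partial ord0 phi z) + \int[@leb2 R]_z (U1 z * partial ord_max phi z) = 0) ->
  (forall phi, test_function phi ->
    \int[@leb2 R]_z (om z * phi z) =
    \int[@leb2 R]_z (U0 z * partial ord_max phi z) - \int[@leb2 R]_z (U1 z * partial ord0 phi z)) ->
  test_function rho -> \int[@leb2 R]_z rho z = 1 ->
  test_function p0 -> test_function p1 ->
  \int[@leb2 R]_z (om z * (U0 z * p1 z - U1 z * p0 z)) + \int[@leb2 R]_z quad U0 U1 p0 p1 z = 0.
Proof.
move=> cU0 cU1 mom U0C U1C omC hdiv hcurl trho rho1 tp0 tp1.
have [mU0 mU1] := (meas_cont cU0, meas_cont cU1).
have [lU0 lU1 lom] := And3 (locint_bounded mU0 U0C) (locint_bounded mU1 U1C) (locint_bounded mom omC).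
have C0 : 0 <= C by rewrite (le_trans _ (U0C 0)).
pose s (n : nat) : R := n.+1%:R^-1.
have s0 n : 0 < s n by rewrite invr_gt0.
have s1 n : s n <= 1 by rewrite invf_le1// ler1n.
pose rn n := rescale (s n) rho.
have trn n : test_function (rn n) by exact: test_rescale.
pose a0 n := conv U0 (rn n); pose a1 n := conv U1 (rn n); pose w n := conv om (rn n).
have aC f n : locint f -> Cn 1 (conv f (rn n)).
  move=> lf; split; first exact: conv_continuous.
  split=> [|k]; first exact: conv_pderivable.
  by rewrite partial_conv//; split => //; apply: conv_continuous => //; exact: test_partial.
have pE f k n z : locint f -> partial k (conv f (rn n)) z =
    - \int[@leb2 R]_y (f y * partial k (fun y => rn n (z - y)) y).
  move=> lf; rewrite partial_conv// /conv -IntN; last first.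
    rewrite partial_refl; last by apply: smooth_pderivable; exact: test_smooth.
    apply: (integ_eq _ (integZ (-1) (@integ_conv _ f (partial k (rn n)) z lf (test_partial k (trn n))))).
    by move=> y; rewrite mulrN mulN1r.
  apply: Int_eq => y; rewrite partial_refl; last by apply: smooth_pderivable; exact: test_smooth.
  by rewrite mulrN opprK.
have div0 n z : partial ord0 (a0 n) z + partial ord_max (a1 n) z = 0.
  by rewrite !pE// -opprD hdiv ?oppr0//; exact: test_refl.
have curl n z : partial ord0 (a1 n) z - partial ord_max (a0 n) z = w n z.
  by rewrite !pE// [RHS](hcurl _ (test_refl z (trn n))) opprK addrC.
pose M := C * (1 + \int[@leb2 R]_z `|rho z|).
have Irho : 0 <= \int[@leb2 R]_z `|rho z| by exact: Rintegral_ge0.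
have M0 : 0 <= M by rewrite mulr_ge0// addr_ge0.
have CM : C <= M by rewrite ler_peMr// lerDl.
have bM f n z : meas f -> (forall z, `|f z| <= C) -> `|conv f (rn n) z| <= M.
  move=> mf fC; apply: (le_trans (conv_rescale_bound z mf fC trho (s0 n))).
  by rewrite ler_wpM2l// lerDr.
have b0 n z : `|a0 n z| <= M by exact: bM.
have b1 n z : `|a1 n z| <= M by exact: bM.
have bw n z : `|w n z| <= M by exact: bM.
have cv f z : continuous f -> (forall z, `|f z| <= C) ->
    conv f (rn n) z @[n --> \oo] --> f z.
  move=> cf fC; rewrite -[X in _ --> X]mulr1 -rho1.
  by apply: (conv_rescale_cvg (C := C)) => //; [exact: meas_cont|exact: cf].
pose g z := U0 z * p1 z - U1 z * p0 z.
(* what the classical identity leaves besides the pairing of [w n] with [g] *)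
pose F n z := w n z * ((a0 n z - U0 z) * p1 z - (a1 n z - U1 z) * p0 z) + quad (a0 n) (a1 n) p0 p1 z.
have [mp0 mp1] := (meas_test tp0, meas_test tp1).
have tp k p : test_function p -> test_function (partial k p) by exact: test_partial.
pose T z := 2^-1 * (partial ord0 p0 z - partial ord_max p1 z).
pose T' z := partial ord_max p0 z + partial ord0 p1 z.
have tT : test_function T by apply: test_scale; apply: test_sub; exact: test_partial.
have tT' : test_function T' by apply: test_add; exact: test_partial.
have ma f n : locint f -> meas (conv f (rn n)).
  by move=> lf; apply: meas_cont; exact: conv_continuous.
have mquad f h : meas f -> meas h -> meas (quad f h p0 p1).
  move=> mf mh; apply: measD; apply: measM.
  - by apply: measB; exact: measM.
  - exact: meas_test tT.
  - exact: measM.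
  - exact: meas_test tT'.
have mF n : meas (F n).
  apply: measD; last by apply: mquad; exact: ma.
  apply: measM; first exact: ma.
  by apply: measB; apply: measM => //; apply: measB => //; exact: ma.
pose dom z := M * (2 * M * `|p1 z| + 2 * M * `|p0 z|) + (2 * M ^+ 2 * `|T z| + M ^+ 2 * `|T' z|).
have idom : integ dom.
  have it p : test_function p -> integ (fun z => `|p z|).
    by move=> t_p; apply: integ_norm; exact: integ_test.
  apply: integD; first by apply: integZ; apply: integD; apply: integZ; exact: it.
  by apply: integD; apply: integZ; exact: it.
have qb f h z : `|f z| <= M -> `|h z| <= M ->
    `|quad f h p0 p1 z| <= 2 * M ^+ 2 * `|T z| + M ^+ 2 * `|T' z|.
  move=> fM hM.
  have h1 : `|f z * f z - h z * h z| <= 2 * M ^+ 2.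
    apply: (le_trans (ler_normB _ _)); rewrite !normrM.
    have H1 : `|f z| * `|f z| <= M * M by exact: ler_pM.
    have H2 : `|h z| * `|h z| <= M * M by exact: ler_pM.
    by rewrite expr2; lra.
  have h2 : `|f z * h z| <= M ^+ 2 by rewrite normrM expr2 ler_pM.
  apply: (le_trans (ler_normD _ _)); apply: lerD.
    by rewrite normrM; apply: (ler_wpM2r (normr_ge0 (T z))).
  by rewrite normrM; apply: (ler_wpM2r (normr_ge0 (T' z))).
have Fdom n z : `|F n z| <= dom z.
  apply: (le_trans (ler_normD _ _)); apply: lerD; last exact: qb.
  rewrite normrM; apply: ler_pM => //.
  apply: (le_trans (ler_normB _ _)); rewrite !normrM.
  have dM (c d : R) : `|c| <= M -> `|d| <= C -> `|c - d| <= 2 * M.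
    by move=> cM dC; rewrite (le_trans (ler_normB _ _))//; have := CM; lra.
  by apply: lerD; rewrite ler_wpM2r// dM.
have mg : meas g by apply: measB; exact: measM.
have [_ limF] : integ (quad U0 U1 p0 p1) /\
    \int[@leb2 R]_z F n z @[n --> \oo] --> \int[@leb2 R]_z quad U0 U1 p0 p1 z.
  apply: (@Int_dominated _ F _ dom) => //; first exact: mquad.
  apply: aeW => z; have [c0 c1] := (cv _ z cU0 U0C, cv _ z cU1 U1C).
  rewrite -[X in _ --> X]add0r; apply: cvgD; last first.
    apply: cvgD; apply: cvgM; try exact: cvg_cst.
      by apply: cvgB; exact: cvgM.
    exact: cvgM.
  have c2 : (a0 n z - U0 z) * p1 z - (a1 n z - U1 z) * p0 z @[n --> \oo] --> (0 : R).
    have -> : (0 : R) = (U0 z - U0 z) * p1 z - (U1 z - U1 z) * p0 z by rewrite !subrr !mul0r subrr.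
    by apply: cvgB; (apply: cvgM; last exact: cvg_cst); (apply: cvgB; last exact: cvg_cst).
  have nc2 := cvg_norm c2; rewrite normr0 in nc2.
  apply/norm_cvg0P.
  apply: (@squeeze_cvgr _ _ _ _ (fun=> 0) (fun n => M * `|(a0 n z - U0 z) * p1 z - (a1 n z - U1 z) * p0 z|)).
  - by apply: nearW => n; rewrite normr_ge0 normrM ler_wpM2r.
  - exact: cvg_cst.
  - by rewrite -[X in _ --> X](mulr0 M); apply: cvgM; [exact: cvg_cst|exact: nc2].
have [_ [r0 r0_gt0 pr0]] := (test_functionP p0).1 tp0.
have [_ [r1 r1_gt0 pr1]] := (test_functionP p1).1 tp1.
have [_ [rr rr_gt0 rhor]] := (test_functionP (reflect rho)).1 (test_reflect trho).
have gr : supported (r0 + r1) g.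
  by move=> z rz; rewrite /g pr0 ?pr1 ?mulr0 ?subrr//; lra.
have [B0 B0_ge0 pB0] := test_bounded tp0.
have [B1 B1_ge0 pB1] := test_bounded tp1.
pose B := C * B1 + C * B0.
have gB z : `|g z| <= B.
  by apply: (le_trans (ler_normB _ _)); rewrite !normrM; apply: lerD; apply: ler_pM.
have cg : continuous g.
  move=> z; have cp (p : R * R -> R) : test_function p -> continuous p.
    by move=> t_p; exact: (smooth_continuous (test_smooth t_p)).
  by apply: cvgB; apply: cvgM; [exact: cU0|exact: (cp _ tp1 z)|exact: cU1|exact: (cp _ tp0 z)].
have r01 : 0 <= r0 + r1 by rewrite addr_ge0// ltW.
have pair n : \int[@leb2 R]_z (g z * w n z) =
    \int[@leb2 R]_z (om z * conv g (rescale (s n) (reflect rho)) z).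
  rewrite (conv_pairing lom (trn n) mg gB r01 gr); apply: Int_eq => y.
  by rewrite conv_rescale_reflect.
pose Bd := B * \int[@leb2 R]_z `|reflect rho z|.
have [_ limG] : integ (fun z => om z * g z) /\
    \int[@leb2 R]_z (om z * conv g (rescale (s n) (reflect rho)) z) @[n --> \oo] -->
    \int[@leb2 R]_z (om z * g z).
  have lg := locint_bounded mg gB.
  have tr := test_reflect trho.
  apply: (@Int_dominated _ (fun n z => om z * conv g (rescale (s n) (reflect rho)) z) _
    (fun z => C * (Bd * ind (r0 + r1 + rr) z))).
  - move=> n; apply: measM => //; apply: meas_cont; apply: conv_continuous => //.
    exact: test_rescale.
  - exact: measM.
  - apply: aeW => z; apply: cvgM; first exact: cvg_cst.
    rewrite -[X in _ --> X]mulr1 -rho1 -Int_reflect; last exact: integ_test.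
    by apply: (conv_rescale_cvg (C := B)) => //; exact: cg.
  - by apply: integZ; apply: integZ; exact: integ_ind.
  - move=> n z; rewrite normrM; apply: ler_pM => //.
    apply: supported_norm_le; last exact: conv_rescale_supported.
    by move=> x; exact: conv_rescale_bound.
have zero n : \int[@leb2 R]_z F n z + \int[@leb2 R]_z (g z * w n z) = 0.
  rewrite -IntD; last 2 first.
  - exact: integ_le (mF n) idom (Fdom n).
  - apply: (@integ_bounded _ (B * M) (r0 + r1)).
    + by apply: measM => //; exact: ma.
    + by move=> z; rewrite normrM; apply: ler_pM.
    + by move=> z rz; rewrite gr// mul0r.
  rewrite -[RHS](classical_vorticity_identity (aC _ n lU0) (aC _ n lU1) tp0 tp1 (div0 n)).
  apply: Int_eq => z; rewrite -/(a0 n) -/(a1 n) curl /F /g; ring.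
have lim0 : (fun n => \int[@leb2 R]_z F n z + \int[@leb2 R]_z (g z * w n z)) @ \oo -->
    \int[@leb2 R]_z quad U0 U1 p0 p1 z + \int[@leb2 R]_z (om z * g z).
  apply: cvgD; first exact: limF.
  by move: limG; rewrite -(funext pair); exact.
rewrite addrC; move: lim0; rewrite (funext zero) => lim0.
apply: (cvg_unique _ lim0 (cvg_cst _)); exact: norm_hausdorff.
Qed.

End Vorticity.

(** * Integrability by dyadic decomposition *)

Section Dyadic.
Context {R : realType}.
Notation P := (measurableTypeR R * measurableTypeR R)%type.
Implicit Types (f g h : R * R -> R) (x y z a b : R * R) (r s t L C : R).

(** The function is dominated by the sum of the [c n * ind (rho n) z], whose
    integrals form a geometric series. *)
Lemma integ_dyadic f (c rho : nat -> R) (A : R) : meas f -> (forall z, 0 <= f z) ->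
  (forall n, 0 <= c n) -> (forall n, 0 <= rho n) ->
  (forall n, c n * (2 * rho n) ^+ 2 = A * 2^-1 ^+ n) ->
  (forall z, exists n, f z <= c n * ind (rho n) z) -> integ f.
Proof.
move=> mf f0 c0 rho0 cA fc; pose F n z := c n * ind (rho n) z.
have F0 n z : 0 <= F n z by rewrite mulr_ge0// ind_ge0.
have mF n : measurable_fun setT (fun z : P => (F n z)%:E).
  by apply/measurable_EFinP; apply: measM; [exact: measurable_cst|exact: meas_ind].
apply/integrableP; split; first exact/measurable_EFinP.
apply: (@le_lt_trans _ _ (\int[@leb2 R]_z (\sum_(n <oo) (F n z)%:E))%E).
  apply: ge0_le_integral => //.
  - by apply/measurable_EFinP; apply: measurableT_comp.
  - by apply: ge0_emeasurable_sum => // n z _ _; rewrite lee_fin.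
  - move=> z _; rewrite /= ger0_norm//; have [n fn] := fc z.
    apply: (@le_trans _ _ (F n z)%:E); first by rewrite lee_fin.
    apply: (@le_trans _ _ (\sum_(0 <= k < n.+1) (F k z)%:E)%E).
      by rewrite big_nat_recr//= leeDr// sume_ge0// => k _; rewrite lee_fin.
    by apply: nneseries_lim_ge => k _ _; rewrite lee_fin.
rewrite integral_nneseries//; last by move=> n z _; rewrite lee_fin.
have E n : (\int[@leb2 R]_z (F n z)%:E = (A * 2^-1 ^+ n)%:E)%E.
  rewrite integ_fineK; last by apply: integZ; exact: integ_ind.
  by rewrite IntZ ?Int_ind ?cA//; exact: integ_ind.
under eq_eseriesr do rewrite E.
have half : `|2^-1 : R| < 1 by rewrite ger0_norm ?invr_ge0// invf_lt1 ?ltr1n.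
have := @cvg_geometric_series R A 2^-1 half.
move=> cvgS.
rewrite (_ : (\sum_(n <oo) _)%E = (A / (1 - 2^-1))%:E) ?ltry//.
apply: cvg_lim => //; apply/fine_cvgP; split.
  by apply: nearW => n; rewrite sumEFin.
rewrite (_ : fine \o _ = series (geometric A 2^-1))//.
by rewrite funeqE => n; rewrite /= sumEFin.
Qed.

Lemma pow2_gt t : exists n : nat, t <= 2 ^+ n.
Proof.
exists (Num.bound t); apply: ltW; exact: upper_nthrootP.
Qed.

Lemma exists_dyadic t : exists2 n : nat, t <= 2 ^+ n & n = 0%N \/ 2 ^+ n < 2 * t.
Proof.
have [n0 Hn0] := pow2_gt t.
have ex : exists n, t <= 2 ^+ n by exists n0.
case: (ex_minnP ex) => n tn nmin; exists n => //.
case: n tn nmin => [|n] tn nmin; [by left|right].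
rewrite exprS ltr_pM2l// ltNge; apply/negP => tn'.
by have := nmin _ tn'; rewrite ltnn.
Qed.

(** The decay at infinity of the gradient of a kernel of order [-2]. *)
Definition decay z : R := ((1 + `|z|) ^+ 3)^-1.

Lemma decay_pos z : 0 < 1 + `|z| :> R.
Proof. by rewrite ltr_pwDl. Qed.

Lemma decay_ge0 z : 0 <= decay z.
Proof. by rewrite invr_ge0 exprn_ge0// ltW// decay_pos. Qed.

Lemma continuous_decay : continuous decay.
Proof.
move=> z; apply: cvgV; first by rewrite gt_eqF// exprn_gt0// decay_pos.
apply: (@continuous_comp _ _ _ (fun w : R * R => 1 + `|w|) (fun t => t ^+ 3)).
  by apply: cvgD; [exact: cvg_cst|exact: norm_continuous].
exact: exprn_continuous.
Qed.

Lemma integ_decay : integ decay.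
Proof.
apply: (@integ_dyadic _ (fun n => 8 * 8^-1 ^+ n) (fun n => 2 ^+ n) 32).
- exact: meas_cont continuous_decay.
- exact: decay_ge0.
- by move=> n; rewrite mulr_ge0// exprn_ge0// invr_ge0.
- by move=> n; rewrite exprn_ge0.
- move=> n; rewrite exprMn -exprM mulnC exprM.
  have -> : (2 : R) ^+ 2 = 4 by ring.
  have -> : 8 * 8^-1 ^+ n * (4 * 4 ^+ n) = 32 * (8^-1 ^+ n * 4 ^+ n) :> R by ring.
  by rewrite -exprMn; congr (_ * _ ^+ n); field.
move=> z; have [n zn nz] := exists_dyadic `|z|.
exists n; rewrite indE zn mulr1 /decay.
rewrite exprVn -[leLHS]div1r ler_pdivrMr ?exprn_gt0 ?decay_pos// mulrAC.
rewrite ler_pdivlMr ?exprn_gt0// mul1r.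
have -> : (8 : R) ^+ n = (2 ^+ n) ^+ 3.
  by rewrite -exprM mulnC exprM; congr (_ ^+ n); ring.
have -> : 8 * (1 + `|z|) ^+ 3 = (2 * (1 + `|z|)) ^+ 3 by ring.
apply: lerXn2r; rewrite ?nnegrE ?exprn_ge0 ?mulr_ge0 ?ltW ?decay_pos//.
have := normr_ge0 z; case: nz => [->|]; first by rewrite expr0; lra.
by lra.
Qed.

(** The convention [x / 0 = 0] makes the quotient the limit of [f / (g + e)]. *)
Lemma meas_quotient f g : continuous f -> continuous g -> (forall z, 0 <= g z) ->
  (forall z, g z = 0 -> f z = 0) -> meas (fun z => f z / g z).
Proof.
move=> cf cg g0 fg0.
have e0 (n : nat) : 0 < n.+1%:R^-1 :> R by rewrite invr_gt0.
have p0 n z : 0 < g z + n.+1%:R^-1 by rewrite ltr_wpDl.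
apply: (@measurable_fun_cvg _ _ _ setT (fun (n : nat) z => f z / (g z + n.+1%:R^-1))).
  move=> n; apply: meas_cont => z; apply: cvgM; first exact: cf.
  apply: cvgV; first by rewrite gt_eqF.
  by apply: cvgD; [exact: cg|exact: cvg_cst].
move=> z _; have [gz|gz] := eqVneq (g z) 0.
  rewrite (_ : (fun n => _) = fun=> 0); first by rewrite fg0// mul0r; exact: cvg_cst.
  by rewrite funeqE => n; rewrite fg0// mul0r.
apply: cvgM; first exact: cvg_cst.
apply: cvgV => //; rewrite -[X in _ --> X]addr0.
by apply: cvgD; [exact: cvg_cst|exact: cvg_harmonic].
Qed.

Lemma meas_norm_inv : meas (fun z => `|z|^-1).
Proof.
have cn : continuous (fun z : R * R => `|z|) by move=> z; exact: norm_continuous.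
have := @meas_quotient (fun z => `|z|) (fun z => `|z| * `|z|) cn.
rewrite (_ : (fun z => _ / _) = fun z : R * R => `|z|^-1).
  apply; first by move=> z; apply: cvgM; exact: cn.
    by move=> z; exact: mulr_ge0.
  by move=> z /eqP; rewrite mulf_eq0 orbb => /eqP.
rewrite funeqE => z; have [->|z0] := eqVneq `|z| 0; first by rewrite mul0r invr0.
by rewrite invfM mulrA mulfV// mul1r.
Qed.

(** A singularity of order [-1] is integrable in dimension two. *)
Lemma integ_singular r : 0 < r -> integ (fun z => `|z|^-1 * ind r z).
Proof.
move=> r0.
apply: (@integ_dyadic _ (fun n => 2 * r^-1 * 2 ^+ n) (fun n => r * 2^-1 ^+ n) (8 * r)).
- apply: measM; last exact: meas_ind.
  exact: meas_norm_inv.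
- by move=> z; rewrite mulr_ge0 ?invr_ge0// ind_ge0.
- by move=> n; rewrite !mulr_ge0 ?invr_ge0 ?exprn_ge0// ltW.
- by move=> n; rewrite mulr_ge0 ?exprn_ge0 ?invr_ge0// ltW.
- move=> n; rewrite exprMn exprMn -exprM mulnC exprM.
  have -> : 2 * r^-1 * 2 ^+ n * (2 ^+ 2 * (r ^+ 2 * (2^-1 ^+ 2) ^+ n)) =
    8 * (r^-1 * r ^+ 2) * (2 ^+ n * (2^-1 ^+ 2) ^+ n) :> R by ring.
  rewrite -exprMn; congr (_ * _ * _ ^+ n); last by field.
  by rewrite expr2 mulKf// gt_eqF.
move=> z; have [->|z0] := eqVneq z 0.
  by exists 0%N; rewrite normr0 invr0 mul0r !mulr_ge0 ?invr_ge0 ?exprn_ge0 ?ind_ge0// ltW.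
have nz : 0 < `|z| by rewrite normr_gt0.
have [zr|rz] := leP `|z| r; last first.
  exists 0%N; rewrite (indE r) (leNgt _ r) rz mulr0.
  by rewrite !mulr_ge0 ?invr_ge0 ?exprn_ge0 ?ind_ge0// ltW.
have [n zn nzn] := exists_dyadic (r / `|z| / 2).
have P2 : 0 < 2 ^+ n :> R by rewrite exprn_gt0.
exists n; rewrite !indE zr mulr1.
have -> : `|z| <= r * 2^-1 ^+ n.
  rewrite exprVn ler_pdivlMr//; case: nzn => [->|]; first by rewrite expr0 mulr1.
  by rewrite [X in _ < X]mulrC divfK// ltr_pdivlMr// mulrC => /ltW.
rewrite mulr1 -(ler_pM2l nz) mulfV ?gt_eqF//.
move: zn; rewrite !ler_pdivrMr// => zn.
rewrite -(ler_pM2l r0) mulr1; apply: (le_trans zn).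
by rewrite le_eqVlt; apply/orP; left; apply/eqP; field; rewrite gt_eqF.
Qed.

End Dyadic.

(** * The fundamental lemma of the calculus of variations *)

Section FundamentalLemma.
Context {R : realType}.
Notation X := (measurableTypeR R).
Notation P := (measurableTypeR R * measurableTypeR R)%type.
Implicit Types (f g h F : R * R -> R) (x y z : R * R) (r s t L C : R).

Lemma meas_indic_comp d (T : measurableType d) (p : P -> T) (A : set T) :
  measurable_fun setT p -> measurable A -> meas (fun z => \1_A (p z) : R).
Proof.
move=> mp mA.
by apply: (@measurableT_comp _ _ _ _ _ _ (\1_A : T -> R)) => //; exact: measurable_indic.
Qed.

Lemma integ_indicM F d (T : measurableType d) (p : P -> T) (A : set T) :
  integ F -> measurable_fun setT p -> measurable A ->
  integ (fun z => F z * \1_A (p z)).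
Proof.
move=> iF mp mA; apply: (@integ_le _ _ (fun z => `|F z|)).
- apply: measM; first exact: integ_meas.
  exact: meas_indic_comp.
- exact: integ_norm.
- move=> z; rewrite normrM ler_piMr// indicE.
  by case: (_ \in _); rewrite ?normr1 ?normr0.
Qed.

Lemma integral_preimage F d (T : measurableType d) (p : P -> T) (A : set T) :
  (\int[@leb2 R]_(z in p @^-1` A) (F z)%:E = \int[@leb2 R]_z (F z * \1_A (p z))%:E)%E.
Proof.
rewrite integral_mkcond; apply: eq_integral => z _.
rewrite patchE indicE (_ : (z \in p @^-1` A) = (p z \in A)).
  by case: ifP; rewrite ?mulr1 ?mulr0.
by apply/idP/idP; rewrite !inE.
Qed.

(** The sets [A] for which the integral over [p @^-1` A] vanishes form a
    Dynkin system. *)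
Lemma dynkin_integral0 F d (T : measurableType d) (G : set (set T)) (p : P -> T) :
  @measurable _ T = <<s G >> -> setI_closed G ->
  integ F -> measurable_fun setT p ->
  \int[@leb2 R]_z F z = 0 ->
  (forall A, G A -> \int[@leb2 R]_z (F z * \1_A (p z)) = 0) ->
  forall A, measurable A -> \int[@leb2 R]_z (F z * \1_A (p z)) = 0.
Proof.
move=> mG GI iF mp F0 FG.
have Gm A : G A -> measurable A by move=> GA; rewrite mG; exact: sub_sigma_algebra.
suff H A : <<s G >> A -> measurable A /\ \int[@leb2 R]_z (F z * \1_A (p z)) = 0.
  by move=> A; rewrite mG => /H[].
move=> sA; split; first by rewrite mG.
move: A sA; apply: (dynkin_induction mG GI) => //.
- by rewrite -[RHS]F0; apply: Int_eq => z; rewrite indicE in_setT mulr1.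
- move=> S mS S0.
  have E : \int[@leb2 R]_z (F z * \1_(~` S) (p z)) =
           \int[@leb2 R]_z (F z - F z * \1_S (p z)).
    apply: Int_eq => z; rewrite !indicE in_setC.
    by case: (_ \in _); rewrite /= ?mulr1 ?mulr0 ?subrr ?subr0.
  by rewrite E IntB ?F0 ?S0 ?subrr//; exact: integ_indicM.
- move=> S mS tS S0; rewrite /Rintegral -integral_preimage preimage_bigcup.
  rewrite integral_bigcup; last 3 first.
  + move: tS => /trivIsetP tS; apply/trivIsetP => i j _ _ ij.
    by rewrite -preimage_setI tS// preimage_set0.
  + by move=> k; rewrite -[X in measurable X]setTI; exact: mp.
  + apply: (integrableS measurableT _ _ iF) => //.
    by apply: bigcupT_measurable => k; rewrite -[X in measurable X]setTI; exact: mp.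
  rewrite eseries0// => k _ _; rewrite integral_preimage.
  rewrite integ_fineK ?S0//; exact: integ_indicM.
Qed.

(** [min 1 (max 0 s)] for [s = n.+1 * t]. *)
Definition ramp (n : nat) (t : R) : R :=
  (`|n.+1%:R * t| - `|n.+1%:R * t - 1| + 1) / 2.

Lemma ramp_ge0 n t : 0 <= ramp n t.
Proof.
rewrite /ramp; move: (_ * t) => s; case: (ger0P s) => s0; case: (ger0P (s - 1)) => s1; lra.
Qed.

Lemma ramp_le1 n t : ramp n t <= 1.
Proof.
rewrite /ramp; move: (_ * t) => s; case: (ger0P s) => s0; case: (ger0P (s - 1)) => s1; lra.
Qed.

Lemma ramp_eq1 n t : 1 <= n.+1%:R * t -> ramp n t = 1.
Proof.
rewrite /ramp; move: (_ * t) => s s1; rewrite !ger0_norm; lra.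
Qed.

Lemma ramp_eq0 n t : n.+1%:R * t <= 0 -> ramp n t = 0.
Proof.
rewrite /ramp; move: (_ * t) => s s1; rewrite !ler0_norm; lra.
Qed.

Lemma ramp_cvg t : ramp n t @[n --> \oo] --> (if 0 < t then 1 else 0 : R).
Proof.
case: ifPn => [t0|]; last first.
  rewrite -leNgt => t0; apply: cvg_near_cst; apply: nearW => n.
  by rewrite ramp_eq0// mulr_ge0_le0.
apply: cvg_near_cst; near=> n; apply: ramp_eq1.
rewrite -ler_pdivrMr// (@le_trans _ _ n%:R)//; last by rewrite ler_nat.
by near: n; exact: nbhs_infty_ger.
Unshelve. all: by end_near. Qed.

Lemma continuous_ramp n : continuous (ramp n).
Proof.
have cm : continuous (fun t : R => n.+1%:R * t).
  by move=> t; apply: cvgM; [exact: cvg_cst|exact: cvg_id].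
move=> t; apply: cvgMr_tmp; apply: cvgD; last exact: cvg_cst.
apply: cvgB; apply: cvg_norm; first exact: cm.
by apply: cvgB; [exact: cm|exact: cvg_cst].
Qed.

(** Continuous approximation of the indicator of the interval from [a] to [b]. *)
Definition bump1 (a b : R) n (t : R) : R := ramp n (t - a) - ramp n (t - b).

Lemma bump1_cvg (a b t : R) : a <= b ->
  bump1 a b n t @[n --> \oo] --> (\1_(`]a, b]%classic : set R) t : R).
Proof.
move=> ab; rewrite (_ : \1_(_) t = (if 0 < t - a then 1 else 0) - (if 0 < t - b then 1 else 0)).
  by apply: cvgB; exact: ramp_cvg.
rewrite indicE !subr_gt0 (_ : (t \in _) = (a < t <= b)).
  have [bt|tb] := ltP b t; last by rewrite andbT subr0; case: ifP.
  by rewrite (le_lt_trans ab bt) subrr.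
by apply/idP/idP; rewrite inE /= in_itv.
Qed.

Lemma bump1_le1 (a b t : R) n : `|bump1 a b n t| <= 1.
Proof.
rewrite /bump1 ler_norml; have := ramp_ge0 n (t - a); have := ramp_ge0 n (t - b).
by have := ramp_le1 n (t - a); have := ramp_le1 n (t - b); lra.
Qed.

Lemma bump1_out (a b r t : R) n : a <= b -> `|a| <= r -> `|b| <= r -> r + 1 < `|t| ->
  bump1 a b n t = 0.
Proof.
rewrite !ler_norml => ab ar br; rewrite ltr_normr /bump1 => /orP[] rt.
  have E c : c <= r -> 1 <= n.+1%:R * (t - c).
    move=> cr; have : 1 <= t - c by lra.
    move=> H; rewrite -[leLHS]mulr1; apply: ler_pM => //.
    by rewrite ler1n.
  by rewrite !ramp_eq1 ?subrr//; apply: E; lra.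
have E c : - r <= c -> n.+1%:R * (t - c) <= 0.
  by move=> cr; rewrite mulr_ge0_le0//; lra.
by rewrite !ramp_eq0 ?subrr//; apply: E; lra.
Qed.

Lemma continuous_bump1 (a b : R) n : continuous (bump1 a b n).
Proof.
move=> t; apply: cvgB; (apply: (@continuous_comp _ _ _ (fun s => s - _) (ramp n));
  [by apply: cvgB; [exact: cvg_id|exact: cvg_cst]|exact: continuous_ramp]).
Qed.

(** Indicators of rectangles are bounded pointwise limits of continuous
    functions supported in one square. *)
Lemma rect_zero f : locint f ->
  (forall g C r, continuous g -> (forall z, `|g z| <= C) -> supported r g ->
    \int[@leb2 R]_z (f z * g z) = 0) ->
  forall (I J : set X), ocitv I -> ocitv J ->
  \int[@leb2 R]_z (f z * (\1_I z.1 * \1_J z.2)) = 0.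
Proof.
move=> lf fg _ _ [[a b] /= _ <-] [[c d] /= _ <-].
have empty (u v t : R) : v < u -> \1_(`]u, v]%classic : set X) t = 0 :> R.
  move=> vu; rewrite indicE (_ : (t \in _) = false)//; apply/negP.
  by rewrite inE /= in_itv /= => /andP[]; lra.
have [ab|ba] := leP a b; last first.
  by rewrite -[RHS](@Int0 R); apply: Int_eq => z; rewrite (empty _ _ _ ba) mul0r mulr0.
have [cd|dc] := leP c d; last first.
  by rewrite -[RHS](@Int0 R); apply: Int_eq => z; rewrite (empty _ _ _ dc) !mulr0.
pose r := `|a| + `|b| + `|c| + `|d|.
have [ar br cr dr] : [/\ `|a| <= r, `|b| <= r, `|c| <= r & `|d| <= r].
  by rewrite /r; split; have := normr_ge0 a; have := normr_ge0 b;
    have := normr_ge0 c; have := normr_ge0 d; lra.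
pose g n z := bump1 a b n z.1 * bump1 c d n z.2.
have cg n : continuous (g n).
  move=> z; apply: cvgM.
    apply: (@continuous_comp _ _ _ fst (bump1 a b n)); first exact: cvg_fst.
    exact: continuous_bump1.
  apply: (@continuous_comp _ _ _ snd (bump1 c d n)); first exact: cvg_snd.
  exact: continuous_bump1.
have g1 n z : `|g n z| <= 1.
  by rewrite normrM -[leRHS]mulr1 ler_pM// bump1_le1.
have gs n : supported (r + 1) (g n).
  move=> z; rewrite normE lt_max => /orP[] h; rewrite /g.
    by rewrite (bump1_out _ ab ar br h) mul0r.
  by rewrite (bump1_out _ cd cr dr h) mulr0.
have [] := @Int_dominated _ (fun n z => f z * g n z)
  (fun z => f z * (\1_(`]a, b]%classic : set X) z.1 * \1_(`]c, d]%classic : set X) z.2))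
  (fun z => `|f z * ind (r + 1) z|).
- by move=> n; apply: measM; [exact: lf.1|exact: meas_cont].
- apply: measM; first exact: lf.1.
  apply: measM.
    by apply: (@meas_indic_comp _ _ fst); [exact: measurable_fst|exact: measurable_itv].
  by apply: (@meas_indic_comp _ _ snd); [exact: measurable_snd|exact: measurable_itv].
- apply: aeW => z; apply: cvgM; first exact: cvg_cst.
  apply: cvgM.
    exact: bump1_cvg ab.
  exact: bump1_cvg cd.
- by apply: integ_norm; exact: lf.2.
- move=> n z; rewrite -(supported_ind z (gs n)) mulrA mulrAC normrM.
  by rewrite ler_piMr.
move=> _ H.
have : (fun n => \int[@leb2 R]_z (f z * g n z)) = fun=> 0.
  by rewrite funeqE => n; exact: fg (cg n) (g1 n) (gs n).
move=> E; rewrite E in H.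
by apply: (cvg_unique _ H (cvg_cst 0)); exact: norm_hausdorff.
Qed.

(** Restricted to a large square, [f] has zero integral over products of
    intervals. Dynkin's theorem extends this to products of Borel sets, one
    factor at a time, and then to all Borel sets of the plane. *)
Lemma fundamental_lemma f : locint f ->
  (forall g C r, continuous g -> (forall z, `|g z| <= C) -> supported r g ->
    \int[@leb2 R]_z (f z * g z) = 0) ->
  {ae @leb2 R, forall z, f z = 0}.
Proof.
move=> lf fg.
pose I0 (N : nat) : set X := `](- N%:R)%R, N%:R%R]%classic.
pose F N z := f z * (\1_(I0 N) z.1 * \1_(I0 N) z.2).
have oI0 N : ocitv (I0 N) by exists (- N%:R, N%:R).
have mI0 N : measurable (I0 N) by exact: measurable_itv.
have m1 := @measurable_fst _ _ X X.
have m2 := @measurable_snd _ _ X X.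
suff H N : {ae @leb2 R, forall z, F N z = 0}.
  apply: (@filterS _ (almost_everywhere (@leb2 R)) _ _ _ _ (ae_foralln H)) => z Hz.
  have := Hz (Num.truncn `|z|).+1; rewrite /F; set N := _.+1.
  have zN : `|z| < N%:R by exact: truncnS_gt.
  have inI (t : R) : `|t| <= `|z| -> \1_(I0 N) t = 1 :> R.
    move=> tz; rewrite indicE (_ : (t \in _) = true)//; apply/idP.
    by rewrite inE /I0 /= in_itv /=; move: tz; rewrite ler_norml; lra.
  by rewrite !inI ?mulr1//; [exact: (coord_le ord_max)|exact: (coord_le ord0)].
have mrect (A B : set X) : measurable A -> measurable B ->
    meas (fun z => \1_A z.1 * \1_B z.2 : R).
  by move=> mA mB; apply: measM; exact: meas_indic_comp.
have ind01 (A : set X) t : 0 <= (\1_A t : R) <= 1 by rewrite indicE; case: (_ \in _); rewrite ?lexx ?ler01.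
have iF : integ (F N).
  apply: (@integ_le _ _ (fun z => `|f z * ind N%:R z|)).
  - by apply: measM; [exact: lf.1|exact: mrect].
  - by apply: integ_norm; exact: lf.2.
  - move=> z; rewrite /F indE; have [zN|Nz] := leP `|z| N%:R.
      rewrite mulr1 normrM ler_piMr// ger0_norm; last first.
        by rewrite mulr_ge0.
      have /andP[a0 a1] := ind01 (I0 N) z.1; have /andP[b0 b1] := ind01 (I0 N) z.2.
      by rewrite -[leRHS]mulr1 ler_pM.
    rewrite mulr0 normr0; move: Nz; rewrite normE lt_max => /orP[] h.
      have -> : \1_(I0 N) z.1 = 0 :> R; last by rewrite mul0r mulr0 normr0.
      rewrite indicE (_ : (_ \in _) = false)//; apply/negP; rewrite inE /I0 /= in_itv /=.
      by move: h; rewrite ltr_normr => /orP[]; lra.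
    have -> : \1_(I0 N) z.2 = 0 :> R; last by rewrite !mulr0 normr0.
    rewrite indicE (_ : (_ \in _) = false)//; apply/negP; rewrite inE /I0 /= in_itv /=.
    by move: h; rewrite ltr_normr => /orP[]; lra.
have indI (A B : set X) t : \1_A t * \1_B t = \1_(A `&` B) t :> R.
  by rewrite !indicE in_setI; case: (_ \in _); rewrite /= ?mul1r ?mul0r.
have rect0 (A B : set X) : ocitv A -> ocitv B ->
    \int[@leb2 R]_z (F N z * \1_A z.1 * \1_B z.2) = 0.
  move=> oA oB.
  rewrite -[RHS](rect_zero lf fg (ocitvI oA (oI0 N)) (ocitvI oB (oI0 N))).
  by apply: Int_eq => z; rewrite -!indI /F; ring.
have HI (A : set X) t : \1_A t * \1_A t = \1_A t :> R by rewrite indI setIid.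
have I01 z : F N z = F N z * \1_(I0 N) z.1 * \1_(I0 N) z.2.
  by rewrite /F -[in LHS](HI _ z.1) -[in LHS](HI _ z.2); ring.
have s1 (B : set X) : ocitv B -> forall A, measurable A ->
    \int[@leb2 R]_z (F N z * \1_A z.1 * \1_B z.2) = 0.
  move=> oB A mA; have mB : measurable B by exact: sub_sigma_algebra.
  have := @dynkin_integral0 (fun z => F N z * \1_B z.2) _ X (@ocitv R) fst erefl (@ocitvI R).
  move=> /(_ (integ_indicM iF m2 mB) m1) K.
  rewrite -[RHS](K _ _ A mA).
  - by apply: Int_eq => z; ring.
  - rewrite -[RHS](rect0 (I0 N) B (oI0 N) oB); apply: Int_eq => z.
    rewrite {1}I01 /F -[in RHS](HI _ z.2); ring.
  - move=> C oC; rewrite -[RHS](rect0 C B oC oB); apply: Int_eq => z; ring.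
have s2 (A B : set X) : measurable A -> measurable B ->
    \int[@leb2 R]_z (F N z * \1_A z.1 * \1_B z.2) = 0.
  move=> mA mB.
  have := @dynkin_integral0 (fun z => F N z * \1_A z.1) _ X (@ocitv R) snd erefl (@ocitvI R).
  move=> /(_ (integ_indicM iF m1 mA) m2) K.
  apply: (K _ _ B mB).
  - rewrite -[RHS](s1 (I0 N) (oI0 N) A mA); apply: Int_eq => z.
    rewrite {1}I01 /F -[in RHS](HI _ z.1); ring.
  - by move=> C oC; exact: s1.
pose G : set (set P) := [set A `*` B | A in measurable & B in measurable].
have GI : setI_closed G.
  move=> _ _ [A1 mA1 [B1 mB1 <-]] [A2 mA2 [B2 mB2 <-]].
  rewrite -setXI; exists (A1 `&` A2); first exact: measurableI.
  by exists (B1 `&` B2) => //; exact: measurableI.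
have F0 : \int[@leb2 R]_z F N z = 0.
  by rewrite -[RHS](s2 setT setT) //; apply: Int_eq => z; rewrite !indicE !in_setT !mulr1.
have s3 (A : set P) : measurable A -> \int[@leb2 R]_z (F N z * \1_A z) = 0.
  apply: (@dynkin_integral0 (F N) _ P G id) => //.
    by rewrite measurable_prod_measurableType.
  move=> _ [B mB [C mC <-]]; rewrite -[RHS](s2 B C mB mC); apply: Int_eq => z.
  by rewrite !indicE -mulrA -natrM mulnb -in_setX; case: (z).
have := @integral_ae_eq _ _ _ (@leb2 R) setT measurableT (cst 0%E) (EFin \o F N) iF.
move=> /(_ (measurable_cst _)) K.
have : ae_eq (@leb2 R) setT (EFin \o F N) (cst 0%E).
  apply: K => E _ mE; rewrite integral0.
  have := integral_preimage (F N) id E; rewrite preimage_id => ->.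
  by rewrite integ_fineK ?s3//; exact: (integ_indicM (p := id)).
apply: (@filterS _ (almost_everywhere (@leb2 R))) => z /(_ I) /=.
by move=> [].
Qed.

End FundamentalLemma.

(** * Kernels that are homogeneous at infinity *)

Section Homogeneous.
Context {R : realType}.
Implicit Types (f g h S : R * R -> R) (x y z a b : R * R) (r s t L C : R) (k l : 'I_2).

(** Scaling [a] and [b] back to a fixed annulus reduces the estimate far away
    to the local Lipschitz bound, with a factor [t ^- 3] for the scale [t]. *)
Lemma homogeneous_lip S r L : 0 < r -> 0 <= L -> smooth S ->
  (forall t z, 1 <= t -> r < `|z| -> S (affine t 0 z) = (t ^+ 2)^-1 * S z) ->
  exists2 C, 0 <= C & forall a b, `|a - b| <= L ->
    `|S a - S b| <= C * `|a - b| * decay b.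
Proof.
move=> r0 L0 sS hS; pose m := r + 1; have m0 : 0 < m by rewrite addr_gt0.
pose rho := 2 * m + 2 * L.
have [C1 C1_ge0 H1] := smooth_lip_box (3 * m) sS.
have [C2 C2_ge0 H2] := smooth_lip_box (rho + L) sS.
have rho0 : 0 < rho by rewrite /rho; lra.
pose A1 := C1 * (2 * m) ^+ 3 * 8; pose A2 := C2 * (1 + rho) ^+ 3.
have A1_ge0 : 0 <= A1 by do ?[apply: mulr_ge0|apply: exprn_ge0|exact: ltW]; lra.
have A2_ge0 : 0 <= A2 by apply: mulr_ge0 => //; apply: exprn_ge0; lra.
exists (A1 + A2) => [|a b abL]; first exact: addr_ge0.
have dge := decay_ge0 b; have pb := decay_pos b.
have nab : 0 <= `|a - b| by [].
have aub : `|a| <= `|b| + `|a - b| by rewrite -{1}(subrK b a) addrC ler_normD.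
have bua : `|b| <= `|a| + `|a - b| by rewrite distrC -{1}(subrK a b) addrC ler_normD.
have [bs|bl] := leP `|b| rho.
  apply: (le_trans (H2 a b _ _)); [lra|lra|].
  rewrite mulrAC ler_wpM2r//.
  apply: (@le_trans _ _ (A2 * decay b)); last by rewrite ler_wpM2r// lerDr.
  rewrite /A2 /decay -mulrA -[leLHS]mulr1 ler_wpM2l// ler_pdivlMr ?exprn_gt0// mul1r.
  by apply: lerXn2r; rewrite ?nnegrE; lra.
pose t := `|b| / (2 * m); have t1 : 1 <= t.
  by rewrite ler_pdivlMr ?mulr_gt0// mul1r; rewrite /rho in bl; lra.
have t0 : 0 < t by lra.
have tn0 : t != 0 by rewrite gt_eqF.
have E c : c = affine t 0 (t^-1 *: c) by rewrite affine0E scalerA mulfV// scale1r.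
have tb : `|b| = t * (2 * m) by rewrite /t divfK// gt_eqF// mulr_gt0.
have nsc c : `|t^-1 *: c| = t^-1 * `|c| by rewrite normrZ gtr0_norm// invr_gt0.
have nb' : `|t^-1 *: b| = 2 * m by rewrite nsc tb mulKf.
have na' : m <= `|t^-1 *: a| <= 3 * m.
  rewrite nsc ler_pdivlMl// ler_pdivrMl//; rewrite /rho in bl.
  by apply/andP; split; have := tb; nra.
have /andP[a1 a2] := na'.
rewrite (E a) (E b) !hS//; [|by rewrite nb' /m; lra|by rewrite (lt_le_trans _ a1)// ltrDl].
rewrite -!E -mulrBr normrM gtr0_norm ?invr_gt0 ?exprn_gt0//.
have := H1 (t^-1 *: a) (t^-1 *: b) a2; rewrite nb' => /(_ _).
rewrite -scalerBr nsc => H.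
apply: (@le_trans _ _ ((t ^+ 2)^-1 * (C1 * (t^-1 * `|a - b|)))).
  by rewrite ler_wpM2l ?invr_ge0 ?exprn_ge0 ?(ltW t0)//; apply: H; lra.
have -> : (t ^+ 2)^-1 * (C1 * (t^-1 * `|a - b|)) = C1 * (t ^+ 3)^-1 * `|a - b|.
  by field.
rewrite [leRHS]mulrAC ler_wpM2r//.
apply: (@le_trans _ _ (A1 * decay b)); last by rewrite ler_wpM2r// lerDl.
have key : (t ^+ 3)^-1 <= (2 * m) ^+ 3 * 8 * ((1 + `|b|) ^+ 3)^-1.
  rewrite -[leLHS]div1r ler_pdivrMr ?exprn_gt0//.
  set e := ((1 + `|b|) ^+ 3)^-1.
  have -> : (2 * m) ^+ 3 * 8 * e * t ^+ 3 = (2 * (t * (2 * m))) ^+ 3 * e by ring.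
  rewrite /e ler_pdivlMr ?exprn_gt0// mul1r -tb.
  by apply: lerXn2r; rewrite ?nnegrE; rewrite /rho /m in bl; lra.
by apply: (le_trans (ler_wpM2l C1_ge0 key)); rewrite /A1 /decay !mulrA.
Qed.

Lemma K_homogeneous k l t z : t != 0 ->
  K_kernel k l (affine t 0 z) = (t ^+ 2)^-1 * K_kernel k l z.
Proof.
move=> t0; have [->|z0] := eqVneq z 0.
  rewrite /K_kernel affine0E scaler0.
  have -> : sqnorm (0 : R * R) = 0 by rewrite sqnormE /= mulr0 addr0.
  by rewrite expr0n /= invr0 !mulr0.
have n0 : sqnorm z != 0 by rewrite gt_eqF ?sqnorm_gt0.
by rewrite /K_kernel !coord_affine0 sqnorm_affine0; field; rewrite n0.
Qed.

(** Since [rescale s] preserves integrals, this is a bound of order [s^-1] in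
    [L ^ 1]. *)
Lemma rescale_translate S C L s x x0 : 0 < s ->
  (forall a b, `|a - b| <= L -> `|S a - S b| <= C * `|a - b| * decay b) ->
  `|x - x0| <= s * L ->
  forall y, `|rescale s S (x - y) - rescale s S (x0 - y)| <=
    C * (s^-1 * `|x - x0|) * rescale s decay (x0 - y).
Proof.
move=> s0 HS xL y; rewrite /rescale -mulrBr normrM gtr0_norm ?invr_gt0 ?exprn_gt0//.
rewrite [leRHS]mulrCA ler_wpM2l ?invr_ge0 ?exprn_ge0 ?(ltW s0)//.
have E : affine s^-1 0 (x - y) - affine s^-1 0 (x0 - y) = s^-1 *: (x - x0).
  by rewrite !affine0E -scalerBr opprB addrA subrK.
have N : `|affine s^-1 0 (x - y) - affine s^-1 0 (x0 - y)| = s^-1 * `|x - x0|.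
  by rewrite E normrZ gtr0_norm ?invr_gt0.
by rewrite -N; apply: HS; rewrite N ler_pdivrMl.
Qed.

Lemma integ_refl f x : integ f -> integ (fun y => f (x - y)).
Proof. by move=> hf; rewrite reflE; apply: integ_affine => //; rewrite oppr_eq0 oner_eq0. Qed.

Lemma integ_rescale f s : 0 < s -> integ f -> integ (rescale s f).
Proof.
by move=> s0 hf; apply: integZ; apply: integ_affine => //; rewrite invr_eq0 gt_eqF.
Qed.

Lemma Int_rescale f s : 0 < s -> integ f ->
  \int[@leb2 R]_z rescale s f z = \int[@leb2 R]_z f z.
Proof.
move=> s0 hf; have sn0 : s^-1 != 0 by rewrite invr_eq0 gt_eqF.
rewrite IntZ; last exact: integ_affine.
rewrite Rintegral_affine// gtr0_norm ?invr_gt0//.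
have s2 : s ^+ 2 != 0 by rewrite expf_neq0// gt_eqF.
by rewrite exprVn invrK mulKf.
Qed.

Lemma Int_rescale_refl f s x : 0 < s -> integ f ->
  \int[@leb2 R]_y rescale s f (x - y) = \int[@leb2 R]_z f z.
Proof. by move=> s0 hf; rewrite Int_refl ?Int_rescale//; exact: integ_rescale. Qed.

Lemma integ_bounded_conv f C (k : R * R -> R) x : meas f -> (forall z, `|f z| <= C) ->
  integ k -> integ (fun y => f y * k (x - y)).
Proof.
move=> mf fC ik; have ik' := integ_refl x ik.
apply: (@integ_le _ _ (fun y => C * `|k (x - y)|)).
- by apply: measM => //; exact: integ_meas ik'.
- by apply: integZ; exact: integ_norm ik'.
- by move=> y; rewrite normrM ler_wpM2r.
Qed.

Lemma conv_bounded f C (k : R * R -> R) x : meas f -> (forall z, `|f z| <= C) ->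
  integ k -> `|conv f k x| <= C * \int[@leb2 R]_z `|k z|.
Proof.
move=> mf fC ik; have ik' := integ_refl x ik.
have ink := integ_norm ik.
rewrite -(Int_refl x ink) -IntZ; last exact: (integ_refl x ink).
apply: Int_norm_le.
- exact: integ_bounded_conv ik.
- by apply: integZ; exact: (integ_refl x ink).
- by move=> y; rewrite normrM ler_wpM2r.
Qed.

Lemma meas_pker k : meas (@pker R k).
Proof.
apply: meas_quotient.
- exact: Cn_continuous (Cn_coord 0 k).
- have H : Cn 0 (fun z : R * R => coord ord0 z * coord ord0 z + coord ord_max z * coord ord_max z).
    by apply: Cn_add; apply: Cn_mul; exact: Cn_coord.
  exact: Cn_continuous H.
- exact: sqnorm_ge0.
move=> z; have [->|z0] := eqVneq z 0; first by move: k; apply: ord2P.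
by move=> E; have := sqnorm_gt0 z0; rewrite E ltxx.
Qed.

Lemma pker_le k z : `|pker k z| <= `|z|^-1.
Proof.
have [->|z0] := eqVneq z 0.
  by rewrite normr0 invr0 /pker (_ : sqnorm 0 = 0) ?invr0 ?mulr0 ?normr0// sqnormE /= mulr0 addr0.
have nz : 0 < `|z| by rewrite normr_gt0.
rewrite /pker normrM normfV (ger0_norm (sqnorm_ge0 z)) ler_pdivrMr ?sqnorm_gt0//.
rewrite ler_pdivlMl//; apply: (le_trans _ (sqnorm_ge z)).
by rewrite expr2 ler_wpM2l// coord_le.
Qed.

Lemma pker_affine0 k t z : t != 0 -> pker k (affine t 0 z) = t^-1 * pker k z.
Proof.
move=> t0; rewrite /pker coord_affine0 sqnorm_affine0 invfM expr2 invfM.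
transitivity ((t * t^-1) * t^-1 * (coord k z / sqnorm z)); first by ring.
by rewrite mulfV// mul1r.
Qed.

Lemma integ_pkerM k (f : R * R -> R) C r : 0 < r -> meas f -> (forall z, `|f z| <= C) ->
  supported r f -> integ (fun z => f z * pker k z).
Proof.
move=> r0 mf fC fr; apply: (@integ_le _ _ (fun z => C * (`|z|^-1 * ind r z))).
- by apply: measM => //; exact: meas_pker.
- by apply: integZ; exact: integ_singular.
move=> z; rewrite normrM [`|z|^-1 * _]mulrC mulrA.
by apply: ler_pM => //; [exact: supported_norm_le|exact: pker_le].
Qed.

End Homogeneous.

(** * The pressure from the regularized potentials *)

Section Pressure.
Context {R : realType}.
Implicit Types (f g h : R * R -> R) (x y z a b : R * R) (s t L : R) (k l j : 'I_2).

Lemma conv_lin f C (c : R) (k h : R * R -> R) x : meas f -> (forall z, `|f z| <= C) ->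
  integ k -> integ h ->
  conv f (fun z => c * k z - h z) x = c * conv f k x - conv f h x.
Proof.
move=> mf fC ik ih.
have i1 := integ_bounded_conv x mf fC ik; have i2 := integ_bounded_conv x mf fC ih.
rewrite /conv -IntZ// -IntB//; last exact: integZ.
by apply: Int_eq => y; ring.
Qed.

Variables (Et : R * R -> R) (d : R).
Hypothesis d_gt0 : 0 < d.
Hypotheses (Et_smooth : smooth Et) (Et_far : forall z, d < `|z| -> Et z = 2^-1 * ln (sqnorm z)).

Let Dk := Lap Et.
(** The part of the singular kernel that the regularization removes. *)
Let m k z := partial k Et z - pker k z.

Let Et_pd : pderivable Et. Proof. exact: smooth_pderivable. Qed.

Let dEt_pd k : pderivable (partial k Et).
Proof. by apply: smooth_pderivable; exact: smooth_partial. Qed.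

Let test_Dk : test_function Dk.
Proof. exact: (test_LapEt d_gt0 Et_smooth Et_far). Qed.

Lemma Et_affine s z : 0 < s -> d < `|z| -> d < s^-1 * `|z| ->
  Et (affine s^-1 0 z) = Et z - ln s.
Proof.
move=> s0 dz dsz; have si0 : 0 < s^-1 by rewrite invr_gt0.
rewrite (Et_far dz) Et_far; last by rewrite norm_affine0.
have N0 : 0 < sqnorm z by apply: sqnorm_gt0; exact: (far_neq0 d_gt0 dz).
rewrite sqnorm_affine0 lnM ?posrE ?exprn_gt0// lnXn// lnV ?posrE//.
by rewrite -mulr_natr; field.
Qed.

Lemma supported_m k : supported d (m k).
Proof. by move=> z dz; rewrite /m (partial_Et_far d_gt0 Et_far k dz) subrr. Qed.

Lemma integ_m k : integ (m k).
Proof.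
have cE : continuous (partial k Et) by apply: smooth_continuous; exact: smooth_partial.
have [C C0 HC] := continuous_bounded_box d cE.
apply: (@integ_le _ _ (fun z => C * ind d z + `|z|^-1 * ind d z)).
- by apply: measB; [exact: meas_cont|exact: meas_pker].
- apply: integD; first by apply: integZ; exact: integ_ind.
  exact: integ_singular.
move=> z; have [zd|dz] := leP `|z| d; last first.
  by rewrite (supported_m k dz) normr0 indE (leNgt _ d) dz !mulr0 addr0.
rewrite indE zd !mulr1 (le_trans (ler_normB _ _))// lerD//; first exact: HC.
exact: pker_le.
Qed.

(** The difference of the regularizations of the logarithm at the scales [s]
    and [1]; these agree outside a square, up to the constant [ln s]. *)
Let theta s z := Et (affine s^-1 0 z) + ln s - Et z.

Lemma smooth_theta s : smooth (theta s).
Proof.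
apply: smoothB Et_smooth; apply: smoothD; last exact: smooth_cst.
exact: (smooth_affine s^-1 0 Et_smooth).
Qed.

Lemma test_theta s : 0 < s -> s <= 1 -> test_function (theta s).
Proof.
move=> s0 s1; apply/test_functionP; split; first exact: smooth_theta.
exists d => // z dz; rewrite /theta Et_affine//.
  by rewrite subrK subrr.
by rewrite (lt_le_trans dz)// ler_peMl// invf_ge1.
Qed.

Lemma partial_theta s k z : 0 < s -> partial k (theta s) z = s * rescale s (m k) z - m k z.
Proof.
move=> s0; have sn0 : s != 0 by rewrite gt_eqF.
have H1 := partialP k _ (pderivable_affine (a := s^-1) (c := 0) Et_pd).
have [_ E] : is_derive z (basis k) (theta s) (partial k (Et \o affine s^-1 0) z + 0 - partial k Et z).
  exact: is_deriveB (is_deriveD (H1 z) (is_derive_cst _ _ _)) (partialP k z Et_pd).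
rewrite [LHS]E partial_affine// /rescale /m pker_affine0 ?invr_eq0// invrK.
by field.
Qed.

Lemma Lap_theta s z : 0 < s -> Lap (theta s) z = 1 * rescale s Dk z - Dk z.
Proof.
move=> s0.
have H k : partial k (theta s) = fun z => s^-1 * partial k Et (affine s^-1 0 z) - partial k Et z.
  rewrite funeqE => w; rewrite partial_theta// /rescale /m pker_affine0 ?invr_eq0 ?gt_eqF// invrK.
  by field; rewrite gt_eqF.
have H2 k w : partial k (partial k (theta s)) w =
    (s ^+ 2)^-1 * partial k (partial k Et) (affine s^-1 0 w) - partial k (partial k Et) w.
  rewrite H.
  have Hk := is_derive_affine (partialP k (affine s^-1 0 w) (@dEt_pd k)).
  have [_ E] : is_derive w (basis k)
      (fun z => s^-1 * partial k Et (affine s^-1 0 z) - partial k Et z)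
      (s^-1 * (s^-1 * partial k (partial k Et) (affine s^-1 0 w)) - partial k (partial k Et) w).
    exact: is_deriveB (is_deriveZ s^-1 Hk) (partialP k w (@dEt_pd k)).
  by rewrite [LHS]E mulrA -invfM.
by rewrite {1}/Lap !H2 mul1r addrACA -opprD -mulrDr.
Qed.

Variables (a0 a1 q : R * R -> R) (C : R).
Hypotheses (ma0 : meas a0) (ma1 : meas a1).
Hypotheses (a0C : forall z, `|a0 z| <= C) (a1C : forall z, `|a1 z| <= C).
Hypothesis lq : locint q.
Hypothesis hq : forall h, test_function h -> forall x,
  conv q (Lap h) x = - (conv a0 (partial ord0 h) x + conv a1 (partial ord_max h) x).

(** [2 * pi] times the value that the equation dictates for [q] once the singular
    kernel is split into its regularization and an integrable remainder; the
    regularized part is transferred to [q], where it becomes a Laplacian. *)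
Definition pressure x : R := conv q Dk x + (conv a0 (m ord0) x + conv a1 (m ord_max) x).

(** The equation tested against [theta s]. *)
Lemma conv_rescale_pressure s x : 0 < s -> s <= 1 ->
  conv q (rescale s Dk) x =
  pressure x - s * (conv a0 (rescale s (m ord0)) x + conv a1 (rescale s (m ord_max)) x).
Proof.
move=> s0 s1; have := hq (test_theta s0 s1) x.
rewrite (_ : Lap (theta s) = fun z => rescale s Dk z - Dk z); last first.
  by rewrite funeqE => z; rewrite Lap_theta// mul1r.
rewrite (convB lq (test_rescale s0 test_Dk) test_Dk).
have P k : partial k (theta s) = fun z => s * rescale s (m k) z - m k z.
  by rewrite funeqE => z; exact: partial_theta.
rewrite (P ord0) (P ord_max).
have ir k : integ (rescale s (m k)) by apply: integ_rescale => //; exact: integ_m.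
rewrite (conv_lin s x ma0 a0C (ir ord0) (integ_m ord0)) (conv_lin s x ma1 a1C (ir ord_max) (integ_m ord_max)).
rewrite /pressure.
do 6!move: (conv _ _ x) => ?.
lra.
Qed.

Let K := C * \int[@leb2 R]_z `|m ord0 z| + C * \int[@leb2 R]_z `|m ord_max z|.

Let C0 : 0 <= C. Proof. exact: le_trans (a0C 0). Qed.

Let K0 : 0 <= K.
Proof. by rewrite addr_ge0// mulr_ge0//; apply: Rintegral_ge0. Qed.

Lemma pressure_dist s x : 0 < s -> s <= 1 ->
  `|conv q (rescale s Dk) x - pressure x| <= s * K.
Proof.
move=> s0 s1; rewrite conv_rescale_pressure// addrC addKr normrN normrM gtr0_norm//.
rewrite ler_wpM2l ?(ltW s0)// (le_trans (ler_normD _ _))//.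
have b (a : R * R -> R) k : meas a -> (forall z, `|a z| <= C) ->
    `|conv a (rescale s (m k)) x| <= C * \int[@leb2 R]_z `|m k z|.
  move=> ma aC; have im := integ_m k.
  have := conv_bounded x ma aC (integ_rescale s0 im).
  have -> : \int[@leb2 R]_z `|rescale s (m k) z| = \int[@leb2 R]_z rescale s (fun z => `|m k z|) z.
    apply: Int_eq => z; rewrite /rescale normrM gtr0_norm// invr_gt0 exprn_gt0//.
  by rewrite Int_rescale//; exact: integ_norm.
by apply: lerD; exact: b.
Qed.

Let sn (n : nat) : R := n.+1%:R^-1.
Let sn0 n : 0 < sn n. Proof. by rewrite invr_gt0. Qed.
Let sn1 n : sn n <= 1. Proof. by rewrite invf_le1// ler1n. Qed.

Let meas_cv n : meas (conv q (rescale (sn n) Dk)).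
Proof. exact: meas_cont (conv_continuous lq (test_rescale (sn0 n) test_Dk)). Qed.

Lemma pressure_cvg x : conv q (rescale (sn n) Dk) x @[n --> \oo] --> pressure x.
Proof.
apply/cvgrPdist_le => e e0.
have : sn n * K @[n --> \oo] --> 0 * K.
  by apply: cvgM; [exact: cvg_harmonic|exact: cvg_cst].
rewrite mul0r => /cvgr0Pnorm_le/(_ e e0); apply: filterS => n Hn.
rewrite distrC (le_trans (pressure_dist x (sn0 n) (sn1 n)))//.
by rewrite (le_trans (ler_norm _)).
Qed.

Lemma meas_pressure : meas pressure.
Proof.
apply: (@measurable_fun_cvg _ _ _ setT (fun n x => conv q (rescale (sn n) Dk) x)).
  exact: meas_cv.
by move=> x _; exact: pressure_cvg.
Qed.

Lemma locint_pressure : locint pressure.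
Proof.
have lD : locint (conv q Dk) := locint_cont (conv_continuous lq test_Dk).
have E : pressure = fun x => conv q Dk x + (pressure x - conv q Dk x).
  by rewrite funeqE => x; rewrite addrC subrK.
rewrite E; apply: locintD => //; apply: (@locint_bounded _ K).
  by apply: measB; [exact: meas_pressure|exact: lD.1].
move=> x; rewrite /pressure addrC addKr (le_trans (ler_normD _ _))//.
by apply: lerD; apply: conv_bounded => //; exact: integ_m.
Qed.

(** The regularized Laplacians are an approximate identity of mass [2 * pi]:
    their convolutions with [q] tend weakly to [2 * pi * q], and uniformly to
    [pressure]. *)
Lemma pressure_ae : {ae @leb2 R, forall x, 2 * pi * q x = pressure x}.
Proof.
suff : {ae @leb2 R, forall x, 2 * pi * q x - pressure x = 0}.
  apply: (@filterS _ (almost_everywhere (@leb2 R))) => x /eqP.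
  by rewrite subr_eq0 => /eqP.
have lf : locint (fun x => 2 * pi * q x - pressure x).
  have l1 := locintZ (2 * pi) lq; have l2 := locintZ (-1) locint_pressure.
  have := locintD l1 l2; rewrite (_ : (fun z => _ + _) = fun x => 2 * pi * q x - pressure x)//.
  by rewrite funeqE => z; rewrite mulN1r.
apply: fundamental_lemma lf _ => g B rg cg gB gr.
have mg := meas_cont cg.
have B0 : 0 <= B by rewrite (le_trans _ (gB 0)).
have gr' : supported `|rg| g by move=> z rz; apply: gr; rewrite (le_lt_trans (ler_norm _)).
have rg0 : 0 <= `|rg| by [].
have tr := test_reflect test_Dk.
have [_ [rr rr0 Dr]] := (test_functionP _).1 tr.
pose Bd := B * \int[@leb2 R]_z `|reflect Dk z|.
have iqg : integ (fun z => q z * g z) := locint_mul lq mg gB gr'.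
have ivg : integ (fun z => pressure z * g z) := locint_mul locint_pressure mg gB gr'.
have [_ L1] : integ (fun z => q z * (g z * (2 * pi))) /\
    \int[@leb2 R]_z (q z * conv g (rescale (sn n) (reflect Dk)) z) @[n --> \oo] -->
    \int[@leb2 R]_z (q z * (g z * (2 * pi))).
  have lg := locint_bounded mg gB.
  apply: (@Int_dominated _ (fun n z => q z * conv g (rescale (sn n) (reflect Dk)) z) _
    (fun z => Bd * `|q z * ind (`|rg| + rr) z|)).
  - move=> n; apply: measM; first exact: lq.1.
    exact: meas_cont (conv_continuous lg (test_rescale (sn0 n) tr)).
  - apply: measM; first exact: lq.1.
    by apply: measM => //; exact: measurable_cst.
  - apply: aeW => z; apply: cvgM; first exact: cvg_cst.
    rewrite -(Int_LapEt d_gt0 Et_smooth Et_far) -/Dk -Int_reflect; last exact: integ_test.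
    by apply: (conv_rescale_cvg (C := B)) => //; exact: cg.
  - by apply: integZ; apply: integ_norm; exact: lq.2.
  - move=> n z; rewrite !normrM mulrCA ler_wpM2l// (ger0_norm (ind_ge0 _ _)).
    apply: supported_norm_le; last exact: conv_rescale_supported.
    by move=> x; exact: conv_rescale_bound.
have [_ L2] : integ (fun z => pressure z * g z) /\
    \int[@leb2 R]_z (conv q (rescale (sn n) Dk) z * g z) @[n --> \oo] -->
    \int[@leb2 R]_z (pressure z * g z).
  apply: (@Int_dominated _ (fun n z => conv q (rescale (sn n) Dk) z * g z) _
    (fun z => `|pressure z * g z| + K * `|g z|)).
  - by move=> n; exact: measM (meas_cv n) mg.
  - by apply: measM => //; exact: meas_pressure.
  - by apply: aeW => z; apply: cvgM; [exact: pressure_cvg|exact: cvg_cst].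
  - apply: integD; first exact: integ_norm.
    by apply: integZ; apply: integ_norm; exact: (integ_bounded mg gB gr').
  - move=> n z; rewrite -(subrK (pressure z) (conv q (rescale (sn n) Dk) z)) mulrDl addrC.
    rewrite (le_trans (ler_normD _ _))// lerD2l normrM ler_wpM2r//.
    rewrite (le_trans (pressure_dist z (sn0 n) (sn1 n)))//.
    by rewrite ler_piMl.
have pair n : \int[@leb2 R]_z (conv q (rescale (sn n) Dk) z * g z) =
    \int[@leb2 R]_z (q z * conv g (rescale (sn n) (reflect Dk)) z).
  transitivity (\int[@leb2 R]_x (g x * conv q (rescale (sn n) Dk) x)).
    by apply: Int_eq => x; rewrite mulrC.
  refine (etrans (conv_pairing lq (test_rescale (sn0 n) test_Dk) mg gB rg0 gr') _).
  apply: Int_eq => y.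
  apply: (f_equal ( *%R (q y))).
  exact: (conv_rescale_reflect g Dk (sn n) y).
move: L2; rewrite (funext pair) => L2.
have E := cvg_unique (@norm_hausdorff _ _) L1 L2.
transitivity (\int[@leb2 R]_z (q z * (g z * (2 * pi)) - pressure z * g z)).
  by apply: Int_eq => z; ring.
rewrite IntB//; first by rewrite E subrr.
by apply: (integ_eq _ (integZ (2 * pi) iqg)) => z; ring.
Qed.

End Pressure.

(** * Splitting off the far field *)

Section Splitting.
Context {R : realType}.
Implicit Types (f g h : R * R -> R) (x y z a b : R * R) (s t L : R) (k l j : 'I_2).

Lemma partial_flat f d (c : R) k z : (forall w, `|w| < d -> f w = c) ->
  `|z| < d -> partial k f z = 0.
Proof.
move=> fc zd; suff [_ E] : is_derive z (basis k) f 0 by exact: E.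
apply: near_eq_is_derive (is_derive_cst c z (basis k)).
have oB : open ((@Num.norm R (R * R)%type) @^-1` [set t : R | t < d]).
  by apply: open_comp => [w _|]; [exact: norm_continuous|exact: open_lt].
have : nbhs z ((@Num.norm R (R * R)%type) @^-1` [set t : R | t < d]).
  exact: open_nbhs_nbhs.
by apply: filterS => w /= dw; rewrite fc.
Qed.

Variables (chi Et : R * R -> R) (d r : R).
Hypotheses (d_gt0 : 0 < d) (dr : d < r).
Hypotheses (chi_test : test_function chi) (chi_near : forall z, `|z| <= 2 * d -> chi z = 1).
Hypothesis chi_supp : supported r chi.
Hypotheses (Et_smooth : smooth Et) (Et_far : forall z, d < `|z| -> Et z = 2^-1 * ln (sqnorm z)).

Definition cut_pot z : R := (1 - chi z) * Et z.
Definition cut_grad k z : R := (1 - chi z) * partial k Et z.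

(** The constant [ln s] is the change of the logarithm under dilation by [s], so
    that [trunc_pot s] vanishes far away. *)
Definition trunc_pot s z : R := Et z - ln s - cut_pot (affine s^-1 0 z).
Definition trunc_grad s k z : R :=
  cut_grad k z - s^-1 * partial k cut_pot (affine s^-1 0 z).

Let r_gt0 : 0 < r. Proof. exact: lt_trans dr. Qed.

Let chi_smooth : smooth chi. Proof. exact: test_smooth. Qed.

Let Et_pd : pderivable Et. Proof. exact: smooth_pderivable. Qed.

Let dEt_smooth k : smooth (partial k Et). Proof. exact: smooth_partial. Qed.

Let chic_smooth : smooth (fun z => 1 - chi z).
Proof. exact: smoothB (smooth_cst 1) chi_smooth. Qed.

Lemma smooth_cut_pot : smooth cut_pot.
Proof. exact: smoothM chic_smooth Et_smooth. Qed.

Lemma smooth_cut_grad k : smooth (cut_grad k).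
Proof. exact: smoothM chic_smooth (dEt_smooth k). Qed.

Lemma cut_pot_far z : r < `|z| -> cut_pot z = 2^-1 * ln (sqnorm z).
Proof.
by move=> rz; rewrite /cut_pot (chi_supp rz) subr0 mul1r (Et_far (lt_trans dr rz)).
Qed.

Let dY_smooth k : smooth (partial k cut_pot).
Proof. by apply: smooth_partial; exact: smooth_cut_pot. Qed.

Let Y_pd : pderivable cut_pot. Proof. exact: smooth_pderivable smooth_cut_pot. Qed.

Lemma test_Lap_cut_pot : test_function (Lap cut_pot).
Proof. exact: test_LapEt r_gt0 smooth_cut_pot cut_pot_far. Qed.

Lemma smooth_trunc_pot s : smooth (trunc_pot s).
Proof.
apply: smoothB (smooth_affine s^-1 0 smooth_cut_pot).
exact: smoothB Et_smooth (smooth_cst (ln s)).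
Qed.

Lemma test_trunc_pot s : 1 <= s -> test_function (trunc_pot s).
Proof.
move=> s1; have s0 : 0 < s := lt_le_trans ltr01 s1.
apply/test_functionP; split; first exact: smooth_trunc_pot.
exists (s * r); first exact: mulr_gt0.
move=> z srz; have rz : r < `|z| by rewrite (le_lt_trans _ srz)// ler_peMl// ltW.
have rsz : r < s^-1 * `|z| by rewrite mulrC ltr_pdivlMr// mulrC.
rewrite /trunc_pot (Et_affine r_gt0 cut_pot_far s0 rz rsz) (cut_pot_far rz).
by rewrite (Et_far (lt_trans dr rz)) subrr.
Qed.

Lemma partial_trunc_pot s k : partial k (trunc_pot s) =
  fun z => partial k Et z - s^-1 * partial k cut_pot (affine s^-1 0 z).
Proof.
rewrite funeqE => z.
have [_ E] : is_derive z (basis k) (trunc_pot s)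
    (partial k Et z - 0 - partial k (cut_pot \o affine s^-1 0) z).
  apply: is_deriveB (is_deriveB (partialP k z Et_pd) (is_derive_cst _ _ _)) _.
  exact: partialP k z (pderivable_affine (a := s^-1) (c := 0) Y_pd).
by rewrite [LHS]E subr0 (partial_affine s^-1 0 k Y_pd).
Qed.

Lemma partial2_affineZ s k l w h : smooth h ->
  is_derive w (basis l) (fun z => s^-1 * partial k h (affine s^-1 0 z))
    (rescale s (partial l (partial k h)) w).
Proof.
move=> sh; have H := partialP l (affine s^-1 0 w) (smooth_pderivable (smooth_partial k sh)).
by apply: is_derive_val (is_deriveZ s^-1 (is_derive_affine H)) _; rewrite /rescale expr2 invfM -mulrA.
Qed.

Lemma Lap_trunc_pot s : Lap (trunc_pot s) =
  fun z => Lap Et z - rescale s (Lap cut_pot) z.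
Proof.
rewrite funeqE => z.
have H k : partial k (partial k (trunc_pot s)) z =
    partial k (partial k Et) z - rescale s (partial k (partial k cut_pot)) z.
  rewrite partial_trunc_pot.
  have [_ E] := is_deriveB (partialP k z (smooth_pderivable (dEt_smooth k)))
    (partial2_affineZ s k k z smooth_cut_pot).
  exact: E.
refine (etrans (f_equal2 +%R (H ord0) (H ord_max)) _).
rewrite /rescale /Lap.
by do 4!move: (partial _ _ _) => ?; move: (_^-1) => ?; ring.
Qed.

Lemma trunc_gradE s k z :
  trunc_grad s k z = partial k (trunc_pot s) z - chi z * partial k Et z.
Proof.
rewrite partial_trunc_pot /trunc_grad /cut_grad.
by move: (partial _ _ _) (partial _ _ _) (chi z) => *; ring.
Qed.

Lemma test_trunc_grad s k : 1 <= s -> test_function (trunc_grad s k).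
Proof.
move=> s1; rewrite (funext (trunc_gradE s k)).
apply: test_sub (test_mull chi_test (dEt_smooth k)).
exact: test_partial (test_trunc_pot s1).
Qed.

Lemma partial_trunc_grad s k l z : partial l (trunc_grad s k) z =
  partial l (cut_grad k) z - rescale s (partial l (partial k cut_pot)) z.
Proof.
have [_ E] := is_deriveB (partialP l z (smooth_pderivable (smooth_cut_grad k)))
  (partial2_affineZ s k l z smooth_cut_pot).
exact: E.
Qed.

(** Where [chi] is not constant the potential is the logarithm, so that the
    derivatives falling on the cut-off only meet [pker]. *)
Lemma cut_grad_partial k l z : partial l (cut_grad k) z =
  - ((1 - chi z) * K_kernel k l z + partial l chi z * pker k z).
Proof.
rewrite (partialM l (smooth_pderivable chic_smooth) (smooth_pderivable (dEt_smooth k))).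
rewrite (_ : partial l (fun z => 1 - chi z) z = - partial l chi z); last first.
  have [_ E] := is_deriveB (is_derive_cst (1 : R) z (basis l))
    (partialP l z (smooth_pderivable chi_smooth)).
  by rewrite [LHS]E sub0r.
have [dz|zd] := ltP d `|z|.
  rewrite (partial_Et_far d_gt0 Et_far k dz) (partial2_Et_far d_gt0 Et_far k l dz).
  by move: (partial _ _ _) (pker _ _) (K_kernel _ _ _) (chi z) => *; ring.
have zd2 : `|z| < 2 * d by rewrite (le_lt_trans zd)// ltr_pMl// ltr1n.
rewrite (partial_flat l _ zd2 (c := 1)); last by move=> w /ltW; exact: chi_near.
by rewrite chi_near ?ltW// subrr oppr0 !mul0r addr0 oppr0.
Qed.

Lemma cut_grad_shear z :
  2^-1 * (partial ord0 (cut_grad ord0) z - partial ord_max (cut_grad ord_max) z) =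
  - ((1 - chi z) * K_kernel ord0 ord0 z + 2^-1 * M_kernel chi ord0 ord0 z).
Proof.
rewrite !cut_grad_partial (_ : K_kernel ord_max ord_max z = - K_kernel ord0 ord0 z); last first.
  by apply/eqP; rewrite -addr_eq0 addrC K_trace.
rewrite /M_kernel /pker eqxx /coord /=.
move: (partial _ _ _) (partial _ _ _) (K_kernel _ _ _) (chi z) (sqnorm z)^-1 => *.
by field.
Qed.

Lemma cut_grad_mixed z :
  partial ord_max (cut_grad ord0) z + partial ord0 (cut_grad ord_max) z =
  - ((1 - chi z) * (K_kernel ord0 ord_max z + K_kernel ord_max ord0 z) +
     2^-1 * (M_kernel chi ord0 ord_max z + M_kernel chi ord_max ord0 z)).
Proof.
rewrite !cut_grad_partial /M_kernel /pker /coord /=.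
move: (partial _ _ _) (partial _ _ _) (K_kernel _ _ _) (K_kernel _ _ _) (chi z) (sqnorm z)^-1 => *.
by field.
Qed.

Variables (U0 U1 om q : R * R -> R) (C : R).
Hypotheses (cU0 : continuous U0) (cU1 : continuous U1) (mom : meas om).
Hypotheses (U0C : forall z, `|U0 z| <= C) (U1C : forall z, `|U1 z| <= C)
  (omC : forall z, `|om z| <= C).
Hypothesis hdiv : forall phi, test_function phi ->
  \int[@leb2 R]_z (U0 z * partial ord0 phi z) + \int[@leb2 R]_z (U1 z * partial ord_max phi z) = 0.
Hypothesis hcurl : forall phi, test_function phi ->
  \int[@leb2 R]_z (om z * phi z) =
  \int[@leb2 R]_z (U0 z * partial ord_max phi z) - \int[@leb2 R]_z (U1 z * partial ord0 phi z).

Let a0 z := - (om z * U1 z).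
Let a1 z := om z * U0 z.
Hypothesis lq : locint q.
Hypothesis hq : forall h, test_function h -> forall x,
  conv q (Lap h) x = - (conv a0 (partial ord0 h) x + conv a1 (partial ord_max h) x).

(** These two functions determine the trace-free part of the matrix with entries
    [u_k * u_l]; the trace does not enter because [K_kernel] and [M_kernel] have
    zero trace. *)
Definition shear0 z : R := U0 z * U0 z - U1 z * U1 z.
Definition shear1 z : R := U0 z * U1 z.

Definition near0 z : R := M_kernel chi ord0 ord0 z.
Definition near1 z : R := M_kernel chi ord0 ord_max z + M_kernel chi ord_max ord0 z.
Definition far0 z : R := (1 - chi z) * K_kernel ord0 ord0 z.
Definition far1 z : R :=
  (1 - chi z) * (K_kernel ord0 ord_max z + K_kernel ord_max ord0 z).
Definition tail0 z : R :=
  2^-1 * (partial ord0 (partial ord0 cut_pot) z - partial ord_max (partial ord_max cut_pot) z).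
Definition tail1 z : R :=
  partial ord_max (partial ord0 cut_pot) z + partial ord0 (partial ord_max cut_pot) z.

Lemma trunc_grad_shear s z :
  2^-1 * (partial ord0 (trunc_grad s ord0) z - partial ord_max (trunc_grad s ord_max) z) =
  - (far0 z + 2^-1 * near0 z + rescale s tail0 z).
Proof.
have := cut_grad_shear z; rewrite -/(far0 z) -/(near0 z) => E.
rewrite !partial_trunc_grad [RHS]opprD -E /rescale /tail0.
do 4!move: (partial _ _ _) => ?; move: (_^-1) => ?.
by ring.
Qed.

Lemma trunc_grad_mixed s z :
  partial ord_max (trunc_grad s ord0) z + partial ord0 (trunc_grad s ord_max) z =
  - (far1 z + 2^-1 * near1 z + rescale s tail1 z).
Proof.
have := cut_grad_mixed z; rewrite -/(far1 z) -/(near1 z) => E.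
rewrite !partial_trunc_grad [RHS]opprD -E /rescale /tail1.
do 4!move: (partial _ _ _) => ?; move: (_^-1) => ?.
by ring.
Qed.

Definition split0 s z : R := far0 z + 2^-1 * near0 z + rescale s tail0 z.
Definition split1 s z : R := far1 z + 2^-1 * near1 z + rescale s tail1 z.

Lemma test_split0 s : 1 <= s -> test_function (split0 s).
Proof.
move=> s1; rewrite (_ : split0 s = fun z => (- 2^-1) *
    (partial ord0 (trunc_grad s ord0) z - partial ord_max (trunc_grad s ord_max) z)).
  apply: test_scale; apply: test_sub; apply: test_partial; exact: test_trunc_grad.
by rewrite funeqE => z; rewrite mulNr trunc_grad_shear opprK.
Qed.

Lemma test_split1 s : 1 <= s -> test_function (split1 s).
Proof.
move=> s1; rewrite (_ : split1 s = fun z => (- 1) *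
    (partial ord_max (trunc_grad s ord0) z + partial ord0 (trunc_grad s ord_max) z)).
  apply: test_scale; apply: test_add; apply: test_partial; exact: test_trunc_grad.
by rewrite funeqE => z; rewrite mulNr mul1r trunc_grad_mixed opprK.
Qed.

Let mU0 : meas U0. Proof. exact: meas_cont. Qed.
Let mU1 : meas U1. Proof. exact: meas_cont. Qed.
Let C0 : 0 <= C. Proof. exact: le_trans (U0C 0). Qed.

Lemma bounded_prod f g z : `|f z| <= C -> `|g z| <= C -> `|f z * g z| <= C * C.
Proof. by move=> fC gC; rewrite normrM ler_pM. Qed.

Lemma meas_shear0 : meas shear0. Proof. by apply: measB; exact: measM. Qed.
Lemma meas_shear1 : meas shear1. Proof. exact: measM. Qed.

Lemma shear0_bounded z : `|shear0 z| <= 2 * (C * C).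
Proof.
by rewrite (le_trans (ler_normB _ _))// mulr_natl mulr2n lerD// bounded_prod.
Qed.

Lemma shear1_bounded z : `|shear1 z| <= 2 * (C * C).
Proof.
by rewrite (le_trans (bounded_prod (U0C z) (U1C z)))// ler_peMl ?mulr_ge0// ler1n.
Qed.

Lemma meas_a0 : meas a0.
Proof.
rewrite (_ : a0 = fun z => 0 - om z * U1 z); last by rewrite funeqE => z; rewrite sub0r.
exact: measB (meas_cont (smooth_continuous (smooth_cst 0))) (measM mom mU1).
Qed.
Lemma meas_a1 : meas a1. Proof. exact: measM. Qed.
Lemma a0_bounded z : `|a0 z| <= C * C.
Proof. by rewrite normrN bounded_prod. Qed.
Lemma a1_bounded z : `|a1 z| <= C * C.
Proof. exact: bounded_prod. Qed.

(** The vorticity identity with the test field obtained by reflecting and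
    translating [trunc_grad s]: the vorticity disappears from the far field. *)
Lemma conv_trunc_grad s x : 1 <= s ->
  conv a0 (trunc_grad s ord0) x + conv a1 (trunc_grad s ord_max) x =
  - (conv shear0 (split0 s) x + conv shear1 (split1 s) x).
Proof.
move=> s1.
pose p k y := trunc_grad s k (x - y).
have tp k : test_function (p k) by exact: test_refl (test_trunc_grad k s1).
have dp k l y : partial l (p k) y = - partial l (trunc_grad s k) (x - y).
  by rewrite (partial_refl l x (smooth_pderivable (test_smooth (test_trunc_grad k s1)))).
have tD := test_LapEt d_gt0 Et_smooth Et_far.
have pi0 : pi != 0 :> R by rewrite gt_eqF// pi_gt0.
have rho1 : \int[@leb2 R]_z ((2 * pi)^-1 * Lap Et z) = 1.
  rewrite IntZ; last exact: integ_test.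
  by rewrite (Int_LapEt d_gt0 Et_smooth Et_far) mulVf// mulf_neq0.
have E := vorticity_identity cU0 cU1 mom U0C U1C omC hdiv hcurl
  (test_scale (2 * pi)^-1 tD) rho1 (tp ord0) (tp ord_max).
have [la0 la1] := (locint_bounded meas_a0 a0_bounded, locint_bounded meas_a1 a1_bounded).
have [ls0 ls1] := (locint_bounded meas_shear0 shear0_bounded,
  locint_bounded meas_shear1 shear1_bounded).
have i0 := integ_conv x la0 (test_trunc_grad ord0 s1).
have i1 := integ_conv x la1 (test_trunc_grad ord_max s1).
have j0 := integ_conv x ls0 (test_split0 s1).
have j1 := integ_conv x ls1 (test_split1 s1).
rewrite -(IntD i0 i1) -(IntD j0 j1); apply/eqP; rewrite -addr_eq0; apply/eqP.
rewrite -[RHS]E; congr (_ + _); apply: Int_eq => y.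
  rewrite /a0 /a1 /p; move: (trunc_grad _ _ _) (trunc_grad _ _ _) => *; ring.
rewrite /quad !dp -/(shear0 y) -/(shear1 y).
have -> : split0 s (x - y) = 2^-1 * (- partial ord0 (trunc_grad s ord0) (x - y)
    - - partial ord_max (trunc_grad s ord_max) (x - y)).
  by rewrite -opprD mulrN trunc_grad_shear opprK.
have -> : split1 s (x - y) = - partial ord_max (trunc_grad s ord0) (x - y)
    - partial ord0 (trunc_grad s ord_max) (x - y).
  by rewrite -opprD trunc_grad_mixed opprK.
by [].
Qed.

Lemma integ_chi_pker k : integ (fun z => chi z * pker k z).
Proof.
have [B B0 chiB] := test_bounded chi_test.
exact: integ_pkerM r_gt0 (meas_test chi_test) chiB chi_supp.
Qed.

(** The equation tested against [trunc_pot s], together with the splitting of its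
    gradient into the cut-off part near the origin and [trunc_grad s]. *)
Lemma pressure_split s x : 1 <= s -> pressure Et a0 a1 q x =
  conv q (rescale s (Lap cut_pot)) x -
  (conv a0 (fun z => chi z * pker ord0 z) x + conv a1 (fun z => chi z * pker ord_max z) x) +
  (conv shear0 (split0 s) x + conv shear1 (split1 s) x).
Proof.
move=> s1; have s0 : 0 < s := lt_le_trans ltr01 s1.
have key (a : R * R -> R) k : meas a -> (forall z, `|a z| <= C * C) ->
    conv a (partial k (trunc_pot s)) x = conv a (trunc_grad s k) x +
    (conv a (fun z => partial k Et z - pker k z) x + conv a (fun z => chi z * pker k z) x).
  move=> ma aC.
  have i1 := integ_bounded_conv x ma aC (integ_test (test_trunc_grad k s1)).
  have i2 := integ_bounded_conv x ma aC (integ_m d_gt0 Et_smooth Et_far k).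
  have i3 := integ_bounded_conv x ma aC (integ_chi_pker k).
  rewrite /conv -(IntD i2 i3) -(IntD i1 (integD i2 i3)); apply: Int_eq => y.
  rewrite -!mulrDr trunc_gradE; congr (_ * _); move: (x - y) => z.
  have [dz|zd] := ltP d `|z|.
    by rewrite (partial_Et_far d_gt0 Et_far k dz) subrr add0r subrK.
  have zd2 : `|z| <= 2 * d by rewrite (le_trans zd)// ler_pMl// ler1n.
  by rewrite chi_near// !mul1r; move: (partial _ _ _) (partial _ _ _) (pker _ _) => *; ring.
have := hq (test_trunc_pot s1) x.
rewrite Lap_trunc_pot (convB lq (test_LapEt d_gt0 Et_smooth Et_far) (test_rescale s0 test_Lap_cut_pot)).
rewrite (key _ ord0 meas_a0 a0_bounded) (key _ ord_max meas_a1 a1_bounded).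
have := conv_trunc_grad x s1; rewrite /pressure.
do 10!move: (conv _ _ x) => ?; lra.
Qed.

(** * Letting the truncation radius tend to infinity *)

Definition homog f : Prop := forall t z, 1 <= t -> r < `|z| ->
  f (affine t 0 z) = (t ^+ 2)^-1 * f z.

Lemma homogD f g : homog f -> homog g -> homog (fun z => f z + g z).
Proof. by move=> hf hg t z t1 rz; rewrite hf// hg// mulrDr. Qed.

Lemma homogZ (c : R) f : homog f -> homog (fun z => c * f z).
Proof. by move=> hf t z t1 rz; rewrite hf// mulrCA. Qed.

Lemma homog_K f k l : (forall z, r < `|z| -> f z = K_kernel k l z) -> homog f.
Proof.
move=> fK t z t1 rz; have t0 : 0 < t := lt_le_trans ltr01 t1.
have rtz : r < t * `|z| by rewrite (lt_le_trans rz)// ler_peMl.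
by rewrite !fK ?norm_affine0// K_homogeneous// gt_eqF.
Qed.

Lemma homog_cut_pot k l : homog (partial l (partial k cut_pot)).
Proof.
have -> : partial l (partial k cut_pot) = fun z => -1 * - partial l (partial k cut_pot) z.
  by rewrite funeqE => z; rewrite mulN1r opprK.
apply: homogZ; apply: (@homog_K _ k l) => z rz.
by rewrite (partial2_Et_far r_gt0 cut_pot_far k l rz) opprK.
Qed.

Lemma smooth_tail0 : smooth tail0.
Proof.
exact: smoothZ _ (smoothB (smooth_partial _ (dY_smooth _)) (smooth_partial _ (dY_smooth _))).
Qed.

Lemma smooth_tail1 : smooth tail1.
Proof.
exact: smoothD (smooth_partial _ (dY_smooth _)) (smooth_partial _ (dY_smooth _)).
Qed.

Lemma homog_tail0 : homog tail0.
Proof.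
have E : tail0 = fun z => 2^-1 * (partial ord0 (partial ord0 cut_pot) z +
    -1 * partial ord_max (partial ord_max cut_pot) z).
  by rewrite funeqE => z; rewrite mulN1r.
rewrite E; apply: homogZ; apply: homogD; first exact: homog_cut_pot.
by apply: homogZ; exact: homog_cut_pot.
Qed.

Lemma homog_tail1 : homog tail1.
Proof. by apply: homogD; exact: homog_cut_pot. Qed.

Definition far_kernel k l z : R := (1 - chi z) * K_kernel k l z.

Lemma far_kernelE k l :
  far_kernel k l = fun z => - ((1 - chi z) * partial l (partial k Et) z).
Proof.
rewrite funeqE => z; rewrite /far_kernel; have [dz|zd] := ltP d `|z|.
  by rewrite (partial2_Et_far d_gt0 Et_far k l dz) mulrN opprK.
have zd2 : `|z| <= 2 * d by rewrite (le_trans zd)// ler_pMl// ler1n.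
by rewrite chi_near// subrr !mul0r oppr0.
Qed.

Lemma smooth_far_kernel k l : smooth (far_kernel k l).
Proof.
rewrite far_kernelE; apply: smoothN; apply: smoothM chic_smooth _.
by apply: smooth_partial; exact: dEt_smooth.
Qed.

Lemma homog_far_kernel k l : homog (far_kernel k l).
Proof.
by apply: (@homog_K _ k l) => z rz; rewrite /far_kernel (chi_supp rz) subr0 mul1r.
Qed.

(** A kernel homogeneous of degree [-2] far out need not be integrable, but its
    increments are of order [-3], and dilation by [s] divides them by [s]. *)
Lemma homog_increment f g B x x0 : smooth f -> homog f ->
  meas g -> (forall z, `|g z| <= B) ->
  exists A, forall s, 1 <= s ->
    integ (fun y => g y * (rescale s f (x - y) - rescale s f (x0 - y))) /\
    `|\int[@leb2 R]_y (g y * (rescale s f (x - y) - rescale s f (x0 - y)))| <= s^-1 * A.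
Proof.
move=> sf hf mg gB.
have [D D0 HD] := homogeneous_lip r_gt0 (normr_ge0 (x - x0)) sf hf.
have B0 : 0 <= B by rewrite (le_trans _ (gB 0)).
exists (B * (D * `|x - x0|) * \int[@leb2 R]_z decay z) => s s1.
have s0 : 0 < s := lt_le_trans ltr01 s1.
have xs : `|x - x0| <= s * `|x - x0| by rewrite ler_peMl.
have tr := rescale_translate s0 HD xs.
have id : integ (fun y => B * (D * (s^-1 * `|x - x0|)) * rescale s decay (x0 - y)).
  by apply: integZ; apply: integ_refl; apply: integ_rescale => //; exact: integ_decay.
have le y : `|g y * (rescale s f (x - y) - rescale s f (x0 - y))| <=
    B * (D * (s^-1 * `|x - x0|)) * rescale s decay (x0 - y).
  by rewrite normrM -mulrA ler_pM.
have mf : meas (rescale s f).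
  apply: meas_cont; apply: smooth_continuous; apply: smoothZ.
  exact: smooth_affine s^-1 0 sf.
have ig : integ (fun y => g y * (rescale s f (x - y) - rescale s f (x0 - y))).
  by apply: integ_le id le; apply: measM => //; apply: measB; exact: meas_refl.
split => //; rewrite (le_trans (Int_norm_le ig id le))//.
rewrite IntZ; last by apply: integ_refl; apply: integ_rescale => //; exact: integ_decay.
rewrite Int_rescale_refl//; last exact: integ_decay.
by move: (\int[_]_z _) => I; rewrite le_eqVlt; apply/orP; left; apply/eqP; ring.
Qed.

Hypothesis q_osc : exists2 B, 0 <= B & forall c (P : R), 0 < P ->
  exists m : R, \int[@leb2 R]_z (`|q z - m| * ind P (c - z)) <= B * P ^+ 2.

(** The increment of a dilated test function has zero mean, so that only the
    oscillation of [q] on a disk matters. *)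
Lemma osc_increment h x x0 : test_function h ->
  exists A, forall s, 1 <= s ->
    `|conv q (rescale s h) x - conv q (rescale s h) x0| <= s^-1 * A.
Proof.
move=> th; have [B B0 osc] := q_osc.
have [Lh Lh0 hL] := test_lip th.
have /test_functionP[_ [rh rh0 hr]] := th.
(* the square around [x0] that contains both supports has radius at most
   [s * (rh + e)], because [1 <= s] *)
pose e := `|x - x0|; have e0 : 0 <= e := normr_ge0 _.
exists (Lh * e * (B * (rh + e) ^+ 2)) => s s1.
have s0 : 0 < s := lt_le_trans ltr01 s1.
have [m Hm] := osc x0 (s * (rh + e)) (mulr_gt0 s0 (ltr_pwDl rh0 e0)).
pose k := rescale s h; have tk : test_function k := test_rescale s0 th.
pose kd y := k (x - y) - k (x0 - y).
have tkd : test_function kd by apply: test_sub; exact: test_refl.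
have skd y : s * (rh + e) < `|x0 - y| -> kd y = 0.
  move=> Hy; have hs := supported_rescale s0 hr.
  have se : e <= s * e by rewrite ler_peMl.
  have xxy : `|x0 - y| <= `|x - y| + e.
    by rewrite (_ : x0 - y = (x - y) - (x - x0)) ?ler_normB//; rewrite opprB [RHS]addrC addrA subrK.
  rewrite /kd /k !hs ?subrr//; first by move: Hy; rewrite mulrDr; nra.
  by move: Hy xxy se; rewrite mulrDr; lra.
have lkd y : `|kd y| <= s^-1 ^+ 3 * Lh * e * ind (s * (rh + e)) (x0 - y).
  rewrite indE; have [Hy|Hy] := leP `|x0 - y| (s * (rh + e)); last first.
    by rewrite skd// normr0 mulr0.
  rewrite mulr1 /kd /k /rescale -mulrBr normrM gtr0_norm ?invr_gt0 ?exprn_gt0//.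
  have := hL (affine s^-1 0 (x - y)) (affine s^-1 0 (x0 - y)).
  rewrite !affine0E -scalerBr normrZ gtr0_norm ?invr_gt0// opprB addrA subrK -/e => H.
  have -> : s^-1 ^+ 3 * Lh * e = (s ^+ 2)^-1 * (Lh * (s^-1 * e)) by field; rewrite gt_eqF.
  by rewrite ler_wpM2l// invr_ge0 exprn_ge0// ltW.
have iqk a : integ (fun y => q y * k (a - y)) := integ_conv a lq tk.
have ikd := integ_test tkd.
have ikx a : integ (fun y => k (a - y)) := integ_test (test_refl a tk).
have E : conv q k x - conv q k x0 = \int[@leb2 R]_y ((q y - m) * kd y).
  rewrite /conv -(IntB (iqk x) (iqk x0)).
  transitivity (\int[@leb2 R]_y (q y * k (x - y) - q y * k (x0 - y)) -
                m * \int[@leb2 R]_y kd y).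
    rewrite /kd (IntB (ikx x) (ikx x0)) !Int_refl ?subrr ?mulr0 ?subr0//; exact: integ_test.
  rewrite -(IntZ m ikd) -(IntB (integB (iqk x) (iqk x0)) (integZ m ikd)).
  by apply: Int_eq => y; rewrite /kd; ring.
rewrite E.
have lm : locint (fun z => q z - m).
  have lc := locint_cont (smooth_continuous (smooth_cst (- m))).
  exact: locintD lq lc.
have [Bk Bk0 kdB] := test_bounded tkd.
have /test_functionP[_ [rk rk0 kdr]] := tkd.
have i1 : integ (fun y => (q y - m) * kd y) := locint_mul lm (meas_test tkd) kdB kdr.
have i4 : integ (fun y => `|q y - m| * ind (s * (rh + e)) (x0 - y)).
  have sI : supported (s * (rh + e)) (ind (s * (rh + e))).
    by move=> z; rewrite indE ltNge => /negbTE ->.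
  have i3 := locint_mul lm (meas_refl x0 (meas_ind (s * (rh + e))))
    (fun z => ind_le1 _ (x0 - z)) (supported_refl (x := x0) sI).
  by apply: integ_eq (integ_norm i3) => y; rewrite normrM (ger0_norm (ind_ge0 _ _)).
have i2 := integZ (s^-1 ^+ 3 * Lh * e) i4.
rewrite (le_trans (Int_norm_le i1 i2 _))//.
  by move=> y; rewrite normrM mulrCA ler_wpM2l.
rewrite (IntZ _ i4); have c0 : 0 <= s^-1 ^+ 3 * Lh * e.
  by rewrite !mulr_ge0// ?exprn_ge0// invr_ge0 ltW.
rewrite (le_trans (ler_wpM2l c0 Hm))// le_eqVlt; apply/orP; left; apply/eqP.
by field; rewrite gt_eqF.
Qed.

(** On the support of the derivatives of [chi] the quotient [coord k z / sqnorm z]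
    is the partial derivative of the smooth potential. *)
Lemma M_kernelE k l : M_kernel chi k l = fun z =>
  2 * (partial l chi z * partial k Et z) - (k == l)%:R *
    (partial ord0 chi z * partial ord0 Et z + partial ord_max chi z * partial ord_max Et z).
Proof.
rewrite funeqE => z; rewrite /M_kernel; have [dz|zd] := ltP d `|z|.
  rewrite !(fun k => partial_Et_far d_gt0 Et_far k dz) /pker [coord ord0 z]/coord /=.
  rewrite [coord ord_max z]/coord /=.
  move: (partial _ _ _) (partial _ _ _) (partial _ _ _) (coord k z) (sqnorm z)^-1 (_%:R) => *.
  by ring.
have zd2 : `|z| < 2 * d by rewrite (le_lt_trans zd)// ltr_pMl// ltr1n.
have E j : partial j chi z = 0.
  by apply: (partial_flat j _ zd2 (c := 1)) => w /ltW; exact: chi_near.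
by rewrite !E !mul0r !mulr0 !addr0 mulr0 subrr mul0r.
Qed.

Lemma test_M_kernel k l : test_function (M_kernel chi k l).
Proof.
rewrite M_kernelE; have t i j : test_function (fun z => partial i chi z * partial j Et z).
  exact: test_mull (test_partial i chi_test) (dEt_smooth j).
exact: test_sub (test_scale 2 (t l k)) (test_scale (k == l)%:R (test_add (t _ _) (t _ _))).
Qed.

Lemma rescale1 f : rescale 1 f = f.
Proof.
rewrite funeqE => z; rewrite /rescale affine0E expr1n invr1 mul1r scale1r//.
Qed.

Lemma far_increment k l g B x x0 : meas g -> (forall z, `|g z| <= B) ->
  integ (fun y => g y * (far_kernel k l (x - y) - far_kernel k l (x0 - y))).
Proof.
move=> mg gB.
have [A HA] := homog_increment x x0 (smooth_far_kernel k l) (homog_far_kernel k l) mg gB.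
by have [+ _] := HA 1 (lexx 1); rewrite rescale1.
Qed.

Lemma far1E z : far1 z = far_kernel ord0 ord_max z + far_kernel ord_max ord0 z.
Proof. exact: mulrDr. Qed.

Lemma split_increment g B (n f t h : R * R -> R) x x0 :
  meas g -> (forall z, `|g z| <= B) -> test_function n -> test_function h ->
  h =1 (fun z => f z + 2^-1 * n z + t z) ->
  integ (fun y => g y * (f (x - y) - f (x0 - y))) ->
  integ (fun y => g y * (t (x - y) - t (x0 - y))) ->
  conv g h x - conv g h x0 = 2^-1 * (conv g n x - conv g n x0) +
    \int[@leb2 R]_y (g y * (f (x - y) - f (x0 - y))) +
    \int[@leb2 R]_y (g y * (t (x - y) - t (x0 - y))).
Proof.
move=> mg gB tn th hE i1 i2.
have j a := integ_bounded_conv a mg gB (integ_test tn).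
have k a := integ_bounded_conv a mg gB (integ_test th).
rewrite /conv -(IntB (k x) (k x0)) -(IntB (j x) (j x0)) -(IntZ _ (integB (j x) (j x0))).
rewrite -(IntD (integZ 2^-1 (integB (j x) (j x0))) i1).
rewrite -(IntD (integD (integZ 2^-1 (integB (j x) (j x0))) i1) i2).
by apply: Int_eq => y; rewrite !hE; ring.
Qed.

(** Both sides are independent of the truncation radius [s], and they differ by
    terms of order [s^-1]. *)
Lemma pressure_increment x x0 : pressure Et a0 a1 q x - pressure Et a0 a1 q x0 =
  (conv a0 (fun z => chi z * pker ord0 z) x0 + conv a1 (fun z => chi z * pker ord_max z) x0) -
  (conv a0 (fun z => chi z * pker ord0 z) x + conv a1 (fun z => chi z * pker ord_max z) x) +
  2^-1 * (conv shear0 near0 x - conv shear0 near0 x0) +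
  2^-1 * (conv shear1 near1 x - conv shear1 near1 x0) +
  \int[@leb2 R]_y (shear0 y * (far0 (x - y) - far0 (x0 - y))) +
  \int[@leb2 R]_y (shear1 y * (far1 (x - y) - far1 (x0 - y))).
Proof.
have tn0 : test_function near0 by exact: test_M_kernel.
have tn1 : test_function near1 by apply: test_add; exact: test_M_kernel.
have f0 := far_increment ord0 ord0 x x0 meas_shear0 shear0_bounded.
have f1 : integ (fun y => shear1 y * (far1 (x - y) - far1 (x0 - y))).
  have h := integD (far_increment ord0 ord_max x x0 meas_shear1 shear1_bounded)
                   (far_increment ord_max ord0 x x0 meas_shear1 shear1_bounded).
  by apply: integ_eq h => y; rewrite !far1E; ring.
have [A0 H0] := homog_increment x x0 smooth_tail0 homog_tail0 meas_shear0 shear0_bounded.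
have [A1 H1] := homog_increment x x0 smooth_tail1 homog_tail1 meas_shear1 shear1_bounded.
have [A HA] := osc_increment x x0 test_Lap_cut_pot.
set RHS := (X in _ = X).
suff H (s : R) : 1 <= s ->
    `|pressure Et a0 a1 q x - pressure Et a0 a1 q x0 - RHS| <= s^-1 * (A + A0 + A1).
  apply/eqP; rewrite -subr_eq0 -normr_le0; apply/ler_addgt0Pr => e e0; rewrite add0r.
  (* [s := 1 + D / e] makes the bound smaller than [e] *)
  pose D := `|A + A0 + A1|.
  have D0 : 0 <= D := normr_ge0 _.
  have s1 : 1 <= 1 + D / e by rewrite lerDl divr_ge0// ltW.
  have s0 := lt_le_trans ltr01 s1.
  rewrite (le_trans (H _ s1))// mulrC ler_pdivrMr// (le_trans (ler_norm _))// -/D.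
  by rewrite mulrDr mulr1 mulrCA divff ?gt_eqF// mulr1 lerDr ltW.
move=> s1; have [i0 b0] := H0 s s1; have [i1 b1] := H1 s s1; have bq := HA s s1.
have E0 := split_increment meas_shear0 shear0_bounded tn0 (test_split0 s1) (fun=> erefl) f0 i0.
have E1 := split_increment meas_shear1 shear1_bounded tn1 (test_split1 s1) (fun=> erefl) f1 i1.
have -> : pressure Et a0 a1 q x - pressure Et a0 a1 q x0 - RHS =
    (conv q (rescale s (Lap cut_pot)) x - conv q (rescale s (Lap cut_pot)) x0) +
    \int[@leb2 R]_y (shear0 y * (rescale s tail0 (x - y) - rescale s tail0 (x0 - y))) +
    \int[@leb2 R]_y (shear1 y * (rescale s tail1 (x - y) - rescale s tail1 (x0 - y))).
  rewrite /RHS (pressure_split x s1) (pressure_split x0 s1).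
  move: E0 E1; do 14!move: (conv _ _ _) => ?; do 4!move: (\int[_]_y _) => ?; lra.
rewrite !mulrDr (le_trans (ler_normD _ _))// lerD//.
by rewrite (le_trans (ler_normD _ _))// lerD.
Qed.

End Splitting.

(** * Bounded mean oscillation *)

Section MeanOscillation.
Context {R : realType}.
Notation P := (measurableTypeR R * measurableTypeR R)%type.
Implicit Types (f g h q : R * R -> R) (c x y z : R * R) (r s t L : R) (k l : 'I_2).

Lemma measurable_disk c r : measurable (disk c r : set P).
Proof.
apply: open_measurable_plane.
have -> : disk c r = (@sqnorm R \o affine 1 (- c)) @^-1` [set t : R | t < r ^+ 2].
  rewrite predeqE => z; rewrite /disk /= (_ : affine 1 (- c) z = z - c)//.
  by rewrite /affine !mul1r.
apply: open_comp => [z _|]; last exact: open_lt.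
apply: smooth_continuous; apply: smooth_affine.
exact: smoothD (smoothM (smooth_coord ord0) (smooth_coord ord0))
  (smoothM (smooth_coord ord_max) (smooth_coord ord_max)).
Qed.

Lemma integ_restrict f (D : set P) : measurable D ->
  (@leb2 R).-integrable D (EFin \o f) <-> integ (f \_ D).
Proof.
move=> mD; rewrite /integ (_ : EFin \o (f \_ D) = (EFin \o f) \_ D); first exact: integrable_mkcond.
by rewrite restrict_EFin.
Qed.

Lemma disk_sub_box c r z : 0 < r -> disk c r z -> `|c - z| <= r.
Proof.
move=> r0 Hz; rewrite -normrN opprB -(ler_pXn2r (n := 2)) ?nnegrE ?(ltW r0)//.
exact: (le_trans (sqnorm_ge _) (ltW Hz)).
Qed.

Lemma box_sub_disk c r z : 0 < r -> `|c - z| <= r -> disk c (2 * r) z.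
Proof.
move=> r0; rewrite -normrN opprB norm_le /disk /= sqnormE => /andP[h1 h2].
have e (t : R) : `|t| <= r -> t * t <= r ^+ 2.
  by move=> h; rewrite -expr2 -(real_normK (num_real t)) ler_pXn2r ?nnegrE// ltW.
have := e _ h1; have := e _ h2; have : 0 < r ^+ 2 by rewrite exprn_gt0.
by rewrite exprMn; lra.
Qed.

Lemma leb2_disk_le c r : 0 < r -> (@leb2 R (disk c r) <= ((2 * r) ^+ 2)%:E)%E.
Proof.
move=> r0; have mD := measurable_disk c r.
have ii : integ (fun z => ind r (c - z)) by apply: integ_refl; exact: integ_ind.
have -> : (((2 * r) ^+ 2)%:E = \int[@leb2 R]_z (ind r (c - z))%:E)%E.
  by rewrite (integ_fineK ii) (Int_refl c (integ_ind r)) Int_ind// ltW.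
rewrite -[X in leb2 X]setIT -(integral_indic (@leb2 R) measurableT mD).
apply: ge0_le_integral => //.
- by apply/measurable_EFinP; exact: measurable_indic.
- by apply/measurable_EFinP; exact: integ_meas ii.
move=> z _; rewrite lee_fin indicE; case: (boolP (z \in disk c r)) => [|_]; last exact: ind_ge0.
by rewrite inE => /(disk_sub_box r0) h; rewrite indE h.
Qed.

Lemma meas_BMO q : BMO q -> meas q.
Proof.
move=> [iq _].
have E : setT = \bigcup_n (disk 0 n.+1%:R : set P).
  rewrite predeqE => z; split => // _; exists (Num.bound (2 * `|z|)) => //.
  have h0 : 0 <= 2 * `|z| by rewrite mulr_ge0.
  have Hn := archi_boundP h0; set n := Num.bound _ in Hn *.
  have n0 : 0 < n.+1%:R / 2 :> R by rewrite divr_gt0.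
  have := @box_sub_disk 0 _ z n0; rewrite [2 * _]mulrC divfK//; apply.
  rewrite sub0r normrN ler_pdivlMr// mulrC (le_trans (ltW Hn))// ler_nat.
  exact: leqnSn.
rewrite /meas E; apply/measurable_fun_bigcup => n; first exact: measurable_disk.
by have /integrableP[/measurable_EFinP] := iq 0 n.+1%:R (ltr0Sn _ _).
Qed.

Lemma locint_BMO q : BMO q -> locint q.
Proof.
move=> bq; have mq := meas_BMO bq; split => // r.
have r0 : 0 < `|r| + 1 by rewrite ltr_wpDl.
have iD := (integ_restrict q (measurable_disk 0 (2 * (`|r| + 1)))).1 (bq.1 0 _ (mulr_gt0 (ltr0Sn _ 1) r0)).
apply: integ_le (integ_norm iD) _; first by apply: measM => //; exact: meas_ind.
move=> z; rewrite normrM indE; have [zr|_] := leP `|z| r; last by rewrite normr0 mulr0.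
rewrite normr1 mulr1 patchE mem_set//; apply: box_sub_disk => //.
by rewrite sub0r normrN (le_trans zr)// (le_trans (ler_norm _))// lerDl.
Qed.

(** The squares that are the balls of the library norm lie in disks of comparable
    radius. *)
Lemma BMO_osc q : BMO q -> exists2 B, 0 <= B & forall c s, 0 < s ->
  exists m : R, \int[@leb2 R]_z (`|q z - m| * ind s (c - z)) <= B * s ^+ 2.
Proof.
move=> bq; have lq := locint_BMO bq; have [iq [Cb HCb]] := bq.
exists (`|Cb| * 16) => // c s s0; have s20 : 0 < 2 * s by rewrite mulr_gt0.
exists (average q (disk c (2 * s))); set m := average _ _.
have mD := measurable_disk c (2 * s).
pose D := disk c (2 * s).
have mqm : meas (fun z => `|q z - m|).
  by apply: measurableT_comp => //; apply: measB => //; [exact: lq.1|exact: measurable_cst].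
have iqm : integ ((fun z => `|q z - m|) \_ D).
  have iD := (integ_restrict q mD).1 (iq c _ s20).
  have ii : integ (fun z => `|m| * ind (2 * s) (c - z)).
    by apply: integZ; apply: integ_refl; exact: integ_ind.
  have E : (fun z => `|q z - m|) \_ D = fun z => `|q z - m| * \1_D z.
    by rewrite funeqE => z; rewrite patchE indicE; case: ifP => _; rewrite ?mulr1 ?mulr0.
  have mD1 : meas (fun z => `|q z - m| * \1_D z).
    exact: measM mqm (measurable_indic mD).
  rewrite E; apply: integ_le mD1 (integD (integ_norm iD) ii) _ => z.
  rewrite indicE /= patchE; case: ifPn => [|_]; last first.
    by rewrite mulr0 !normr0 add0r mulr_ge0// ind_ge0.
  rewrite inE => /(disk_sub_box s20) h; rewrite indE h !mulr1 normr_id.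
  exact: ler_normB.
have le z : `|q z - m| * ind s (c - z) <= ((fun z => `|q z - m|) \_ D) z.
  rewrite indE; have [zs|_] := leP `|c - z| s; last first.
    by rewrite mulr0 patchE; case: ifP.
  by rewrite mulr1 patchE mem_set//; exact: box_sub_disk.
apply: (@le_trans _ _ (\int[@leb2 R]_(z in D) `|q z - m|)).
  rewrite [leRHS]Rintegral_mkcond.
  have im : integ (fun z => `|q z - m| * ind s (c - z)).
    apply: integ_le iqm _.
      exact: measM mqm (meas_refl c (meas_ind s)).
    by move=> z; rewrite ger0_norm// mulr_ge0// ind_ge0.
  exact: (Int_le im iqm le).
have := HCb c _ s20; rewrite -/m /average -/D.
set I := (\int[_]_(_ in _) _); set V := fine _ => H.
have fin := leb2_disk_le c s20.
have V0 : 0 <= V by apply: fine_ge0; exact: measure_ge0.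
have VE : leb2 D = V%:E.
  by rewrite fineK// fin_num_abs gee0_abs ?measure_ge0// (le_lt_trans fin)// ltey.
have V1 : V <= 16 * s ^+ 2.
  by rewrite -lee_fin -VE (le_trans fin)// lee_fin !exprMn; lra.
have [V00|Vn0] := eqVneq V 0.
  have -> : I = 0.
    rewrite /I /Rintegral null_set_integral//; last by rewrite VE V00.
    by have /integrableP[] := (integ_restrict _ mD).2 iqm.
  by apply: mulr_ge0; [exact: mulr_ge0|exact: exprn_ge0 (ltW s0)].
have Vp : 0 < V by rewrite lt_def Vn0.
rewrite ler_pdivrMr// in H; rewrite (le_trans H)// -mulrA.
by rewrite (le_trans (ler_wpM2r V0 (ler_norm Cb)))// ler_wpM2l.
Qed.

End MeanOscillation.

(** * The representation formula *)

Section Representation.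
Context {R : realType}.
Implicit Types (f g h q chi om : R * R -> R) (u : R * R -> R * R) (x y z : R * R)
  (r s t L : R) (k l : 'I_2).

Lemma integ_ae f g : meas g -> {ae @leb2 R, forall z, f z = g z} -> integ f -> integ g.
Proof.
move=> mg fg /integrableP[mf fi]; apply/integrableP; split; first exact/measurable_EFinP.
suff <- : (\int[@leb2 R]_z `|(f z)%:E| = \int[@leb2 R]_z `|(g z)%:E|)%E by [].
apply: ae_eq_integral => //.
- exact: measurableT_comp.
- by apply: measurableT_comp => //; exact/measurable_EFinP.
by apply: (@filterS _ (almost_everywhere (@leb2 R))) fg => z E _; rewrite E.
Qed.

Lemma Int_ae f g : meas f -> meas g -> {ae @leb2 R, forall z, f z = g z} ->
  \int[@leb2 R]_z f z = \int[@leb2 R]_z g z.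
Proof.
move=> mf mg fg; rewrite /Rintegral; congr fine; apply: ae_eq_integral => //.
- exact/measurable_EFinP.
- exact/measurable_EFinP.
by apply: (@filterS _ (almost_everywhere (@leb2 R))) fg => z E _; rewrite E.
Qed.

Lemma leb2_setT_gt0 : (0 < @leb2 R setT)%E.
Proof.
apply: (@lt_le_trans _ _ (@leb2 R (box 1))).
  by rewrite leb2_box// lte_fin exprn_gt0// mulr_gt0.
by apply: le_measure; rewrite ?inE//; exact: measurable_box.
Qed.

Lemma Lfun_bounded om : om \in Lfun (@leb2 R) +oo%E ->
  meas om /\ exists C : R, {ae @leb2 R, forall z, `|om z| <= C}.
Proof.
move=> Hom; split.
  by have := sub_Lfun_mfun Hom; rewrite inE.
have := sub_Lfun_finLfun Hom; rewrite inE /= /finite_norm unlock leb2_setT_gt0 => H.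
exact: (@ess_supr_bounded _ _ _ (@leb2 R) (fun z => `|om z|)).
Qed.

Lemma buc_continuous u k : buc u -> continuous (fun z => coord k (u z)).
Proof.
move=> [_ uc] z; apply: (@continuous_comp _ _ _ u (coord k)).
  apply/cvg_app_entourageP => A eA; have := nbhs_entourage z (uc A eA).
  by apply: filterS => y /=; rewrite /xsection /= inE.
by apply: smooth_continuous; exact: smooth_coord.
Qed.

Lemma buc_bounded u : buc u -> exists C : R, forall k z, `|coord k (u z)| <= C.
Proof.
move=> [[M [_ HM]] _]; exists (M + 1) => k z; rewrite (le_trans (coord_le _ _))//.
by apply: HM => //; rewrite ltrDl.
Qed.

Lemma q1_integrandE chi u om x y : q1_integrand chi u om x y =
  - (- (om y * coord ord_max (u y)) * (chi (x - y) * pker ord0 (x - y)) +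
     om y * coord ord0 (u y) * (chi (x - y) * pker ord_max (x - y))).
Proof.
rewrite /q1_integrand /pker /dot /perp /coord /=.
by move: (sqnorm _)^-1 (chi _) => *; ring.
Qed.

Lemma K_diag z : K_kernel ord_max ord_max z = - K_kernel ord0 ord0 z :> R.
Proof. by apply/eqP; rewrite -addr_eq0 addrC K_trace. Qed.

Lemma M_diag chi z : M_kernel chi ord_max ord_max z = - M_kernel chi ord0 ord0 z.
Proof. by rewrite /M_kernel /coord /=; ring. Qed.

Lemma dlaplacianE q phi : dlaplacian q phi =
  \int[@leb2 R]_y (q y * partial ord0 (partial ord0 phi) y) +
  \int[@leb2 R]_y (q y * partial ord_max (partial ord_max phi) y).
Proof. by rewrite /dlaplacian sum_ord2; congr (_ + _); exact: opprK. Qed.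

Lemma ddivE u phi : ddiv u phi =
  - (\int[@leb2 R]_y (coord ord0 (u y) * partial ord0 phi y)) -
  (\int[@leb2 R]_y (coord ord_max (u y) * partial ord_max phi y)).
Proof. exact: sum_ord2. Qed.

Lemma dcurlE u phi : dcurl u phi =
  \int[@leb2 R]_y (coord ord0 (u y) * partial ord_max phi y) -
  \int[@leb2 R]_y (coord ord_max (u y) * partial ord0 phi y).
Proof. by rewrite /dcurl [RHS]addrC; congr (_ + _); exact: opprK. Qed.

Lemma coord0_perp (c : R) z : coord ord0 (c *: perp z) = - (c * coord ord_max z).
Proof. exact: mulrN. Qed.

Lemma coord1_perp (c : R) z : coord ord_max (c *: perp z) = c * coord ord0 z.
Proof. by []. Qed.

(** After multiplication by [2 * pi], the increment of [pressure] between [x0] and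
    [x] is that of [q1 + q2] plus [q3], so that the difference is a constant,
    which is evaluated at [x0]. *)
Lemma representation u om chi q C : buc u -> distr_eq (ddiv u) (fun=> 0) ->
  meas om -> (forall z, `|om z| <= C) -> distr_eq (distr_of om) (dcurl u) ->
  test_function chi -> (\forall z \near (0 : R * R), chi z = 1) -> BMO q ->
  distr_eq (fun phi => - dlaplacian q phi) (ddiv (fun y => om y *: perp (u y))) ->
  forall x0,
    (forall x, integrals_converge chi u om x x0) /\
    exists q0 : R, {ae leb2, forall x,
      q x = q0 + q1 chi u om x + q2 chi u x + q3 chi u x x0}.
Proof.
move=> u_buc u_div mom omC0 om_curl chi_test chi_near0 q_BMO q_eq x0.
have [d d0 chi1] : exists2 d : R, 0 < d & forall z, `|z| <= 2 * d -> chi z = 1.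
  move/nbhs_ballP : chi_near0 => [e /= e0 He]; exists (e / 4); first by rewrite divr_gt0.
  move=> z zd; apply: He; rewrite -ball_normE /= sub0r normrN (le_lt_trans zd)//.
  lra.
have [r dr chi_supp] : exists2 r : R, d < r & supported r chi.
  have /test_functionP[_ [r r0 chir]] := chi_test; exists (r + d); first by rewrite ltrDr.
  by move=> z rz; apply: chir; rewrite (le_lt_trans _ rz)// lerDl ltW.
have chi0 : chi 0 = 1 by apply: chi1; rewrite normr0 mulr_ge0// ltW.
have [Et Et_smooth Et_far] := potential_exists chi_test chi0 d0.
have [Cu uC0] := buc_bounded u_buc.
pose B := Num.max C Cu.
pose U0 z := coord ord0 (u z); pose U1 z := coord ord_max (u z).
have [cU0 cU1] := (@buc_continuous u ord0 u_buc, @buc_continuous u ord_max u_buc).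
have U0B z : `|U0 z| <= B by rewrite le_max (uC0 ord0 z) orbT.
have U1B z : `|U1 z| <= B by rewrite le_max (uC0 ord_max z) orbT.
have omB z : `|om z| <= B by rewrite le_max omC0.
have hdiv phi : test_function phi ->
    \int[@leb2 R]_z (U0 z * partial ord0 phi z) + \int[@leb2 R]_z (U1 z * partial ord_max phi z) = 0.
  move=> tphi; have := u_div phi tphi; rewrite ddivE -opprD.
  by move/eqP; rewrite oppr_eq0 => /eqP.
have hcurl phi : test_function phi ->
    \int[@leb2 R]_z (om z * phi z) =
    \int[@leb2 R]_z (U0 z * partial ord_max phi z) - \int[@leb2 R]_z (U1 z * partial ord0 phi z).
  by move=> tphi; have := om_curl phi tphi; rewrite dcurlE.
have lq := locint_BMO q_BMO.
pose a0 z := - (om z * U1 z); pose a1 z := om z * U0 z.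
have ma0 : meas a0 := meas_a0 cU1 mom.
have ma1 : meas a1 := meas_a1 cU0 mom.
have a0B z : `|a0 z| <= B * B := a0_bounded U1B omB z.
have a1B z : `|a1 z| <= B * B := a1_bounded U0B omB z.
have hq h : test_function h -> forall x,
    conv q (Lap h) x = - (conv a0 (partial ord0 h) x + conv a1 (partial ord_max h) x).
  move=> th x.
  have dp k g : test_function g -> partial k (fun y => g (x - y)) = fun y => - partial k g (x - y).
    by move=> tg; exact: partial_refl (smooth_pderivable (test_smooth tg)).
  have d2 k : partial k (partial k (fun y => h (x - y))) = fun y => partial k (partial k h) (x - y).
    rewrite (dp k _ th) partialN; last first.
      exact: smooth_pderivable (test_smooth (test_refl x (test_partial k th))).
    by rewrite (dp k _ (test_partial k th)) funeqE => y; rewrite opprK.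
  have tphi := test_refl x th; have := q_eq _ tphi; rewrite dlaplacianE ddivE.
  move: d2 (fun k => dp k h th) tphi; move: (fun y => h (x - y)) => phi d2 d1 tphi H.
  have i k := integ_conv x lq (test_partial k (test_partial k th)).
  have E2 k : \int[@leb2 R]_y (q y * partial k (partial k phi) y) =
      \int[@leb2 R]_y (q y * partial k (partial k h) (x - y)).
    by apply: Int_eq => y; rewrite d2.
  have -> : conv q (Lap h) x = \int[@leb2 R]_y (q y * partial ord0 (partial ord0 h) (x - y)) +
      \int[@leb2 R]_y (q y * partial ord_max (partial ord_max h) (x - y)).
    by rewrite -(IntD (i ord0) (i ord_max)); apply: Int_eq => y; rewrite -mulrDr.
  refine (etrans (f_equal2 +%R (esym (E2 ord0)) (esym (E2 ord_max))) _).
  apply: oppr_inj; refine (etrans H (etrans _ (esym (opprK _)))).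
  have [l0 l1] := (locint_bounded ma0 a0B, locint_bounded ma1 a1B).
  have k0 := integ_conv x l0 (test_partial ord0 th).
  have k1 := integ_conv x l1 (test_partial ord_max th).
  congr (_ + _).
    rewrite -mulN1r -IntZ.
      by apply: Int_eq => y; rewrite d1 coord0_perp /a0 /U1; ring.
    apply: integ_eq (integZ (-1) k0) => y.
    by rewrite d1 coord0_perp /a0 /U1; ring.
  rewrite -mulN1r -IntZ.
    by apply: Int_eq => y; rewrite d1 coord1_perp /a1 /U0; ring.
  apply: integ_eq (integZ (-1) k1) => y.
  by rewrite d1 coord1_perp /a1 /U0; ring.
have ip k := integ_chi_pker d0 dr chi_test chi_supp k.
have j0 x := integ_bounded_conv x ma0 a0B (ip ord0).
have j1 x := integ_bounded_conv x ma1 a1B (ip ord_max).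
have mU k : meas (fun z => coord k (u z)) by apply: meas_cont; exact: buc_continuous.
have mUU k l : meas (fun z => coord k (u z) * coord l (u z)) by exact: measM.
have UUB k l z : `|coord k (u z) * coord l (u z)| <= Cu * Cu.
  by rewrite normrM ler_pM.
have iM k l x := integ_bounded_conv x (mUU k l) (UUB k l)
  (integ_test (test_M_kernel d0 chi_test chi1 Et_smooth Et_far k l)).
have iF k l x := far_increment d0 dr chi_test chi1 chi_supp Et_smooth Et_far k l x x0
  (mUU k l) (UUB k l).
have iq2 k l x : integ (q2_integrand chi u k l x).
  by apply: integ_eq (iM k l x) => y; rewrite /q2_integrand; ring.
have iq3 k l x : integ (q3_integrand chi u x0 k l x).
  by apply: integ_eq (iF k l x) => y; rewrite /q3_integrand /far_kernel; ring.
split.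
  move=> x; split; [|by move=> k l; exact: iq2|by move=> k l; exact: iq3].
  have := integZ (-1) (integD (j0 x) (j1 x)); apply: integ_eq => y.
  by rewrite q1_integrandE mulN1r.
have pi0 : pi != 0 :> R by rewrite gt_eqF// pi_gt0.
have E1 x : 2 * pi * q1 chi u om x =
    - (conv a0 (fun z => chi z * pker ord0 z) x + conv a1 (fun z => chi z * pker ord_max z) x).
  rewrite /q1 mulrA divff ?mulf_neq0// mul1r -(IntD (j0 x) (j1 x)) -(IntN (integD (j0 x) (j1 x))).
  by apply: Int_eq => y; rewrite q1_integrandE.
have E2 x : 2 * pi * q2 chi u x =
    2^-1 * (conv (shear0 U0 U1) (near0 chi) x + conv (shear1 U0 U1) (near1 chi) x).
  have -> : conv (shear0 U0 U1) (near0 chi) x =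
      \int[@leb2 R]_y q2_integrand chi u ord0 ord0 x y +
      \int[@leb2 R]_y q2_integrand chi u ord_max ord_max x y.
    rewrite -(IntD (iq2 _ _ x) (iq2 _ _ x)); apply: Int_eq => y.
    by rewrite /q2_integrand M_diag /near0 /shear0 /U0 /U1; ring.
  have -> : conv (shear1 U0 U1) (near1 chi) x =
      \int[@leb2 R]_y q2_integrand chi u ord0 ord_max x y +
      \int[@leb2 R]_y q2_integrand chi u ord_max ord0 x y.
    rewrite -(IntD (iq2 _ _ x) (iq2 _ _ x)); apply: Int_eq => y.
    by rewrite /q2_integrand /near1 /shear1 /U0 /U1; ring.
  rewrite /q2 !sum_ord2; do 4!move: (\int[_]_y _) => ?.
  by move: pi0; move: (@pi R) => p p0; field.
have E3 x : 2 * pi * q3 chi u x x0 =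
    \int[@leb2 R]_y (shear0 U0 U1 y * (far0 chi (x - y) - far0 chi (x0 - y))) +
    \int[@leb2 R]_y (shear1 U0 U1 y * (far1 chi (x - y) - far1 chi (x0 - y))).
  have -> : \int[@leb2 R]_y (shear0 U0 U1 y * (far0 chi (x - y) - far0 chi (x0 - y))) =
      \int[@leb2 R]_y q3_integrand chi u x0 ord0 ord0 x y +
      \int[@leb2 R]_y q3_integrand chi u x0 ord_max ord_max x y.
    rewrite -(IntD (iq3 _ _ x) (iq3 _ _ x)); apply: Int_eq => y.
    by rewrite /q3_integrand !K_diag /far0 /shear0 /U0 /U1; ring.
  have -> : \int[@leb2 R]_y (shear1 U0 U1 y * (far1 chi (x - y) - far1 chi (x0 - y))) =
      \int[@leb2 R]_y q3_integrand chi u x0 ord0 ord_max x y +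
      \int[@leb2 R]_y q3_integrand chi u x0 ord_max ord0 x y.
    rewrite -(IntD (iq3 _ _ x) (iq3 _ _ x)); apply: Int_eq => y.
    by rewrite /q3_integrand /far1 /shear1 /U0 /U1; ring.
  rewrite /q3 !sum_ord2; do 4!move: (\int[_]_y _) => ?.
  by move: pi0; move: (@pi R) => p p0; field.
have inc := pressure_increment d0 dr chi_test chi1 chi_supp Et_smooth Et_far cU0 cU1 mom
  U0B U1B omB hdiv hcurl lq hq (BMO_osc q_BMO).
pose v := pressure Et a0 a1 q.
exists ((2 * pi)^-1 * v x0 - q1 chi u om x0 - q2 chi u x0).
have := pressure_ae d0 Et_smooth Et_far ma0 ma1 a0B a1B lq hq.
apply: (@filterS _ (almost_everywhere (@leb2 R))) => x Ex.
have pi20 : 2 * pi != 0 :> R by rewrite mulf_neq0.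
move: pi20 (E1 x) (E1 x0) (E2 x) (E2 x0) (E3 x) (inc x x0) Ex.
rewrite -/a0 -/a1 -/(v x) -/(v x0).
do 2!move: (q1 _ _ _ _) => ?; do 2!move: (q2 _ _ _) => ?; move: (q3 _ _ _ _) => ?.
do 2!move: (v _) => ?; move: (2 * pi) (q x) => p qx p0.
do 8!move: (conv _ _ _) => ?; do 2!move: (\int[_]_y _) => ?.
move=> ? ? ? ? ? ? ?; apply: (mulfI p0); rewrite !mulrDr !mulrN (mulVKf p0); lra.
Qed.

End Representation.

(** * Modifying the vorticity on a null set *)

Section Truncation.
Context {R : realType}.
Implicit Types (f g h q chi om : R * R -> R) (u : R * R -> R * R) (x y z : R * R)
  (k l : 'I_2).

Lemma ddiv_ae u v phi : (forall k, meas (coord k \o u)) -> (forall k, meas (coord k \o v)) ->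
  {ae @leb2 R, forall z, u z = v z} -> test_function phi -> ddiv u phi = ddiv v phi.
Proof.
move=> mu mv uv tphi; rewrite !ddivE.
have E k : \int[@leb2 R]_y (coord k (u y) * partial k phi y) =
    \int[@leb2 R]_y (coord k (v y) * partial k phi y).
  have mp := meas_test (test_partial k tphi).
  apply: (Int_ae (measM (mu k) mp) (measM (mv k) mp)).
  by apply: (@filterS _ (almost_everywhere (@leb2 R))) uv => z E; rewrite /= E.
by rewrite (E ord0) (E ord_max).
Qed.

Lemma meas_q1_integrand chi u om x : meas chi -> (forall k, meas (coord k \o u)) ->
  meas om -> meas (q1_integrand chi u om x).
Proof.
move=> mchi mu mom.
have mk k : meas (fun y => chi (x - y) * pker k (x - y)).
  exact: measM (meas_refl x mchi) (meas_refl x (meas_pker k)).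
rewrite (_ : q1_integrand chi u om x = fun y =>
    om y * coord ord_max (u y) * (chi (x - y) * pker ord0 (x - y)) -
    om y * coord ord0 (u y) * (chi (x - y) * pker ord_max (x - y))).
  by apply: measB; apply: measM => //; apply: measM => //; exact: mu.
by rewrite funeqE => y; rewrite q1_integrandE; ring.
Qed.

End Truncation.

Theorem lemma4p5 (R : realType) (u : R * R -> R * R)
    (omega chi q : R * R -> R)
    (u_buc : buc u)
    (u_div0 : distr_eq (ddiv u) (fun _ => 0))
    (omega_bounded : omega \in Lfun leb2 +oo%E)
    (omega_curl : distr_eq (distr_of omega) (dcurl u))
    (chi_test : test_function chi)
    (chi_near0 : \forall z \near (0 : R * R), chi z = 1)
    (q_BMO : BMO q)
    (q_eq : distr_eq (fun phi => - dlaplacian q phi)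
                     (ddiv (fun y => omega y *: perp (u y)))) :
  forall x0 : R * R,
    (forall x : R * R, integrals_converge chi u omega x x0) /\
    exists q0 : R, {ae leb2, forall x,
      q x = q0 + q1 chi u omega x + q2 chi u x + q3 chi u x x0}.
Proof.
move=> x0; have [mom [C omC]] := Lfun_bounded omega_bounded.
(* an everywhere bounded representative of [omega] *)
pose om z := Num.max (- `|C|) (Num.min `|C| (omega z)).
have mU k : meas (coord k \o u) by apply: meas_cont; exact: buc_continuous.
have mom' : meas om.
  by apply: measurable_maxr => //; exact: measurable_minr.
have omE : {ae @leb2 R, forall z, omega z = om z}.
  apply: (@filterS _ (almost_everywhere (@leb2 R))) omC => z zC.
  have : `|omega z| <= `|C| by rewrite (le_trans zC) ?ler_norm.
  by rewrite ler_norml => /andP[h1 h2]; rewrite /om (min_r h2) (max_r h1).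
have omC' z : `|om z| <= `|C|.
  have C0 : - `|C| <= `|C| by rewrite (@le_trans _ _ 0)// oppr_le0.
  by rewrite ler_norml /om le_max lexx ge_max C0 ge_min lexx.
have curl' : distr_eq (distr_of om) (dcurl u).
  move=> phi tphi; rewrite -(omega_curl phi tphi); have mp := meas_test tphi.
  apply/esym; apply: (Int_ae (measM mom mp) (measM mom' mp)).
  by apply: (@filterS _ (almost_everywhere (@leb2 R))) omE => z E; rewrite /= E.
have mp (w : R * R -> R) k : meas w -> meas (coord k \o (fun y => w y *: perp (u y))).
  move=> mw; have H := measM mw (mU _); move: k; apply: ord2P; last exact: (H ord0).
  apply: eq_measurable_fun (measB (meas_cont (smooth_continuous (smooth_cst 0))) (H ord_max)).
  by move=> y _ /=; rewrite coord0_perp sub0r.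
have q_eq' : distr_eq (fun phi => - dlaplacian q phi) (ddiv (fun y => om y *: perp (u y))).
  move=> phi tphi; rewrite (q_eq phi tphi).
  apply: ddiv_ae => // [k|k|]; [exact: mp|exact: mp|].
  by apply: (@filterS _ (almost_everywhere (@leb2 R))) omE => z E; rewrite /= E.
have [conv' [q0 Hq]] := representation u_buc u_div0 mom' omC' curl' chi_test chi_near0 q_BMO q_eq' x0.
have m1 x w : meas w -> meas (q1_integrand chi u w x).
  by move=> mw; exact: meas_q1_integrand (meas_test chi_test) mU mw.
have ae1 x : {ae @leb2 R, forall y, q1_integrand chi u om x y = q1_integrand chi u omega x y}.
  apply: (@filterS _ (almost_everywhere (@leb2 R))) omE => y E.
  by rewrite /q1_integrand E.
split; first by move=> x; have [i1 i2 i3] := conv' x; split => //; exact: integ_ae (m1 x _ mom) (ae1 x) i1.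
exists q0; apply: (@filterS _ (almost_everywhere (@leb2 R))) Hq => x ->.
by rewrite /q1 (Int_ae (m1 x _ mom') (m1 x _ mom) (ae1 x)).
Qed.
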